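(* For every $d\ge2$ there exist a finite point set $\mathcal S\subset\mathbb R^d$ and two compact $(d-1)$-dimensional topological submanifolds $\mathcal C,\mathcal C'\subset\mathbb R^d$ without boundary, having different numbers of connected components, such that $\mathcal S\subset\mathcal C\cap\mathcal C'$ and $\mathcal S$ is a $0.72$-sample of both $\mathcal C$ and $\mathcal C'$.
   Context: For a closed set $\mathcal C\subset\mathbb R^d$, the medial axis $\mathcal M$ is the set of points of $\mathbb R^d$ that do not have a unique closest point in $\mathcal C$, $\mathrm{lfs}(p)=d(p,\mathcal M)$ for $p\in\mathcal C$ (Euclidean distance), and a finite set $\mathcal S\subset\mathcal C$ is an $\epsilon$-sample of $\mathcal C$ if $d(p,\mathcal S)<\epsilon\,\mathrm{lfs}(p)$ for all $p\in\mathcal C$. *)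

(* Defs.v *)
(* R^d is modelled as 'rV[R]_d (row vectors) with its
   standard (product) topology, which coincides with the Euclidean topology;
   distances are the Euclidean distance defined explicitly below. *)
From HB Require Import structures.
From mathcomp Require Import all_boot all_order all_algebra.
From mathcomp Require Import all_classical all_reals all_analysis.
Set Implicit Arguments. Unset Strict Implicit. Unset Printing Implicit Defensive.
Import Order.TTheory GRing.Theory Num.Theory numFieldNormedType.Exports.
Local Open Scope classical_set_scope.
Local Open Scope ring_scope.

Section Defs.
Variables (R : realType) (d : nat).
Notation V := 'rV[R]_d.

Definition edist (x y : V) : R :=
  Num.sqrt (\sum_(i < d) (x ord0 i - y ord0 i) ^+ 2).

(* distance from a point to a set (extended real: +oo for the empty set) *)
Definition setdist (p : V) (A : set V) : \bar R :=
  ereal_inf [set (edist p a)%:E | a in A].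

Definition closest (C : set V) (x c : V) : Prop :=
  C c /\ forall c', C c' -> edist x c <= edist x c'.

Definition medial_axis (C : set V) : set V :=
  [set x | ~ (exists! c, closest C x c)].

Definition lfs (C : set V) (p : V) : \bar R := setdist p (medial_axis C).

(* S is an eps-sample of C: S finite, S ⊆ C (the latter stated separately),
   and d(p,S) < eps lfs(p) for all p in C *)
Definition eps_sample (eps : R) (S C : set V) : Prop :=
  finite_set S /\ forall p, C p -> (setdist p S < (eps%:E * lfs C p)%E)%E.

Definition top_submanifold (k : nat) (C : set V) : Prop :=
  forall p, C p -> exists U : set V, [/\ open U, U p &
    exists (f : 'rV[R]_k -> V) (g : V -> 'rV[R]_k),
      [/\ continuous f, range f = U `&` C,
          {within U `&` C, continuous g} &
          (forall y, g (f y) = y)]].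

Definition components (A : set V) : set (set V) :=
  [set connected_component A x | x in A].

End Defs.

(* Main.v *)
(* Both sets are obtained from plane curves with the symmetry group of the square,
   hence determined by their part in the wedge 0 <= y <= x, whose bisecting ray has
   slope sqrt 2 - 1. A chain of tangent arcs starts orthogonally to the x-axis and
   ends at a point s of the bisecting ray; there it continues a circle centred on
   the x-axis and tangent to the ray. The first curve follows this circle down to
   the axis and consists of four closed lobes. The second curve keeps the circular
   cap but replaces the rest by its mirror image in the bisecting ray; it ends
   orthogonally to the diagonal and is a single closed curve. The two curves share
   the caps and the points where the chain crosses the ray. Points at distance less
   than a local radius g from a curve point p have a unique nearest point on the
   curve, and some shared point is within sqrt (15/29) g < 0.72 g of p,
   which leaves room for replacing the shared points by a finite net.
   Revolving around the x-axis shifted by 10 gives hypersurfaces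
   {(v0, w) | (v0, |w| - 10) on the curve} with the same radii g. The first
   coordinate separates the lobes of the first one, which has at least three
   components, while the second one has at most two. *)
Require Import Defs.
From HB Require Import structures.
From mathcomp Require Import all_boot all_order all_algebra.
From mathcomp Require Import all_classical all_reals all_analysis.
From mathcomp Require Import finmap ring lra.
Import Order.TTheory GRing.Theory Num.Theory numFieldNormedType.Exports.
Local Open Scope classical_set_scope.
Local Open Scope ring_scope.
Set Implicit Arguments. Unset Strict Implicit. Unset Printing Implicit Defensive.

(** * Circles and tangent arcs *)

Section Circle.
Variable R : rcfType.
Implicit Types x y px py qx qy dx dy : R.

(** The reflection in the bisecting ray fixes the ray pointwise, so wherever the chain crosses the
    ray the point lies on both curves; the design balances the spacing of these crossings against
    [g]. On the chain, [g] is the smaller of 1, the radius of [arc2], and the distance to the side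
    of the wedge opposite to the start of the chain. Caps belong entirely to the shared set, so
    there any fixed radius will do. Uniqueness of nearest points needs no calculus. Two equidistant
    points of one arc are beaten by the point of the circle midway between them. Two on different
    arcs are beaten by a junction between them, since the curve avoids two discs tangent to each
    other there. Queries on a side of the wedge need separate care, as a nearest point off that side
    would have a mirror twin. All data are rational or enclosed by rationals, so that each estimate
    is a polynomial inequality. In dimension 2 revolving produces two mirror copies, in higher
    dimension it does not; the bounds three and two on the components hold in every case. *)

Definition sqd px py qx qy : R := (px - qx) ^+ 2 + (py - qy) ^+ 2.

(* [J = 0]: if [d] avoids the open discs through [J] centred at [tp n] and
   [- tm n] and lies on the other side of the normal line than [p], then [J]
   is closer to [p] than [d]. *)
Lemma junction_closer n1 n2 (tp tm : R) px py dx dy :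
  0 < n1 ^+ 2 + n2 ^+ 2 -> 0 < dx ^+ 2 + dy ^+ 2 ->
  (dx * n2 - dy * n1) * (px * n2 - py * n1) <= 0 ->
  px * n1 + py * n2 < tp * (n1 ^+ 2 + n2 ^+ 2) ->
  - tm * (n1 ^+ 2 + n2 ^+ 2) < px * n1 + py * n2 ->
  2 * tp * (dx * n1 + dy * n2) <= dx ^+ 2 + dy ^+ 2 ->
  - 2 * tm * (dx * n1 + dy * n2) <= dx ^+ 2 + dy ^+ 2 ->
  px ^+ 2 + py ^+ 2 < (px - dx) ^+ 2 + (py - dy) ^+ 2.
Proof.
set N := n1 ^+ 2 + n2 ^+ 2; set v := dx * n1 + dy * n2.
set b := px * n1 + py * n2; set S := dx ^+ 2 + dy ^+ 2.
move=> N0 S0 ua bp bm dp dm.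
(* The inner product is split along [n] and its orthogonal direction. By [ua] the orthogonal part
   only helps, so it remains to bound [v * b]. *)
have idN : N * (px * dx + py * dy) =
    v * b + (dx * n2 - dy * n1) * (px * n2 - py * n1).
  by rewrite /N /v /b; ring.
suff : 0 < N * (S - 2 * (px * dx + py * dy)).
  rewrite pmulr_rgt0 // => ?; rewrite -subr_gt0.
  by rewrite (_ : _ - _ = S - 2 * (px * dx + py * dy)) // /S; ring.
rewrite mulrBr [N * (2 * _)]mulrCA idN.
suff : 0 < N * S - 2 * (v * b) by lra.
have NS : 0 < N * S by exact: mulr_gt0.
case: (ltrgtP v 0) => v0.
- have : v * b < v * (- tm * N) by rewrite ltr_nM2l.
  have : N * (- 2 * tm * v) <= N * S by rewrite ler_pM2l.
  lra.
- have : v * b < v * (tp * N) by rewrite ltr_pM2l.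
  have : N * (2 * tp * v) <= N * S by rewrite ler_pM2l.
  lra.
- by rewrite v0 mul0r mulr0 subr0.
Qed.

Lemma junction_sqd n1 n2 (tp tm jx jy : R) qx qy x y :
  0 < n1 ^+ 2 + n2 ^+ 2 -> (x != jx) || (y != jy) ->
  ((x - jx) * n2 - (y - jy) * n1) * ((qx - jx) * n2 - (qy - jy) * n1) <= 0 ->
  (qx - jx) * n1 + (qy - jy) * n2 < tp * (n1 ^+ 2 + n2 ^+ 2) ->
  - tm * (n1 ^+ 2 + n2 ^+ 2) < (qx - jx) * n1 + (qy - jy) * n2 ->
  tp ^+ 2 * (n1 ^+ 2 + n2 ^+ 2) <= sqd x y (jx + tp * n1) (jy + tp * n2) ->
  tm ^+ 2 * (n1 ^+ 2 + n2 ^+ 2) <= sqd x y (jx - tm * n1) (jy - tm * n2) ->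
  sqd jx jy qx qy < sqd x y qx qy.
Proof.
rewrite /sqd => N0 ne ua bp bm dp dm.
have d0 : 0 < (x - jx) ^+ 2 + (y - jy) ^+ 2.
  case/orP: ne => ne.
    by rewrite ltr_wpDr ?sqr_ge0 // exprn_even_gt0 // subr_eq0.
  by rewrite ltr_wpDl ?sqr_ge0 // exprn_even_gt0 // subr_eq0.
have := @junction_closer n1 n2 tp tm (qx - jx) (qy - jy) (x - jx) (y - jy) N0 d0
  ua bp bm.
have -> : 2 * tp * ((x - jx) * n1 + (y - jy) * n2) <= (x - jx) ^+ 2 + (y - jy) ^+ 2
  by lra.
have -> : - 2 * tm * ((x - jx) * n1 + (y - jy) * n2) <=
  (x - jx) ^+ 2 + (y - jy) ^+ 2 by lra.
move=> /(_ isT isT); lra.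
Qed.

Lemma bisector_dot (ox oy r x1 y1 x2 y2 qx qy : R) :
  (x1 - ox) ^+ 2 + (y1 - oy) ^+ 2 = r ^+ 2 ->
  (x2 - ox) ^+ 2 + (y2 - oy) ^+ 2 = r ^+ 2 ->
  sqd x1 y1 qx qy = sqd x2 y2 qx qy ->
  (qx - ox) * (x1 + x2 - 2 * ox) + (qy - oy) * (y1 + y2 - 2 * oy) =
    2 * ((qx - ox) * (x1 - ox) + (qy - oy) * (y1 - oy)).
Proof. by rewrite /sqd; lra. Qed.

(** The witness is the radial projection onto the circle of the midpoint of the two points. A query
    closer to them than [r] has positive inner product with the direction of the midpoint, and the
    projection moves the midpoint outwards, by the factor [2 * m]. *)
Lemma bisector_closer (ox oy r x1 y1 x2 y2 qx qy : R) :
  (x1 - ox) ^+ 2 + (y1 - oy) ^+ 2 = r ^+ 2 ->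
  (x2 - ox) ^+ 2 + (y2 - oy) ^+ 2 = r ^+ 2 ->
  sqd x1 y1 qx qy = sqd x2 y2 qx qy -> sqd x1 y1 qx qy < r ^+ 2 ->
  (x1 != x2) || (y1 != y2) ->
  (x1 + x2 - 2 * ox != 0) || (y1 + y2 - 2 * oy != 0) ->
  exists m : R, [/\ 0 < m,
    (m * (x1 + x2 - 2 * ox)) ^+ 2 + (m * (y1 + y2 - 2 * oy)) ^+ 2 = r ^+ 2 &
    sqd (ox + m * (x1 + x2 - 2 * ox)) (oy + m * (y1 + y2 - 2 * oy)) qx qy
      < sqd x1 y1 qx qy].
Proof.
rewrite /sqd => h1 h2 e12 lt ne sne.
set sx := x1 + x2 - _ in sne *; set sy := y1 + y2 - _ in sne *.
have S0 : 0 < sx ^+ 2 + sy ^+ 2.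
  case/orP: sne => ne'; first by rewrite ltr_wpDr ?sqr_ge0 // exprn_even_gt0.
  by rewrite ltr_wpDl ?sqr_ge0 // exprn_even_gt0.
have d0 : 0 < (x1 - x2) ^+ 2 + (y1 - y2) ^+ 2.
  case/orP: ne => ne.
    by rewrite ltr_wpDr ?sqr_ge0 // exprn_even_gt0 // subr_eq0.
  by rewrite ltr_wpDl ?sqr_ge0 // exprn_even_gt0 // subr_eq0.
have r0 : 0 < r ^+ 2.
  by rewrite (le_lt_trans _ lt) // addr_ge0 ?sqr_ge0.
have S4 : sx ^+ 2 + sy ^+ 2 < 4 * r ^+ 2 by rewrite /sx /sy; lra.
pose m := Num.sqrt (r ^+ 2 / (sx ^+ 2 + sy ^+ 2)).
have m0 : 0 < m by rewrite sqrtr_gt0 divr_gt0.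
have m2 : m ^+ 2 * (sx ^+ 2 + sy ^+ 2) = r ^+ 2.
  by rewrite sqr_sqrtr ?divfK ?gt_eqF // ltW // divr_gt0.
have mh : 1 < 2 * m.
  rewrite ltNge; apply/negP => mh.
  have : m ^+ 2 * (sx ^+ 2 + sy ^+ 2) <= 1 / 4 * (sx ^+ 2 + sy ^+ 2).
    by rewrite ler_pM2r //; nra.
  by rewrite m2; lra.
exists m; split=> //; first by rewrite !exprMn -mulrDr.
have e3 : (qx - ox) * sx + (qy - oy) * sy =
    2 * ((qx - ox) * (x1 - ox) + (qy - oy) * (y1 - oy)).
  exact: bisector_dot h1 h2 e12.
have P0 : 0 < (qx - ox) * sx + (qy - oy) * sy.
  by rewrite e3; move: (sqr_ge0 (qx - ox)) (sqr_ge0 (qy - oy)); lra.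
have P1 : (qx - ox) * (x1 - ox) + (qy - oy) * (y1 - oy) <
    (qx - ox) * (m * sx) + (qy - oy) * (m * sy).
  have : (2 * m - 1) * ((qx - ox) * sx + (qy - oy) * sy) > 0.
    by rewrite mulr_gt0 // subr_gt0.
  have -> : (2 * m - 1) * ((qx - ox) * sx + (qy - oy) * sy) =
    2 * ((qx - ox) * (m * sx) + (qy - oy) * (m * sy)) -
    ((qx - ox) * sx + (qy - oy) * sy) by ring.
  by rewrite e3; lra.
have M2 : (m * sx) ^+ 2 + (m * sy) ^+ 2 = r ^+ 2 by rewrite !exprMn -mulrDr.
move: P1 M2 h1; clear; move: (m * sx) (m * sy) => u v; lra.
Qed.

Lemma circle_bounds (x y r : R) : 0 <= r -> x ^+ 2 + y ^+ 2 = r ^+ 2 ->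
  [/\ - r <= x, x <= r, - r <= y & y <= r].
Proof.
move=> r0 h; have a0 := sqr_ge0 x; have b0 := sqr_ge0 y.
have X : `|x| <= `|r| by rewrite -ler_sqr ?nnegrE // !real_normK ?num_real; lra.
have Y : `|y| <= `|r| by rewrite -ler_sqr ?nnegrE // !real_normK ?num_real; lra.
by move: X Y; rewrite (ger0_norm r0) !ler_norml => /andP[? ?] /andP[? ?].
Qed.

Lemma dot_bounds (x y x' y' r r' : R) : 0 <= r -> 0 <= r' ->
  x ^+ 2 + y ^+ 2 = r ^+ 2 -> x' ^+ 2 + y' ^+ 2 = r' ^+ 2 ->
  - (r * r') <= x * x' + y * y' /\ x * x' + y * y' <= r * r'.
Proof.
move=> r0 r'0 h h'.
have e : (x * x' + y * y') ^+ 2 + (x * y' - y * x') ^+ 2 = (r * r') ^+ 2.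
  by rewrite exprMn -h -h'; ring.
by have [] := circle_bounds (mulr_ge0 r0 r'0) e.
Qed.

(** By Cauchy-Schwarz. It excludes queries lying beyond the centre of a tangent disc, because only
    queries at distance below 1 from the curve matter. *)
Lemma far_sqd (n1 n2 r x y qx qy : R) : 0 < r -> n1 ^+ 2 + n2 ^+ 2 = r ^+ 2 ->
  r <= (x - qx) * n1 + (y - qy) * n2 -> 1 <= sqd x y qx qy.
Proof.
move=> r0 h le1.
have e : ((x - qx) * n1 + (y - qy) * n2) ^+ 2 +
  ((x - qx) * n2 - (y - qy) * n1) ^+ 2 = sqd x y qx qy * r ^+ 2.
  by rewrite -h /sqd; ring.
have : r ^+ 2 <= ((x - qx) * n1 + (y - qy) * n2) ^+ 2.
  by rewrite ler_sqr ?nnegrE //; lra.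
move=> h2; have := sqr_ge0 ((x - qx) * n2 - (y - qy) * n1) => h3.
rewrite -(ler_pM2r (exprn_gt0 2 r0)) mul1r -e; lra.
Qed.

Lemma quadrant_le (x y x' y' : R) : 0 <= x -> 0 <= y -> 0 <= x' -> 0 <= y' ->
  x ^+ 2 + y ^+ 2 = x' ^+ 2 + y' ^+ 2 -> x <= x' -> y' <= y.
Proof.
move=> x0 y0 x'0 y'0 h; rewrite -(ler_sqr x0 x'0) -(ler_sqr y'0 y0); lra.
Qed.

(** On a quarter circle the order of abscissae is the order of directions. The latter is linear in
    each point, hence passes to sums; this is how the direction midway between two points of an arc
    is seen to stay within the arc. *)
Lemma quadrant_cone (x y x' y' : R) : 0 <= x -> 0 <= y -> 0 <= x' -> 0 <= y' ->
  x ^+ 2 + y ^+ 2 = x' ^+ 2 + y' ^+ 2 -> (x <= x') = (x * y' <= x' * y).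
Proof.
move=> x0 y0 x'0 y'0 e; apply/idP/idP => H.
  have H' := quadrant_le x0 y0 x'0 y'0 e H.
  by rewrite ler_pM.
rewrite leNgt; apply/negP => lt.
have yy : y < y'.
  by rewrite ltNge; apply/negP => ?; nra.
nra.
Qed.

End Circle.

(** * The arcs *)

(* [q = sqrt 2]; [rc = c sin(pi/8)] is the radius of the cap circle, centred at
   [(c, 0)] and tangent to the ray of slope [q - 1] at [(xs, ys)]; the circle of
   radius [r3] centred at [(29/12, b)] is externally tangent to it at
   [(xJ, yJ)] and has horizontal tangent at [(29/12, 18/17)]. *)
Record config (R : realFieldType) := Config {
  q : R; rc : R; r3 : R; b : R; xJ : R; yJ : R; xs : R; ys : R;
  q_bounds : 41 / 29 < q /\ q < 58 / 41;
  q_sq : q ^+ 2 = 2;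
  rc_bounds : 7 / 5 < rc /\ rc < 45 / 32;
  rc_sq : rc ^+ 2 = 121 / 36 * (2 - q);
  r3_bounds : 31 / 30 < r3 /\ r3 < 26 / 25;
  b_def : b = 18 / 17 + r3;
  tangency : (5 / 4) ^+ 2 + b ^+ 2 = (r3 + rc) ^+ 2;
  xJ_bounds : 44 / 15 < xJ /\ xJ < 59 / 20;
  yJ_bounds : 6 / 5 < yJ /\ yJ < 23 / 19;
  J_collinear : r3 * (xJ - 11 / 3) = rc * (29 / 12 - xJ) /\
                r3 * yJ = rc * (b - yJ);
  J_cap : (xJ - 11 / 3) ^+ 2 + yJ ^+ 2 = rc ^+ 2;
  J_arc : (xJ - 29 / 12) ^+ 2 + (yJ - b) ^+ 2 = r3 ^+ 2;
  s_bounds : [/\ 25 / 8 < xs, xs < 47 / 15, 22 / 17 < ys & ys < 13 / 10];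
  s_def : xs = 11 / 12 * (2 + q) /\ ys = 11 / 12 * q;
  s_cap : (xs - 11 / 3) ^+ 2 + ys ^+ 2 = rc ^+ 2;
  s_ray : ys = (q - 1) * xs
}.

Lemma config_exists (R : rcfType) : inhabited (config R).
Proof.
pose q : R := Num.sqrt 2.
have q2 : q ^+ 2 = 2 by rewrite sqr_sqrtr.
have q0 : 0 <= q by exact: sqrtr_ge0.
(* Enclosures here are tighter than those kept in [config], to survive the propagation through [rc],
   [r3] and [m]. *)
have qb : 239 / 169 < q /\ q < 577 / 408 by split; nra.
pose rc : R := Num.sqrt (121 / 36 * (2 - q)).
have rc2 : rc ^+ 2 = 121 / 36 * (2 - q) by rewrite sqr_sqrtr //; lra.
have rc0 : 0 <= rc by exact: sqrtr_ge0.
clearbody q rc.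
have rcb : 94 / 67 < rc /\ rc < 87 / 62 by split; nra.
(* The squares of [r3] cancel in the tangency equation, which is therefore linear in [r3]. *)
pose r3 := ((5 / 4) ^+ 2 + (18 / 17) ^+ 2 - rc ^+ 2) / (2 * (rc - 18 / 17)).
have r3E : r3 * (2 * (rc - 18 / 17)) = (5 / 4) ^+ 2 + (18 / 17) ^+ 2 - rc ^+ 2.
  by rewrite divfK // gt_eqF //; lra.
clearbody r3.
have r3b : 28 / 27 < r3 /\ r3 < 26 / 25 by clear -r3E rc2 qb rcb; split; nra.
have tg : (5 / 4) ^+ 2 + (18 / 17 + r3) ^+ 2 = (r3 + rc) ^+ 2 by clear -r3E; lra.
pose b := 18 / 17 + r3.
(* The point of tangency divides the segment from the centre of the cap circle to the other centre
   in the ratio of the radii. *)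
pose m := rc / (rc + r3).
have mE : m * (rc + r3) = rc by rewrite divfK // gt_eqF //; clear -rcb r3b; lra.
have mb : 31 / 54 < m /\ m < 19 / 33
  by clear -mE rcb r3b; clearbody m; split; nra.
clearbody m.
have J1 : (11 / 3 - 5 / 4 * m - 11 / 3) ^+ 2 + (b * m) ^+ 2 = rc ^+ 2.
  have -> : (11 / 3 - 5 / 4 * m - 11 / 3) ^+ 2 + (b * m) ^+ 2 =
    m ^+ 2 * ((5 / 4) ^+ 2 + (18 / 17 + r3) ^+ 2) by rewrite /b; ring.
  by rewrite tg (addrC r3) -exprMn mE.
have J2 : (11 / 3 - 5 / 4 * m - 29 / 12) ^+ 2 + (b * m - b) ^+ 2 = r3 ^+ 2.
  have -> : (11 / 3 - 5 / 4 * m - 29 / 12) ^+ 2 + (b * m - b) ^+ 2 =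
    (1 - m) ^+ 2 * ((5 / 4) ^+ 2 + (18 / 17 + r3) ^+ 2) by rewrite /b; field.
  have r3m : r3 = (1 - m) * (rc + r3) by clear -mE; lra.
  by rewrite tg (addrC r3) -exprMn -r3m.
have J3 : r3 * m = rc * (1 - m) by clear -mE; lra.
have qw : 41 / 29 < q /\ q < 58 / 41 by clear -qb; split; lra.
have rw : 7 / 5 < rc /\ rc < 45 / 32 by clear -rcb; split; lra.
have r3w : 31 / 30 < r3 /\ r3 < 26 / 25 by clear -r3b; split; lra.
constructor; apply: (@Config R q rc r3 b (11 / 3 - 5 / 4 * m) (b * m)
  (11 / 12 * (2 + q)) (11 / 12 * q)) => //.
- by clear -mb; split; lra.
- by rewrite /b; clear -mb r3b; split; nra.
- by rewrite mulrCA J3; clear -J3; split; lra.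
- by clear -qb; split; lra.
- by clear -rc2 q2; lra.
- by clear -q2; lra.
Qed.

Section Arcs.
Variables (R : rcfType) (K : config R).
Implicit Types x y : R.

(* the reflection in the ray through [(xs, ys)] *)
Definition rx x y : R := q K / 2 * (x + y).
Definition ry x y : R := q K / 2 * (x - y).

Definition arc1 x y := x = 17 / 12 /\ 0 <= y <= 1 / 17.
Definition arc2 x y :=
  [/\ x <= 29 / 12, 1 / 17 <= y & (x - 29 / 12) ^+ 2 + (y - 1 / 17) ^+ 2 = 1].
Definition arc3 x y := [/\ 29 / 12 <= x, x <= xJ K, y <= b K &
  (x - 29 / 12) ^+ 2 + (y - b K) ^+ 2 = r3 K ^+ 2].
Definition cap_circle x y := (x - 11 / 3) ^+ 2 + y ^+ 2 = rc K ^+ 2.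
Definition arc4 x y := [/\ xJ K <= x, x <= xs K, 0 <= y & cap_circle x y].
Definition cap x y := [/\ xs K <= x, 0 <= y & cap_circle x y].
Definition inner x y := [\/ arc1 x y, arc2 x y, arc3 x y | arc4 x y].
(* The part of the curve in the wedge: of the curve with four lobes for [d = true],
   and of the connected curve, seen through the reflection, for [d = false]. *)
Definition wing (d : bool) x y :=
  inner x y \/ if d then cap x y else cap (rx x y) (ry x y).

Lemma half_q_sq : q K ^+ 2 / 2 = 1.
Proof. by rewrite q_sq; lra. Qed.

Lemma rxK x y : rx (rx x y) (ry x y) = x.
Proof.
transitivity (q K ^+ 2 / 2 * x); first by rewrite /rx /ry; field.
by rewrite half_q_sq mul1r.
Qed.

Lemma ryK x y : ry (rx x y) (ry x y) = y.
Proof.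
transitivity (q K ^+ 2 / 2 * y); first by rewrite /rx /ry; field.
by rewrite half_q_sq mul1r.
Qed.

Lemma refl_sqd x y x' y' :
  sqd (rx x y) (ry x y) (rx x' y') (ry x' y') = sqd x y x' y'.
Proof.
transitivity (q K ^+ 2 / 2 * sqd x y x' y'); last by rewrite half_q_sq mul1r.
by rewrite /rx /ry /sqd; field.
Qed.

Lemma refl_s : rx (xs K) (ys K) = xs K /\ ry (xs K) (ys K) = ys K.
Proof. by have := q_sq K; have [-> ->] := s_def K; rewrite /rx /ry => ?; split; nra. Qed.

Lemma arc2_bounds x y : arc2 x y -> 17 / 12 <= x /\ y <= 18 / 17.
Proof.
case=> hx hy h; have h' : (x - 29 / 12) ^+ 2 + (y - 1 / 17) ^+ 2 = 1 ^+ 2 by rewrite expr1n.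
by have [? _ _ ?] := circle_bounds ler01 h'; split; lra.
Qed.

Lemma arc3_bounds x y : arc3 x y -> 18 / 17 <= y /\ y <= yJ K.
Proof.
case=> x1 x2 yb h; have hJ := J_arc K; have bE := b_def K.
have [yJ1 yJ2] := yJ_bounds K; have [r31 r32] := r3_bounds K.
have r0 : 0 <= r3 K by lra.
have [_ _ ? ?] := circle_bounds r0 h.
split; first by lra.
have : b K - yJ K <= b K - y; last by lra.
by apply: (quadrant_le (x := x - 29 / 12) (x' := xJ K - 29 / 12)); lra.
Qed.

Lemma arc4_bounds x y : arc4 x y -> yJ K <= y /\ y <= ys K.
Proof.
case=> x1 x2 y0; rewrite /cap_circle => h; have hJ := J_cap K; have hs := s_cap K.
have [_ xs2 ys1 _] := s_bounds K; have [yJ1 _] := yJ_bounds K.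
split.
  by apply: (quadrant_le (x := 11 / 3 - x) (x' := 11 / 3 - xJ K)); lra.
by apply: (quadrant_le (x := 11 / 3 - xs K) (x' := 11 / 3 - x)); lra.
Qed.

Lemma cap_bounds x y : cap x y -> y <= rc K /\ x <= 11 / 3 + rc K.
Proof.
case=> _ _ h; have [r1 _] := rc_bounds K; have r0 : 0 <= rc K by lra.
by have [_ ? _ ?] := circle_bounds r0 h; split; lra.
Qed.

(** The cap rises from [s] over the top of its circle and descends on the other side, so a point
    lower than [s] lies beyond the mirror image of [s] in the vertical through the centre. *)
Lemma cap_dich x y : cap x y -> ys K <= y \/ 2 * (11 / 3) - xs K <= x.
Proof.
case=> x1 y0; rewrite /cap_circle => h; have hs := s_cap K.
have [_ xs2 ys1 _] := s_bounds K.
case: (lerP (ys K) y) => yy; [by left | right].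
case: (lerP (11 / 3) x) => xc.
  have h2 : ys K ^+ 2 - y ^+ 2 >= 0 by rewrite subr_ge0 ler_sqr ?nnegrE; lra.
  have : 11 / 3 - xs K <= x - 11 / 3; last by lra.
  by rewrite -ler_sqr ?nnegrE; lra.
have : ys K <= y; last by lra.
by apply: (quadrant_le (x := 11 / 3 - x) (x' := 11 / 3 - xs K)); lra.
Qed.

(** The coordinates of the reflected point are the sum and the difference of the old ones, up to a
    common factor; on the cap neither falls below its value at [s], which the reflection fixes. *)
Lemma cap_up_bounds x y : cap (rx x y) (ry x y) -> xs K <= x /\ ys K <= y.
Proof.
have [sx sy] := refl_s; have xE := rxK x y; have yE := ryK x y.
move: xE yE; move: (rx x y) (ry x y) => X Y xE yE H.
have q0 : 0 < q K / 2 by have [? ?] := q_bounds K; lra.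
suff [h1 h2] : xs K + ys K <= X + Y /\ xs K - ys K <= X - Y.
  by split; [rewrite -sx -xE | rewrite -sy -yE]; rewrite ler_pM2l.
have := cap_dich H; case: H; rewrite /cap_circle => x1 y0 h.
have hs := s_cap K; have [xs1 xs2 ys1 ys2] := s_bounds K.
have [r1 r2] := rc_bounds K; have r0 : 0 <= rc K by lra.
have [_ _ _ yr] := circle_bounds r0 h.
case=> [yy|xx]; split.
- by lra.
- case: (lerP (11 / 3) X) => Xc; first by lra.
  have : (xs K - X + Y - ys K) * (Y + ys K) <= 0; last by rewrite pmulr_lle0; lra.
  have -> : (xs K - X + Y - ys K) * (Y + ys K) =
     (xs K - X) * (Y + ys K - (11 / 3 - xs K + 11 / 3 - X)) by lra.
  by rewrite mulr_le0_ge0; lra.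
- have : rc K ^+ 2 <= (X - 11 / 3 + Y) ^+ 2.
    have h3 : 0 <= (X - 11 / 3) * Y by rewrite mulr_ge0; lra.
    by rewrite -h; lra.
  by rewrite ler_sqr ?nnegrE; lra.
- by lra.
Qed.

Lemma inner_bounds x y : inner x y -> [/\ 17 / 12 <= x, x <= xs K, 0 <= y & y <= ys K].
Proof.
have [xs1 xs2 ys1 ys2] := s_bounds K; have [xJ1 xJ2] := xJ_bounds K.
have [yJ1 yJ2] := yJ_bounds K.
case=> H.
- by case: H => -> /andP[? ?]; split; lra.
- by have [? ?] := arc2_bounds H; case: H => ? ? _; split; lra.
- by have [? ?] := arc3_bounds H; case: H => ? ? _ _; split; lra.
- by have [? ?] := arc4_bounds H; case: H => ? ? _ _; split; lra.
Qed.

End Arcs.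

(** * Points nearest to two arcs *)

Section Pairs.
Variables (R : rcfType) (K : config R).
Implicit Types x y : R.
Variables qx qy t : R.
Hypotheses (t1 : t < 1) (qy0 : 0 <= qy).
Local Notation D x y := (sqd x y qx qy).

Lemma inside_unit (x y : R) : D x y = t -> 1 <= (x - qx) ^+ 2 \/ 1 <= (y - qy) ^+ 2 -> False.
Proof.
move=> e h; move: t1; rewrite -e /sqd; have := sqr_ge0 (x - qx); have := sqr_ge0 (y - qy).
by case: h; lra.
Qed.

Lemma shiftK (a u : R) : a + u - a = u.
Proof. by rewrite addrC addKr. Qed.

Lemma shiftB (a c : R) : a + (c - a) = c.
Proof. by rewrite addrC subrK. Qed.

Lemma sqdC (a c a' c' : R) : sqd a c a' c' = sqd a' c' a c.
Proof. by rewrite /sqd; ring. Qed.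

Lemma sqr_ge1 (u : R) : 1 <= u \/ u <= -1 -> 1 <= u ^+ 2.
Proof. by case=> ?; nra. Qed.

(** The query lies on one side of the normal line at the junction; the nearest point on the other
    side would lose against the junction, so it is the junction. The factors [tp] and [tm] allow
    different radii for the two discs. *)
Lemma pair_at n1 n2 (tp tm jx jy x1 y1 x2 y2 : R) :
  0 < n1 ^+ 2 + n2 ^+ 2 -> t <= D jx jy -> D x1 y1 = t -> D x2 y2 = t ->
  (x1 - jx) * n2 - (y1 - jy) * n1 <= 0 -> 0 <= (x2 - jx) * n2 - (y2 - jy) * n1 ->
  (qx - jx) * n1 + (qy - jy) * n2 < tp * (n1 ^+ 2 + n2 ^+ 2) ->
  - tm * (n1 ^+ 2 + n2 ^+ 2) < (qx - jx) * n1 + (qy - jy) * n2 ->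
  tp ^+ 2 * (n1 ^+ 2 + n2 ^+ 2) <= sqd x1 y1 (jx + tp * n1) (jy + tp * n2) ->
  tm ^+ 2 * (n1 ^+ 2 + n2 ^+ 2) <= sqd x1 y1 (jx - tm * n1) (jy - tm * n2) ->
  tp ^+ 2 * (n1 ^+ 2 + n2 ^+ 2) <= sqd x2 y2 (jx + tp * n1) (jy + tp * n2) ->
  tm ^+ 2 * (n1 ^+ 2 + n2 ^+ 2) <= sqd x2 y2 (jx - tm * n1) (jy - tm * n2) ->
  (x1 = jx /\ y1 = jy) \/ (x2 = jx /\ y2 = jy).
Proof.
move=> N0 tJ D1 D2 u1 u2 bp bm d1p d1m d2p d2m.
case: (lerP 0 ((qx - jx) * n2 - (qy - jy) * n1)) => a0.
  left; case: (eqVneq x1 jx) => [ex|nx]; last first.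
    have := junction_sqd N0 _ (mulr_le0_ge0 u1 a0) bp bm d1p d1m.
    by rewrite nx D1 ltNge tJ => /(_ isT).
  split=> //; apply/eqP/negPn/negP => ny.
  have := junction_sqd N0 _ (mulr_le0_ge0 u1 a0) bp bm d1p d1m.
  by rewrite ny orbT D1 ltNge tJ => /(_ isT).
right; case: (eqVneq x2 jx) => [ex|nx]; last first.
  have := junction_sqd N0 _ (mulr_ge0_le0 u2 (ltW a0)) bp bm d2p d2m.
  by rewrite nx D2 ltNge tJ => /(_ isT).
split=> //; apply/eqP/negPn/negP => ny.
have := junction_sqd N0 _ (mulr_ge0_le0 u2 (ltW a0)) bp bm d2p d2m.
by rewrite ny orbT D2 ltNge tJ => /(_ isT).
Qed.

Lemma arc1_arc1 x1 y1 x2 y2 : (forall x y, arc1 x y -> t <= D x y) ->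
  arc1 x1 y1 -> arc1 x2 y2 -> D x1 y1 = t -> D x2 y2 = t -> x1 = x2 /\ y1 = y2.
Proof.
move=> Hm [-> /andP[a1 b1]] [-> /andP[a2 b2]]; rewrite /sqd => e1 e2; split=> //.
have : t <= D (17 / 12) ((y1 + y2) / 2) by apply: Hm; split=> //; apply/andP; lra.
rewrite /sqd => hm; have : (y1 - y2) ^+ 2 <= 0 by lra.
by move=> ?; apply/eqP; rewrite -subr_eq0 -sqrf_eq0 eq_le sqr_ge0 andbT.
Qed.

(** The last condition on [P] asks that the arc contain the radial projection of the midpoint; two
    distinct nearest points would make it strictly nearer. *)
Lemma same_circle (P : R -> R -> Prop) ox oy (r : R) x1 y1 x2 y2 :
  1 <= r -> (forall x y, P x y -> t <= D x y) ->
  (forall x y, P x y -> (x - ox) ^+ 2 + (y - oy) ^+ 2 = r ^+ 2) ->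
  P x1 y1 -> P x2 y2 ->
  (x1 + x2 - 2 * ox != 0) || (y1 + y2 - 2 * oy != 0) ->
  (forall m, 0 < m ->
    (m * (x1 + x2 - 2 * ox)) ^+ 2 + (m * (y1 + y2 - 2 * oy)) ^+ 2 = r ^+ 2 ->
    P (ox + m * (x1 + x2 - 2 * ox)) (oy + m * (y1 + y2 - 2 * oy))) ->
  D x1 y1 = t -> D x2 y2 = t -> x1 = x2 /\ y1 = y2.
Proof.
move=> r1 Hm cP P1 P2 ne Hs e1 e2.
have tr : t < r ^+ 2 by apply: (lt_le_trans t1); rewrite exprn_ege1.
case: (boolP ((x1 != x2) || (y1 != y2))) => [nq|]; last first.
  by rewrite negb_or !negbK => /andP[/eqP -> /eqP ->].
have [m [m0 hc]] := bisector_closer (cP _ _ P1) (cP _ _ P2) (etrans e1 (esym e2))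
  (eq_ind_r (fun u => u < _) tr e1) nq ne.
by rewrite e1 ltNge (Hm _ _ (Hs m m0 hc)).
Qed.

Lemma arc2_arc2 x1 y1 x2 y2 : (forall x y, arc2 x y -> t <= D x y) ->
  arc2 x1 y1 -> arc2 x2 y2 -> D x1 y1 = t -> D x2 y2 = t -> x1 = x2 /\ y1 = y2.
Proof.
move=> Hm a1 a2; apply: (same_circle (P := arc2 (R := R)) (ox := 29 / 12)
  (oy := 1 / 17) (r := 1)) => //.
- by move=> x y [_ _]; rewrite expr1n.
- case: a1 a2 => u1 v1 h1 [u2 v2 h2]; rewrite -negb_and; apply/negP => /andP[/eqP ex /eqP ey].
  have zx : x1 = 29 / 12 by lra.
  have zy : y1 = 1 / 17 by lra.
  by move: h1; rewrite zx zy !subrr expr0n /=; lra.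
- case: a1 a2 => u1 v1 h1 [u2 v2 h2] m m0 hm; clear -u1 v1 u2 v2 m0 hm; split.
  + by rewrite gerDl pmulr_rle0 //; lra.
  + by rewrite lerDl pmulr_rge0 //; lra.
  + by rewrite !shiftK hm expr1n.
Qed.

Lemma arc3_arc3 x1 y1 x2 y2 : (forall x y, arc3 K x y -> t <= D x y) ->
  arc3 K x1 y1 -> arc3 K x2 y2 -> D x1 y1 = t -> D x2 y2 = t -> x1 = x2 /\ y1 = y2.
Proof.
move=> Hm a1 a2; have [r31 _] := r3_bounds K; have hJ := J_arc K.
have [_ ?] := yJ_bounds K; have ? := b_def K; have [? _] := xJ_bounds K.
apply: (same_circle (P := arc3 K) (ox := 29 / 12) (oy := b K) (r := r3 K)) => //.
- by lra.
- by move=> x y [].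
- have [? ?] := arc3_bounds a1; have [? ?] := arc3_bounds a2.
  by apply/orP; right; rewrite lt_eqF //; lra.
- have [? ?] := arc3_bounds a1; have [? ?] := arc3_bounds a2.
  case: a1 a2 => u1 v1 w1 h1 [u2 v2 w2 h2] m m0 hm.
  have x0 : 0 <= m * (x1 + x2 - 2 * (29 / 12)) by rewrite pmulr_rge0 //; lra.
  have y0 : m * (y1 + y2 - 2 * b K) <= 0 by rewrite pmulr_rle0 //; lra.
  have c1 : (x1 - 29 / 12) * (b K - yJ K) <= (xJ K - 29 / 12) * (b K - y1).
    by rewrite -quadrant_cone; lra.
  have c2 : (x2 - 29 / 12) * (b K - yJ K) <= (xJ K - 29 / 12) * (b K - y2).
    by rewrite -quadrant_cone; lra.
  split; rewrite ?gerDl ?lerDl //; last by rewrite !shiftK.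
  rewrite -lerBrDl (quadrant_cone (y := - (m * (y1 + y2 - 2 * b K)))
    (y' := b K - yJ K)) //; try lra.
  have : 0 <= m * ((xJ K - 29 / 12) * (b K - y1) - (x1 - 29 / 12) * (b K - yJ K)
     + ((xJ K - 29 / 12) * (b K - y2) - (x2 - 29 / 12) * (b K - yJ K))).
    by rewrite pmulr_rge0 //; lra.
  by clear; lra.
Qed.

End Pairs.

(** * Nearest points on the cap circle *)

Section CapPairs.
Variables (R : rcfType) (K : config R).
Implicit Types x y : R.

Lemma arc4_s : arc4 K (xs K) (ys K).
Proof.
have [? ? ? ?] := s_bounds K; have [_ ?] := xJ_bounds K.
by split; [lra | lra | lra | exact: s_cap].
Qed.

Lemma cap_s : cap K (xs K) (ys K).
Proof. by have [? ? ? ?] := s_bounds K; split; [lra | lra | exact: s_cap]. Qed.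

(** The centres are [r3 + rc] apart, so a point at distance [r3] from one is at distance at least
    [rc] from the other. *)
Lemma arc3_out_cap x y : (x - 29 / 12) ^+ 2 + (y - b K) ^+ 2 = r3 K ^+ 2 ->
  rc K ^+ 2 <= (x - 11 / 3) ^+ 2 + y ^+ 2.
Proof.
have tg := tangency K; have [r31 _] := r3_bounds K; have [r1 _] := rc_bounds K => h.
have tg' : (- (5 / 4)) ^+ 2 + b K ^+ 2 = (r3 K + rc K) ^+ 2 by rewrite sqrrN.
have r30 : 0 <= r3 K by lra.
have rr0 : 0 <= r3 K + rc K by lra.
by have [d _] := dot_bounds r30 rr0 h tg'; lra.
Qed.

Lemma cap_out_arc3 x y : cap_circle K x y ->
  r3 K ^+ 2 <= (x - 29 / 12) ^+ 2 + (y - b K) ^+ 2.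
Proof.
have tg := tangency K; have [r31 _] := r3_bounds K; have [r1 _] := rc_bounds K => h.
have tg' : (5 / 4) ^+ 2 + (- b K) ^+ 2 = (r3 K + rc K) ^+ 2 by rewrite sqrrN.
have r30 : 0 <= rc K by lra.
have rr0 : 0 <= r3 K + rc K by lra.
by have [d _] := dot_bounds r30 rr0 h tg'; rewrite /cap_circle in h; lra.
Qed.

Lemma arc4_cone x y : arc4 K x y ->
  (11 / 3 - xs K) * y <= (11 / 3 - x) * ys K /\
  (11 / 3 - x) * yJ K <= (11 / 3 - xJ K) * y.
Proof.
have hJ := J_cap K; have hs := s_cap K.
have [yJ1 _] := yJ_bounds K; have [_ xs2 ys1 _] := s_bounds K.
case; rewrite /cap_circle => xa xb ya h.
have x0 : 0 <= 11 / 3 - x by clear -K xb xs2; lra.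
have xJ0 : 0 <= 11 / 3 - xJ K by clear -K xa xb xs2; lra.
have xs0 : 0 <= 11 / 3 - xs K by clear -K xs2; lra.
have ys0 : 0 <= ys K by clear -K ys1; lra.
have yJ0 : 0 <= yJ K by clear -K yJ1; lra.
split; rewrite -quadrant_cone // ?lerD2l ?lerN2 //.
  by clear -K hs h; lra.
by clear -K hJ h; lra.
Qed.

Lemma cap_cone x y : cap K x y -> (11 / 3 - x) * ys K <= (11 / 3 - xs K) * y.
Proof.
have hs := s_cap K; have [_ xs2 ys1 _] := s_bounds K.
case; rewrite /cap_circle => xa ya h.
have xs0 : 0 <= 11 / 3 - xs K by clear -K xs2; lra.
have ys0 : 0 <= ys K by clear -K ys1; lra.
case: (lerP (11 / 3) x) => xc.
  apply: (@le_trans _ _ 0); last exact: mulr_ge0.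
  by rewrite mulr_le0_ge0 // subr_le0.
rewrite -quadrant_cone // ?lerD2l ?lerN2 // ?subr_ge0 ?(ltW xc) //.
by clear -K hs h; lra.
Qed.

Variables qx qy t : R.
Hypotheses (t1 : t < 1) (qy0 : 0 <= qy).
Local Notation D x y := (sqd x y qx qy).

Lemma arc4_arc4 x1 y1 x2 y2 : (forall x y, arc4 K x y -> t <= D x y) ->
  arc4 K x1 y1 -> arc4 K x2 y2 -> D x1 y1 = t -> D x2 y2 = t -> x1 = x2 /\ y1 = y2.
Proof.
move=> Hm a1 a2; have [r1 _] := rc_bounds K.
have hJ := J_cap K; have hs := s_cap K.
have [yJ1 _] := yJ_bounds K; have [_ xs2 ys1 _] := s_bounds K.
apply: (same_circle t1 (P := arc4 K) (ox := 11 / 3) (oy := 0) (r := rc K)) => //.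
- by lra.
- by move=> x y [_ _ _]; rewrite subr0.
- have [? ?] := arc4_bounds a1; have [? ?] := arc4_bounds a2.
  by apply/orP; right; rewrite gt_eqF //; lra.
move=> m m0 hm; have [u1 v1 w1 h1] := a1; have [u2 v2 w2 h2] := a2; rewrite /cap_circle in h1 h2.
have x0 : m * (x1 + x2 - 2 * (11 / 3)) <= 0.
  by rewrite pmulr_rle0 //; clear -K t1 qy0 v1 v2 xs2; lra.
have y0 : 0 <= m * (y1 + y2 - 2 * 0) by rewrite pmulr_rge0 // mulr0 subr0 addr_ge0.
have xn : 0 <= - (m * (x1 + x2 - 2 * (11 / 3))) by rewrite oppr_ge0.
have xJ0 : 0 <= 11 / 3 - xJ K by clear -K t1 qy0 u1 v1 xs2; lra.
have xs0 : 0 <= 11 / 3 - xs K by clear -K t1 qy0 xs2; lra.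
have ys0 : 0 <= ys K by clear -K t1 qy0 ys1; lra.
have yJ0 : 0 <= yJ K by clear -K t1 qy0 yJ1; lra.
have [p1 p1'] := arc4_cone a1; have [p2 p2'] := arc4_cone a2.
split=> //; rewrite ?add0r //; last by rewrite /cap_circle shiftK.
- rewrite -lerBlDl -lerN2 opprB (quadrant_cone (x := - (m * _))
    (y := m * (y1 + y2 - 2 * 0)) (y' := yJ K)) //; last by clear -K t1 qy0 hm hJ; lra.
  have : 0 <= m * ((11 / 3 - xJ K) * y1 - (11 / 3 - x1) * yJ K +
                   ((11 / 3 - xJ K) * y2 - (11 / 3 - x2) * yJ K)).
    by rewrite pmulr_rge0 // addr_ge0 // subr_ge0.
  by clear; lra.
- rewrite -lerBrDl -lerN2 opprB (quadrant_cone (x' := - (m * _))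
    (y' := m * (y1 + y2 - 2 * 0)) (y := ys K)) //; last by clear -K t1 qy0 hm hs; lra.
  have : 0 <= m * ((11 / 3 - x1) * ys K - (11 / 3 - xs K) * y1 +
                   ((11 / 3 - x2) * ys K - (11 / 3 - xs K) * y2)).
    by rewrite pmulr_rge0 // addr_ge0 // subr_ge0.
  by clear; lra.
Qed.

Lemma cap_cap x1 y1 x2 y2 : (forall x y, cap K x y -> t <= D x y) ->
  cap K x1 y1 -> cap K x2 y2 -> D x1 y1 = t -> D x2 y2 = t -> x1 = x2 /\ y1 = y2.
Proof.
move=> Hm a1 a2; have [r1 _] := rc_bounds K; have hs := s_cap K.
have [xs1 xs2 ys1 _] := s_bounds K.
apply: (same_circle t1 (P := cap K) (ox := 11 / 3) (oy := 0) (r := rc K)) => //.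
- by lra.
- by move=> x y [_ _]; rewrite subr0.
- case: a1 a2 => u1 v1 h1 [u2 v2 h2]; rewrite -negb_and; apply/negP => /andP[/eqP ex /eqP ey].
  have zy : y1 = 0 by lra.
  move: h1; rewrite /cap_circle zy expr0n addr0 => h1.
  have : (x1 - 11 / 3) ^+ 2 <= (11 / 3 - xs K) ^+ 2.
    have : 0 <= (x1 - xs K) * (2 * (11 / 3) - xs K - x1) by rewrite mulr_ge0; lra.
    by lra.
  have : 0 < ys K ^+ 2 by rewrite exprn_gt0 //; lra.
  by lra.
move=> m m0 hm; have [u1 v1 h1] := a1; have [u2 v2 h2] := a2; rewrite /cap_circle in h1 h2.
have y0 : 0 <= m * (y1 + y2 - 2 * 0) by rewrite pmulr_rge0 // mulr0 subr0 addr_ge0.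
have xs0 : 0 <= 11 / 3 - xs K by clear -K t1 qy0 xs2; lra.
have ys0 : 0 <= ys K by clear -K t1 qy0 ys1; lra.
have p1 := cap_cone a1; have p2 := cap_cone a2.
split=> //; rewrite ?add0r //; last by rewrite /cap_circle shiftK.
rewrite -lerBlDl; case: (lerP 0 (m * (x1 + x2 - 2 * (11 / 3)))) => M0.
  by apply: le_trans M0; rewrite subr_le0 -subr_ge0.
rewrite -lerN2 opprB (quadrant_cone (x := - (m * _))
    (y := m * (y1 + y2 - 2 * 0)) (y' := ys K)) //; [|by rewrite oppr_ge0 ltW|by clear -K t1 qy0 hm hs; lra].
have : 0 <= m * ((11 / 3 - xs K) * y1 - (11 / 3 - x1) * ys K +
                   ((11 / 3 - xs K) * y2 - (11 / 3 - x2) * ys K)).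
  by rewrite pmulr_rge0 // addr_ge0 // subr_ge0.
by clear; lra.
Qed.

End CapPairs.

(** * Nearest points on both sides of the first two junctions *)

Section ArcPairs.
Variables (R : rcfType) (K : config R).
Implicit Types x y : R.
Variables qx qy t : R.
Hypotheses (t1 : t < 1) (qy0 : 0 <= qy).
Local Notation D x y := (sqd x y qx qy).

Lemma far_contra (x y : R) : D x y = t -> 1 <= D x y -> False.
Proof. by move=> e; rewrite e leNgt t1. Qed.

Lemma arc1_arc2 x1 y1 x2 y2 : (forall x y, arc1 x y -> t <= D x y) ->
  (forall x y, arc2 x y -> t <= D x y) ->
  arc1 x1 y1 -> arc2 x2 y2 -> D x1 y1 = t -> D x2 y2 = t -> x1 = x2 /\ y1 = y2.
Proof.
move=> H1 H2 a1 a2 e1 e2; have [b2 _] := arc2_bounds a2.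
have j1 : arc1 (17 / 12 : R) (1 / 17) by split=> //; apply/andP; split; lra.
have j2 : arc2 (17 / 12 : R) (1 / 17) by split; lra.
have [x1E /andP[y10 y11]] := a1.
have g1 : qx < 29 / 12.
  rewrite ltNge; apply/negP => ?; apply: (inside_unit t1 e1); left.
  by apply: sqr_ge1; lra.
have g2 : -7 / 12 < qx.
  rewrite ltNge; apply/negP => ?; apply: (inside_unit t1 e1); left.
  by apply: sqr_ge1; lra.
have [u2 v2 h2] := a2.
(* The right disc is that of [arc2]. Both arcs lie to the right of the common tangent, so the left
   disc may have any radius at least 1; it is 2 here. *)
have := @pair_at R qx qy t 1 0 1 2 (17 / 12) (1 / 17) x2 y2 x1 y1.
case; rewrite /sqd ?x1E //; try lra.
- exact: H1.
- by rewrite -x1E.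
- by have := sqr_ge0 (y1 - 1 / 17); lra.
- by have := sqr_ge0 (y1 - 1 / 17); lra.
- by move=> [ex ey]; rewrite -x1E; apply: (arc1_arc1 H1 a1 _ e1 e2); rewrite ex ey.
- by move=> [_ ey]; rewrite -x1E; apply: (arc2_arc2 t1 H2 _ a2 e1 e2); rewrite x1E ey.
Qed.



(** The curvature changes sign at this junction: the disc of [arc2] touches the horizontal tangent
    from below, that of [arc3] from above. *)
Lemma arc12_arc34 x1 y1 x2 y2 :
  (forall x y, inner K x y -> t <= D x y) ->
  arc1 x1 y1 \/ arc2 x1 y1 -> arc3 K x2 y2 \/ arc4 K x2 y2 ->
  D x1 y1 = t -> D x2 y2 = t ->
  (x1 = 29 / 12 /\ y1 = 18 / 17) \/ (x2 = 29 / 12 /\ y2 = 18 / 17).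
Proof.
move=> Hm a1 a2 e1 e2.
have [r31 _] := r3_bounds K; have bE := b_def K; have [yJ1 _] := yJ_bounds K.
have [xJ1 _] := xJ_bounds K.
have [B1 B2 B3] : [/\ x1 <= 29 / 12, y1 <= 18 / 17 & 1 <= sqd x1 y1 (29 / 12) (1 / 17)].
  rewrite /sqd; case: a1 => [[-> /andP[? ?]]|a1].
    by have := sqr_ge0 (y1 - 1 / 17); split; lra.
  by have [_ ?] := arc2_bounds a1; case: a1 => ? ? ->.
have [C1 C2 C3] : [/\ 29 / 12 <= x2, 18 / 17 <= y2 &
    r3 K ^+ 2 <= (x2 - 29 / 12) ^+ 2 + (y2 - b K) ^+ 2].
  case: a2 => a2.
    by have [? _] := arc3_bounds a2; case: a2 => ? ? ? ->; split.
  have [? _] := arc4_bounds a2; case: a2 => ? ? ? h.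
  by split; [lra | lra | exact: cap_out_arc3].
have hJ : inner K (29 / 12) (18 / 17).
  by constructor 2; split; lra.
have g1 : qy < b K.
  rewrite ltNge; apply/negP => ?; apply: (inside_unit t1 e1); right.
  by apply: sqr_ge1; lra.
have g2 : 1 / 17 < qy.
  rewrite ltNge; apply/negP => ?; apply: (inside_unit t1 e2); right.
  by apply: sqr_ge1; lra.
have z2 : 1 <= (y2 - 1 / 17) ^+ 2 by apply: sqr_ge1; lra.
have z1 : r3 K ^+ 2 <= (b K - y1) ^+ 2 by rewrite ler_sqr ?nnegrE; lra.
apply: (@pair_at R qx qy t 0 1 (r3 K) 1) => //.
- exact: Hm.
- by lra.
- by lra.
- by lra.
- by lra.
- by have := sqr_ge0 (x1 - 29 / 12); move: z1; rewrite /sqd bE; lra.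
- by move: B3; rewrite /sqd; lra.
- by move: C3; rewrite /sqd bE; lra.
- by have := sqr_ge0 (x2 - 29 / 12); move: z2; rewrite /sqd; lra.
Qed.

End ArcPairs.

(** * The two discs tangent to the ray at s *)

Section SDiscs.
Variables (R : rcfType) (K : config R).
Implicit Types x y : R.

Lemma cap_circle_discs x y : cap_circle K x y ->
  rc K ^+ 2 <= (x - (2 * xs K - 11 / 3)) ^+ 2 + (y - 2 * ys K) ^+ 2 /\
  (x - xs K) * (xs K - 11 / 3) + (y - ys K) * ys K <= 0.
Proof.
move=> h; have hs := s_cap K; have [r1 _] := rc_bounds K.
have r0 : 0 <= rc K by lra.
have [_] := dot_bounds r0 r0 h hs; rewrite /cap_circle in h.
by move: h hs; clear; move=> *; split; lra.
Qed.

Lemma rc_sq_bound : rc K ^+ 2 <= 99 / 50.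
Proof.
by have [r1 r2] := rc_bounds K; move: r1 r2; clear; move: (rc K) => *; nra.
Qed.

Lemma low_disc x y : y <= 18 / 17 ->
  rc K ^+ 2 <= (x - (2 * xs K - 11 / 3)) ^+ 2 + (y - 2 * ys K) ^+ 2.
Proof.
have rmax := rc_sq_bound; have [_ _ ys1 _] := s_bounds K => hy.
have h1 := sqr_ge0 (x - (2 * xs K - 11 / 3)).
have h2 : (3 / 2) ^+ 2 <= (2 * ys K - y) ^+ 2.
  by clear -K ys1 hy; rewrite ler_sqr ?nnegrE; lra.
by clear -K h1 h2 rmax; lra.
Qed.

Lemma arc3_disc x y : arc3 K x y ->
  rc K ^+ 2 <= (x - (2 * xs K - 11 / 3)) ^+ 2 + (y - 2 * ys K) ^+ 2.
Proof.
move=> H; have [_ hy] := arc3_bounds H; case: H => x0 x1 y0 h.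
have [_ yJ2] := yJ_bounds K; have [_ xJ2] := xJ_bounds K.
have [r31 r32] := r3_bounds K; have bE := b_def K.
have [xs1 xs2 ys1 ys2] := s_bounds K.
(* The vector from the centre of [arc3] to the centre of the reflected cap circle; the square is
   expanded around the former. *)
set al := 2 * xs K - 11 / 3 - 29 / 12; set be := 2 * ys K - b K.
have -> : (x - (2 * xs K - 11 / 3)) ^+ 2 + (y - 2 * ys K) ^+ 2 =
   r3 K ^+ 2 - 2 * ((x - 29 / 12) * al) + 2 * ((b K - y) * be) + al ^+ 2 + be ^+ 2.
  by rewrite /al /be -h; ring.
have al1 : 1 / 6 <= al by rewrite /al; clear -K xs1; lra.
have al2 : al <= 11 / 60 by rewrite /al; clear -K xs2; lra.
have be1 : 22 / 45 <= be by rewrite /be bE; clear -K ys1 r32; lra.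
clearbody al be.
have e1 : (x - 29 / 12) * al <= 8 / 15 * (11 / 60).
  by clear -K x0 x1 xJ2 al1 al2; apply: ler_pM; lra.
have byy : 22 / 25 <= b K - y by rewrite bE; clear -K hy yJ2 r31; lra.
have e2 : 22 / 25 * (22 / 45) <= (b K - y) * be.
  by clear -K byy be1; apply: ler_pM; lra.
have e3 : (1 / 6) ^+ 2 <= al ^+ 2 by clear -K al1; rewrite ler_sqr ?nnegrE; lra.
have e4 : (22 / 45) ^+ 2 <= be ^+ 2 by clear -K be1; rewrite ler_sqr ?nnegrE; lra.
have e5 : (31 / 30) ^+ 2 <= r3 K ^+ 2 by clear -K r31; rewrite ler_sqr ?nnegrE; lra.
by apply: (le_trans rc_sq_bound); clear -K e1 e2 e3 e4 e5; lra.
Qed.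

(** This is [rc] times the signed distance to the ray through [s], positive on the side away from
    the cap centre. The bound 5/9 below is a rational number not exceeding [rc ^+ 2 - rc]. *)
Local Notation V x y := ((x - xs K) * (xs K - 11 / 3) + (y - ys K) * ys K).

Lemma offset_ge x y : 18 / 17 <= y -> x <= xs K -> y <= ys K -> - (5 / 9) <= V x y.
Proof.
move=> hy hx' hy'; have [xs1 xs2 ys1 ys2] := s_bounds K.
have h1 : 0 <= (xs K - x) * (11 / 3 - xs K).
  by clear -K hx' xs2; rewrite mulr_ge0; lra.
have h2 : (ys K - y) * ys K <= 1 / 4 * (13 / 10).
  by clear -K hy hy' ys1 ys2; apply: ler_pM; lra.
by clear -K h1 h2; lra.
Qed.

Lemma offset_le x y : 29 / 12 <= x -> y <= ys K -> x <= xs K -> V x y <= 5 / 9.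
Proof.
move=> hx hy hx'; have [xs1 xs2 ys1 ys2] := s_bounds K.
have h1 : (xs K - x) * (11 / 3 - xs K) <= 18 / 25 * (13 / 24).
  by clear -K hx hx' xs1 xs2; apply: ler_pM; lra.
have h2 : 0 <= (ys K - y) * ys K by clear -K hy ys1; rewrite mulr_ge0; lra.
by clear -K h1 h2; lra.
Qed.

Lemma arc1_offset x y : arc1 x y -> V x y <= 5 / 9.
Proof.
case=> -> /andP[y0 y1]; have [xs1 xs2 ys1 ys2] := s_bounds K.
have h1 : (xs K - 17 / 12) * (11 / 3 - xs K) <= 2 * (13 / 24).
  by clear -K xs1 xs2; apply: ler_pM; lra.
have h2 : 22 / 17 * (21 / 17) <= ys K * (ys K - y).
  by clear -K y1 ys1; apply: ler_pM; lra.
by clear -K h1 h2; lra.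
Qed.

Lemma arc2_offset x y : arc2 x y -> V x y <= 5 / 9.
Proof.
case=> x0 y0 h; have [xs1 xs2 ys1 ys2] := s_bounds K.
have hs := s_cap K; have [r1 r2] := rc_bounds K.
have r0 : 0 <= rc K by clear -K r1; lra.
have h' : (x - 29 / 12) ^+ 2 + (y - 1 / 17) ^+ 2 = 1 ^+ 2 by rewrite expr1n.
have [_ h3] := dot_bounds ler01 r0 h' hs.
have h1 : (xs K - 29 / 12) * (11 / 3 - xs K) <= 18 / 25 * (13 / 24).
  by clear -K xs1 xs2; apply: ler_pM; lra.
have h2 : 22 / 17 * (21 / 17) <= ys K * (ys K - 1 / 17).
  by clear -K ys1; apply: ler_pM; lra.
by clear -K h1 h2 h3 r2; lra.
Qed.

(* Seen from the tangency point [s] of the cap circle with the ray, [inner]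
   avoids the two discs of radius [rc] tangent to the ray at [s], and it stays
   close to the ray beyond the abscissa [29 / 12]. *)
Lemma inner_discs x y : inner K x y ->
  [/\ rc K ^+ 2 <= (x - 11 / 3) ^+ 2 + y ^+ 2,
    rc K ^+ 2 <= (x - (2 * xs K - 11 / 3)) ^+ 2 + (y - 2 * ys K) ^+ 2 &
    V x y <= 5 / 9 /\ (29 / 12 < x -> - (5 / 9) <= V x y)].
Proof.
move=> H; have rmax := rc_sq_bound; have y0 := sqr_ge0 y.
have [_ hX2 _ hY2] := inner_bounds H; case: H => H.
- have := arc1_offset H; case: H => xE /andP[_ y1] hV; rewrite xE in hV *.
  split; [by clear -K y0 rmax; lra | by apply: low_disc; clear -K y1; lra |].
  by split=> // h; exfalso; clear -K h; lra.
- have [_ hy] := arc2_bounds H; have hV := arc2_offset H; case: H => x0 y1 h.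
  split; [|exact: low_disc|].
    by clear -K rmax x0 y1 h; nra.
  by split=> // h'; exfalso; clear -K h' x0; lra.
- have [hy1 hy2] := arc3_bounds H; have hd := arc3_disc H; case: H => x0 x1 y1 h.
  split; [exact: (arc3_out_cap h) | exact: hd |].
  by split; [exact: offset_le | move=> ?; exact: offset_ge].
- have [hy1 hy2] := arc4_bounds H; have [yJ1 _] := yJ_bounds K.
  case: H => x0 x1 y1 h; have [? hV] := cap_circle_discs h.
  split=> //; first by rewrite -h.
  split; first by clear -K hV; lra.
  by move=> ?; apply: offset_ge => //; clear -K hy1 yJ1; lra.
Qed.

Lemma cap_discs x y : cap K x y ->
  [/\ rc K ^+ 2 <= (x - 11 / 3) ^+ 2 + y ^+ 2,
    rc K ^+ 2 <= (x - (2 * xs K - 11 / 3)) ^+ 2 + (y - 2 * ys K) ^+ 2 &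
    0 <= (x - xs K) * ys K - (y - ys K) * (xs K - 11 / 3)].
Proof.
have [xs1 xs2 ys1 ys2] := s_bounds K => H.
have dich := cap_dich H; case: H => x0 y0 h; have [? _] := cap_circle_discs h.
split=> //; first by rewrite -h.
case: dich => h'.
  have h1 : 0 <= (x - xs K) * ys K by clear -K x0 ys1; rewrite mulr_ge0; lra.
  have h2 : 0 <= (y - ys K) * (11 / 3 - xs K) by clear -K h' xs2; rewrite mulr_ge0; lra.
  by clear -K h1 h2; lra.
have h1 : 0 <= (x - (2 * (11 / 3) - xs K)) * ys K by clear -K h' ys1; rewrite mulr_ge0; lra.
have h2 : 0 <= (ys K + y) * (11 / 3 - xs K) by clear -K xs2 ys1 y0; rewrite mulr_ge0; lra.
by clear -K h1 h2; lra.
Qed.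

(** Since [s] is the foot of the perpendicular from the cap centre to the ray, the reflected centre
    is also the image of the centre under the point reflection in [s]. *)
Lemma cap_up_circle x y : cap_circle K (rx K x y) (ry K x y) ->
  (x - (2 * xs K - 11 / 3)) ^+ 2 + (y - 2 * ys K) ^+ 2 = rc K ^+ 2.
Proof.
move=> <-; have := refl_sqd K x y (2 * xs K - 11 / 3) (2 * ys K).
rewrite /sqd => <-; have [sx sy] := s_def K.
have E : rx K (2 * xs K - 11 / 3) (2 * ys K) = 11 / 3.
  transitivity (11 / 3 * (q K ^+ 2 / 2)); first by rewrite /rx sx sy; field.
  by rewrite half_q_sq mulr1.
have E' : ry K (2 * xs K - 11 / 3) (2 * ys K) = 0 by rewrite /ry sx sy; field.
by rewrite E E' subr0.
Qed.

Lemma cap_up_discs x y : cap K (rx K x y) (ry K x y) ->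
  [/\ rc K ^+ 2 <= (x - 11 / 3) ^+ 2 + y ^+ 2,
    rc K ^+ 2 <= (x - (2 * xs K - 11 / 3)) ^+ 2 + (y - 2 * ys K) ^+ 2 &
    0 <= (x - xs K) * ys K - (y - ys K) * (xs K - 11 / 3)].
Proof.
have hs := s_cap K; have [xs1 xs2 ys1 ys2] := s_bounds K => H.
have [hx hy] := cap_up_bounds H; case: H => _ _ /cap_up_circle E.
split; [|by rewrite E|].
  have h1 := sqr_ge0 (x - xs K); have h2 := sqr_ge0 (y - ys K).
  by clear -K E hs h1 h2; lra.
have h1 : 0 <= (x - xs K) * ys K by clear -K hx ys1; rewrite mulr_ge0; lra.
have h2 : 0 <= (y - ys K) * (11 / 3 - xs K) by clear -K hy xs2; rewrite mulr_ge0; lra.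
by clear -K h1 h2; lra.
Qed.

End SDiscs.


(** * Nearest points on both sides of J and of s *)

Section RayPairs.
Variables (R : rcfType) (K : config R).
Implicit Types x y : R.
Variables qx qy t : R.
Hypotheses (t1 : t < 1) (qy0 : 0 <= qy).
Local Notation D x y := (sqd x y qx qy).

Lemma arc3_side x y : arc3 K x y ->
  0 <= (x - xJ K) * (29 / 12 - xJ K) + (y - yJ K) * (b K - yJ K).
Proof.
case=> _ _ _ h1; have [r31 _] := r3_bounds K; have hA := J_arc K.
have r3p : 0 <= r3 K by clear -K r31 t1 qy0; lra.
by have [_ h2] := dot_bounds r3p r3p h1 hA; clear -K t1 qy0 h1 hA h2; lra.
Qed.

Lemma arc4_side x y : arc4 K x y ->
  (x - xJ K) * (29 / 12 - xJ K) + (y - yJ K) * (b K - yJ K) <= 0.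
Proof.
case=> _ _ _; rewrite /cap_circle => h2; have [r1 _] := rc_bounds K.
have [r31 _] := r3_bounds K; have [cx cy] := J_collinear K; have hJ := J_cap K.
have r0 : 0 <= rc K by clear -K r1 t1 qy0; lra.
have r00 : 0 < rc K by clear -K r1 t1 qy0; lra.
have r30 : 0 < r3 K by clear -K r31 t1 qy0; lra.
have [_ le] := dot_bounds r0 r0 h2 hJ.
rewrite -(pmulr_rle0 _ r00) mulrDr !(mulrCA (rc K)) -cx -cy.
have h3 : r3 K * ((x - xJ K) * (xJ K - 11 / 3) + (y - yJ K) * yJ K) <= 0.
  by rewrite pmulr_rle0 //; clear -K t1 qy0 le hJ h2; lra.
by clear -K t1 qy0 h3; lra.
Qed.

Lemma arc3_arc4 x1 y1 x2 y2 :
  t <= D (xJ K) (yJ K) -> arc3 K x1 y1 -> arc4 K x2 y2 ->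
  D x1 y1 = t -> D x2 y2 = t ->
  (x1 = xJ K /\ y1 = yJ K) \/ (x2 = xJ K /\ y2 = yJ K).
Proof.
move=> Hm a1 a2 e1 e2.
have [r31 _] := r3_bounds K; have [yJ1 yJ2] := yJ_bounds K.
have [xJ1 xJ2] := xJ_bounds K; have [r1 _] := rc_bounds K; have bE := b_def K.
have [cx cy] := J_collinear K; have hJ := J_cap K; have hA := J_arc K.
have r30 : 0 < r3 K by clear -K r31 t1 qy0; lra.
have r3n : r3 K != 0 by rewrite gt_eqF.
(* The normal at [J] is the vector to the centre of [arc3], of length [r3]; the cap centre lies
   opposite, at [- tm] times this vector. *)
set tm := rc K / r3 K.
have tmE : tm * r3 K = rc K by rewrite divfK.
have ox : xJ K - tm * (29 / 12 - xJ K) = 11 / 3.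
  by apply: (mulfI r3n); rewrite mulrBr mulrA [r3 K * tm]mulrC tmE; clear -K t1 qy0 cx; lra.
have oy : yJ K - tm * (b K - yJ K) = 0.
  by apply: (mulfI r3n); rewrite mulrBr mulrA [r3 K * tm]mulrC tmE; clear -K t1 qy0 cy; lra.
have N : (29 / 12 - xJ K) ^+ 2 + (b K - yJ K) ^+ 2 = r3 K ^+ 2.
  by clear -K t1 qy0 hA; lra.
have [p1 p1'] := arc3_bounds a1; have [p2 p2'] := arc4_bounds a2.
have s1 := arc3_side a1; have s2 := arc4_side a2.
have [u1 v1 w1 h1] := a1; have [u2 v2 w2 h2] := a2; rewrite /cap_circle in h2.
clearbody tm.
have rr : r3 K <= r3 K ^+ 2.
  by rewrite expr2 ler_peMr //; clear -K t1 qy0 r31; lra.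
have rt : r3 K <= rc K * r3 K.
  by rewrite ler_peMl //; clear -K t1 qy0 r31 r1; lra.
have tN : tm * r3 K ^+ 2 = rc K * r3 K by rewrite expr2 mulrA tmE.
have bJ : yJ K <= b K by clear -K t1 qy0 bE yJ2 r31; lra.
have xo : 29 / 12 <= xJ K by clear -K t1 qy0 xJ1; lra.
apply: (@pair_at R qx qy t (29 / 12 - xJ K) (b K - yJ K) 1 tm) => //; rewrite ?N ?ox ?oy.
- exact: exprn_gt0.
- have k1 : 0 <= (xJ K - x1) * (b K - yJ K) by rewrite mulr_ge0 ?subr_ge0.
  have k2 : 0 <= (yJ K - y1) * (xJ K - 29 / 12) by rewrite mulr_ge0 ?subr_ge0.
  by clear -K t1 qy0 k1 k2; lra.
- have k1 : 0 <= (x2 - xJ K) * (b K - yJ K) by rewrite mulr_ge0 ?subr_ge0.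
  have k2 : 0 <= (y2 - yJ K) * (xJ K - 29 / 12) by rewrite mulr_ge0 ?subr_ge0.
  by clear -K t1 qy0 k1 k2; lra.
(* A query beyond the centre of [arc3] would be at distance at least 1 from [arc4], which lies
   across the tangent at [J]; the next goal is symmetric. *)
- rewrite mul1r ltNge; apply/negP => h.
  apply: (far_contra t1 e2); rewrite sqdC.
  by apply: (far_sqd r30 N); clear -K t1 qy0 h s2 rr; lra.
- rewrite mulNr tN ltNge; apply/negP => h.
  apply: (far_contra t1 e1).
  by apply: (far_sqd r30 N); clear -K t1 qy0 h s1 rt; lra.
- by rewrite /sqd !mul1r expr1n mul1r !shiftB h1.
- by rewrite -exprMn tmE /sqd subr0; exact: arc3_out_cap.
- by rewrite /sqd !mul1r expr1n mul1r !shiftB; exact: cap_out_arc3.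
- by rewrite -exprMn tmE /sqd subr0 h2.
Qed.

Lemma inner_cap x1 y1 x2 y2 (d : bool) :
  t <= D (xs K) (ys K) -> inner K x1 y1 ->
  (if d then cap K x2 y2 else cap K (rx K x2 y2) (ry K x2 y2)) ->
  D x1 y1 = t -> D x2 y2 = t ->
  (x1 = xs K /\ y1 = ys K) \/ (x2 = xs K /\ y2 = ys K).
Proof.
move=> Hm a1 a2 e1 e2.
have [xs1 xs2 ys1 ys2] := s_bounds K.
have [r1 r2] := rc_bounds K; have hs := s_cap K.
have [X1 X2 Y1 Y2] := inner_bounds a1.
have r00 : 0 < rc K by clear -K t1 qy0 r1; lra.
(* A query beyond the centre of a disc has offset at least [rc ^+ 2] in absolute value. Against a
   curve point whose offset is at most 5/9 in that direction, at least [rc] remains, hence distance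
   at least 1. *)
have rq : 5 / 9 <= rc K ^+ 2 - rc K by clear -K t1 qy0 r1; nra.
have [I1 I2 [I3 I4]] := inner_discs a1.
have [C1 C2 C3] : [/\ rc K ^+ 2 <= (x2 - 11 / 3) ^+ 2 + y2 ^+ 2,
    rc K ^+ 2 <= (x2 - (2 * xs K - 11 / 3)) ^+ 2 + (y2 - 2 * ys K) ^+ 2 &
    0 <= (x2 - xs K) * ys K - (y2 - ys K) * (xs K - 11 / 3)].
  by case: d a2 => [/cap_discs|/cap_up_discs].
have N : (xs K - 11 / 3) ^+ 2 + ys K ^+ 2 = rc K ^+ 2 by [].
apply: (@pair_at R qx qy t (xs K - 11 / 3) (ys K) 1 1) => //; rewrite ?N ?mul1r ?mulN1r.
- exact: exprn_gt0.
- have k1 : 0 <= (xs K - x1) * ys K by clear -K t1 qy0 X2 ys1; rewrite mulr_ge0; lra.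
  have k2 : 0 <= (ys K - y1) * (11 / 3 - xs K).
    by clear -K t1 qy0 Y2 xs2; rewrite mulr_ge0; lra.
  by clear -K t1 qy0 k1 k2; lra.
- rewrite ltNge; apply/negP => h; apply: (far_contra t1 e1); rewrite sqdC.
  by apply: (far_sqd r00 N); clear -K t1 qy0 I3 h rq; lra.
- rewrite ltNge; apply/negP => h.
  (* Beyond the centre of the cap disc, [qy0] forces the query to the right of that centre. Points
     of [inner] up to abscissa 29/12 are then too far horizontally, and the others have offset at
     least -5/9. *)
  have qc : 11 / 3 <= qx.
    have k1 : 0 <= qy * ys K by apply: mulr_ge0 => //; clear -K t1 qy0 ys1; lra.
    have k2 : 0 < 11 / 3 - xs K by clear -K t1 qy0 xs2; lra.
    rewrite -subr_ge0 -(pmulr_lge0 _ k2).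
    by clear -K t1 qy0 k1 hs h; lra.
  case: (lerP x1 (29 / 12)) => xx.
    by apply: (inside_unit t1 e1); left; apply: sqr_ge1; clear -K t1 qy0 xx qc; lra.
  apply: (far_contra t1 e1); apply: (far_sqd r00 N).
  by have := I4 xx; clear -K t1 qy0 h rq => k1; lra.
- by move: I2; rewrite expr1n mul1r /sqd; clear -K t1 qy0; lra.
- by move: I1; rewrite expr1n mul1r /sqd; clear -K t1 qy0; lra.
- by move: C2; rewrite expr1n mul1r /sqd; clear -K t1 qy0; lra.
- by move: C1; rewrite expr1n mul1r /sqd; clear -K t1 qy0; lra.
Qed.

End RayPairs.

(** * Uniqueness of the nearest point in the wedge *)

Section Wing.
Variables (R : rcfType) (K : config R).
Implicit Types x y : R.

Lemma bottom_arc2_arc3 : arc2 (29 / 12 : R) (18 / 17) /\ arc3 K (29 / 12) (18 / 17).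
Proof.
have bE := b_def K; have [r31 _] := r3_bounds K; have [xJ1 _] := xJ_bounds K.
by split; split; rewrite ?bE; clear -K r31 xJ1; lra.
Qed.

Lemma J_arc3_arc4 : arc3 K (xJ K) (yJ K) /\ arc4 K (xJ K) (yJ K).
Proof.
have bE := b_def K; have [r31 _] := r3_bounds K; have [xJ1 xJ2] := xJ_bounds K.
have [yJ1 yJ2] := yJ_bounds K; have [xs1 _ _ _] := s_bounds K.
split; split; [..|exact: J_arc| | | |exact: J_cap] => //; clear -K bE r31 xJ1 xJ2 yJ1 yJ2 xs1; lra.
Qed.

Lemma cap_both_s (d : bool) :
  if d then cap K (xs K) (ys K) else cap K (rx K (xs K) (ys K)) (ry K (xs K) (ys K)).
Proof. by case: d; rewrite ?(refl_s K).1 ?(refl_s K).2; exact: cap_s. Qed.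

Lemma wing_xge d x y : wing K d x y -> 17 / 12 <= x.
Proof.
case=> [/inner_bounds[]//|]; have [xs1 _ _ _] := s_bounds K; case: d => [[h _ _]|/cap_up_bounds[h _]];
  clear -K xs1 h; lra.
Qed.

Section Query.
Variables (qx qy t : R).
Hypotheses (t1 : t < 1) (qy0 : 0 <= qy).
Local Notation D x y := (sqd x y qx qy).

Lemma arc12_unique x1 y1 x2 y2 : (forall x y, inner K x y -> t <= D x y) ->
  arc1 x1 y1 \/ arc2 x1 y1 -> arc1 x2 y2 \/ arc2 x2 y2 ->
  D x1 y1 = t -> D x2 y2 = t -> x1 = x2 /\ y1 = y2.
Proof.
move=> Hm.
have H1 x y : arc1 x y -> t <= D x y by move=> ?; apply: Hm; constructor 1.
have H2 x y : arc2 x y -> t <= D x y by move=> ?; apply: Hm; constructor 2.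
case=> a1 [] a2 e1 e2.
- exact: arc1_arc1 H1 a1 a2 e1 e2.
- exact: (arc1_arc2 t1 H1 H2 a1 a2 e1 e2).
- by have [-> ->] := arc1_arc2 t1 H1 H2 a2 a1 e2 e1.
- exact: (arc2_arc2 t1 H2 a1 a2 e1 e2).
Qed.

Lemma arc34_unique x1 y1 x2 y2 : (forall x y, inner K x y -> t <= D x y) ->
  arc3 K x1 y1 \/ arc4 K x1 y1 -> arc3 K x2 y2 \/ arc4 K x2 y2 ->
  D x1 y1 = t -> D x2 y2 = t -> x1 = x2 /\ y1 = y2.
Proof.
move=> Hm; have [j3 j4] := J_arc3_arc4.
have H3 x y : arc3 K x y -> t <= D x y by move=> ?; apply: Hm; constructor 3.
have H4 x y : arc4 K x y -> t <= D x y by move=> ?; apply: Hm; constructor 4.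
have U x1' y1' x2' y2' : arc3 K x1' y1' -> arc4 K x2' y2' -> D x1' y1' = t ->
    D x2' y2' = t -> x1' = x2' /\ y1' = y2'.
  move=> a1 a2 e1 e2; have := arc3_arc4 t1 (H3 _ _ j3) a1 a2 e1 e2.
  case=> [[ex ey]|[ex ey]].
    by apply: (arc4_arc4 t1 H4 _ a2 e1 e2); rewrite ex ey.
  by apply: (arc3_arc3 t1 H3 a1 _ e1 e2); rewrite ex ey.
case=> a1 [] a2 e1 e2.
- exact: (arc3_arc3 t1 H3 a1 a2 e1 e2).
- exact: U.
- by have [-> ->] := U _ _ _ _ a2 a1 e2 e1.
- exact: (arc4_arc4 t1 H4 a1 a2 e1 e2).
Qed.

Lemma inner_unique x1 y1 x2 y2 : (forall x y, inner K x y -> t <= D x y) ->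
  inner K x1 y1 -> inner K x2 y2 ->
  D x1 y1 = t -> D x2 y2 = t -> x1 = x2 /\ y1 = y2.
Proof.
move=> Hm; have [j2 j3] := bottom_arc2_arc3.
have S x y : inner K x y -> (arc1 x y \/ arc2 x y) \/ (arc3 K x y \/ arc4 K x y).
  by case; [left; left|left; right|right; left|right; right].
have U x1' y1' x2' y2' : arc1 x1' y1' \/ arc2 x1' y1' ->
    arc3 K x2' y2' \/ arc4 K x2' y2' -> D x1' y1' = t ->
    D x2' y2' = t -> x1' = x2' /\ y1' = y2'.
  move=> a1 a2 e1 e2; have := arc12_arc34 t1 Hm a1 a2 e1 e2.
  case=> [[ex ey]|[ex ey]].
    by apply: (arc34_unique Hm _ a2 e1 e2); left; rewrite ex ey.
  by apply: (arc12_unique Hm a1 _ e1 e2); right; rewrite ex ey.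
move=> /S[a1|a1] /S[a2|a2] e1 e2.
- exact: arc12_unique Hm a1 a2 e1 e2.
- exact: U.
- by have [-> ->] := U _ _ _ _ a2 a1 e2 e1.
- exact: arc34_unique Hm a1 a2 e1 e2.
Qed.

Lemma caps_unique d x1 y1 x2 y2 : (forall x y, wing K d x y -> t <= D x y) ->
  (if d then cap K x1 y1 else cap K (rx K x1 y1) (ry K x1 y1)) ->
  (if d then cap K x2 y2 else cap K (rx K x2 y2) (ry K x2 y2)) ->
  D x1 y1 = t -> D x2 y2 = t -> x1 = x2 /\ y1 = y2.
Proof.
case: d => Hm a1 a2.
  by apply: (cap_cap t1 _ a1 a2) => x y ?; apply: Hm; right.
rewrite -(refl_sqd K) -(refl_sqd K x2) => e1 e2.
have H x y : cap K x y -> t <= sqd x y (rx K qx qy) (ry K qx qy).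
  move=> h; have := refl_sqd K (rx K x y) (ry K x y) qx qy; rewrite rxK ryK => ->.
  by apply: Hm; right; rewrite rxK ryK.
have [ex ey] := cap_cap t1 H a1 a2 e1 e2.
by split; [rewrite -(rxK K x1 y1) ex ey rxK | rewrite -(ryK K x1 y1) ex ey ryK].
Qed.

Lemma wing_unique d x1 y1 x2 y2 : (forall x y, wing K d x y -> t <= D x y) ->
  wing K d x1 y1 -> wing K d x2 y2 ->
  D x1 y1 = t -> D x2 y2 = t -> x1 = x2 /\ y1 = y2.
Proof.
move=> Hm; have Hi x y : inner K x y -> t <= D x y by move=> ?; apply: Hm; left.
have is4 : inner K (xs K) (ys K) by constructor 4; exact: arc4_s.
have U x1' y1' x2' y2' : inner K x1' y1' ->
    (if d then cap K x2' y2' else cap K (rx K x2' y2') (ry K x2' y2')) ->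
    D x1' y1' = t -> D x2' y2' = t -> x1' = x2' /\ y1' = y2'.
  move=> a1 a2 e1 e2; have := inner_cap t1 qy0 (Hi _ _ is4) a1 a2 e1 e2.
  case=> [[ex ey]|[ex ey]].
    by apply: (caps_unique Hm _ a2 e1 e2); rewrite ex ey; exact: cap_both_s.
  by apply: (inner_unique Hi a1 _ e1 e2); rewrite ex ey.
case=> a1 [] a2 e1 e2.
- exact: inner_unique Hi a1 a2 e1 e2.
- exact: U.
- by have [-> ->] := U _ _ _ _ a2 a1 e2 e1.
- exact: caps_unique Hm a1 a2 e1 e2.
Qed.

End Query.

(** * Queries on the sides of the wedge *)

Section Wall.
Variables (qx t : R).
Hypothesis (t1 : t < 1).
Local Notation D x y := (sqd x y qx 0).

Lemma cap_wall x y : 11 / 3 < qx -> t <= D (11 / 3 + rc K) 0 -> cap K x y ->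
  D x y = t -> y = 0.
Proof.
move=> qc hm a e; have [_ xr] := cap_bounds a; case: a => _ _ h.
rewrite /sqd /cap_circle in h e hm.
have h1 : (qx - 11 / 3) * (11 / 3 + rc K - x) <= 0 by clear -K qx t1 hm h e; lra.
have h2 : 0 < qx - 11 / 3 by clear -K qx t1 qc; lra.
move: h1; rewrite pmulr_rle0 // subr_le0 => h1.
have xE : x = 11 / 3 + rc K by apply/eqP; rewrite eq_le xr h1.
by apply/eqP; rewrite -sqrf_eq0; move: h; rewrite xE shiftK => /eqP; rewrite -subr_eq0 shiftK.
Qed.

Lemma far0 x y : D x y = t -> 1 <= y -> False.
Proof. by move=> e ?; apply: (inside_unit t1 e); right; rewrite subr0; apply: sqr_ge1; left. Qed.

(** For a query on the axis, a nearest point off the axis would have its mirror image as a second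
    nearest point. The points of the axis where this happens are at distance at least 1 from the
    curve. *)
Lemma wing_wall d x y : (forall x y, wing K d x y -> t <= D x y) ->
  wing K d x y -> D x y = t -> y = 0.
Proof.
move=> Hm a e; have xh := wing_xge a.
have [xs1 xs2 ys1 ys2] := s_bounds K; have [yJ1 _] := yJ_bounds K.
case: (lerP qx (29 / 12)) => qh.
  have hJ : t <= D (17 / 12) 0.
    by apply: Hm; left; constructor 1; split=> //; apply/andP; split; clear -K qx t1; lra.
  (* The point is at least as near to the query as [(17 / 12, 0)] and not to the left of it; this
     persists when the query moves right to [29 / 12]. *)
  have B : (x - 29 / 12) ^+ 2 + y ^+ 2 <= 1.
    rewrite /sqd in e hJ; have h1 : 0 <= (x - 17 / 12) * (29 / 12 - qx).
      by rewrite mulr_ge0 ?subr_ge0.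
    by clear -K qx t1 e hJ h1; lra.
  have far : 1 < y -> y = 0.
    move=> y1; exfalso; have h0 := sqr_ge0 (x - 29 / 12).
    have h1 : 1 < y ^+ 2 by rewrite exprn_egt1.
    by clear -K qx t1 B h0 h1; lra.
  case: a => [[]a|].
  - case: a => xE _; apply/eqP; rewrite -sqrf_eq0 eq_le sqr_ge0 andbT.
    by move: B; rewrite xE; clear -K qx t1; lra.
  - by case: a => _ y0 h; exfalso; clear -K qx t1 B h y0; lra.
  - by have [hh _] := arc3_bounds a; apply: far; clear -K qx t1 hh; lra.
  - by have [hh _] := arc4_bounds a; apply: far; clear -K qx t1 hh yJ1; lra.
  - case: d Hm => Hm a; last first.
      by have [_ hh] := cap_up_bounds a; apply: far; clear -K qx t1 hh ys1; lra.
    case: (cap_dich a) => h; first by apply: far; clear -K qx t1 h ys1; lra.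
    exfalso; have h1 : (3 / 2) ^+ 2 <= (x - 29 / 12) ^+ 2.
      by clear -K qx t1 h xs2; rewrite ler_sqr ?nnegrE; lra.
    by have h2 := sqr_ge0 y; clear -K qx t1 h1 h2 B; lra.
case: a => [[]a|].
- case: a => xE _; exfalso; apply: (inside_unit t1 e); left; apply: sqr_ge1.
  by clear -K qx t1 xE qh; lra.
- case: a => x0 y0 h; exfalso; move: e; rewrite /sqd subr0 => e.
  have h1 : (29 / 12 - x) ^+ 2 <= (qx - x) ^+ 2.
    by clear -K qx t1 x0 qh; rewrite ler_sqr ?nnegrE; lra.
  by have := t1; move: (t1); clear -K qx t1 h1 h e y0; lra.
- by have [hh _] := arc3_bounds a; exfalso; apply: (far0 e); clear -K qx t1 hh; lra.
- by have [hh _] := arc4_bounds a; exfalso; apply: (far0 e); clear -K qx t1 hh yJ1; lra.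
case: d Hm => Hm a; last first.
  by have [_ hh] := cap_up_bounds a; exfalso; apply: (far0 e); clear -K qx t1 hh ys1; lra.
case: (lerP qx (11 / 3)) => qc; last first.
  apply: (cap_wall qc _ a e); apply: Hm; right.
  have [r1 _] := rc_bounds K; split; [clear -K qx t1 r1 xs2; lra | by [] |].
  by rewrite /cap_circle shiftK expr0n addr0.
exfalso; case: (cap_dich a) => h; first by apply: (far0 e); clear -K qx t1 h ys1; lra.
case: a => _ _; rewrite /cap_circle => hc.
have h1 : 0 <= (x - 11 / 3) * (11 / 3 - qx) by apply: mulr_ge0; clear -K qx t1 h xs2 qc; lra.
have h2 := sqr_ge0 (11 / 3 - qx).
have [r1 _] := rc_bounds K; have h3 : 1 <= rc K ^+ 2.
  by apply: sqr_ge1; left; clear -K qx t1 r1; lra.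
by rewrite /sqd in e; move: (t1); clear -K qx t1 e h1 h2 h3 hc; lra.
Qed.

(* The reflection in the ray through [s] changes the sign of the offset. *)
Lemma refl_offset x y :
  (rx K x y - xs K) * (xs K - 11 / 3) + (ry K x y - ys K) * ys K =
  - ((x - xs K) * (xs K - 11 / 3) + (y - ys K) * ys K).
Proof.
have [sx sy] := s_def K; have q2 := q_sq K.
have e1 : q K / 2 * (xs K - 11 / 3 + ys K) = - (xs K - 11 / 3).
  by rewrite sx sy; clear -K qx t1 q2; nra.
have e2 : q K / 2 * (xs K - 11 / 3 - ys K) = - ys K by rewrite sx sy; field.
have e3 : xs K * (xs K - 11 / 3) + ys K * ys K = 0.
  by rewrite sx sy; clear -K qx t1 q2; nra.
have -> : (rx K x y - xs K) * (xs K - 11 / 3) + (ry K x y - ys K) * ys K =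
  x * (q K / 2 * (xs K - 11 / 3 + ys K)) + y * (q K / 2 * (xs K - 11 / 3 - ys K))
  - (xs K * (xs K - 11 / 3) + ys K * ys K) by rewrite /rx /ry; ring.
by rewrite e1 e2 e3; move: e3; clear -K qx t1; lra.
Qed.

(** For the connected curve, the axis on which the cap ends is the diagonal in the frame of [wing].
    Near a cap a query may lie on it, and [wing_wall] does not apply there. *)
Lemma cap_axis_wall x y : 11 / 3 < qx ->
  (forall x y, wing K false x y -> t <= D (rx K x y) (ry K x y)) ->
  wing K false x y -> D (rx K x y) (ry K x y) = t -> ry K x y = 0.
Proof.
move=> qc Hm a e.
have [xs1 xs2 ys1 ys2] := s_bounds K; have [r1 r2] := rc_bounds K.
case: a => [a|a]; last first.
  have {}a : cap K (rx K x y) (ry K x y) by [].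
  apply: (cap_wall qc _ a e).
  have := Hm (rx K (11 / 3 + rc K) 0) (ry K (11 / 3 + rc K) 0).
  rewrite !rxK !ryK; apply; right; rewrite !rxK !ryK.
  split; [clear -K qx t1 r1 xs2; lra | by [] |].
  by rewrite /cap_circle shiftK expr0n addr0.
exfalso; have [_ _ [hV _]] := inner_discs a.
have rV := refl_offset x y; have hs := s_cap K.
apply: (far_contra t1 e); have r0 : 0 < rc K by clear -K qx t1 r1; lra.
apply: (far_sqd r0 hs).
have h1 : 0 <= (qx - 11 / 3) * (11 / 3 - xs K).
  by apply: mulr_ge0; clear -K qx t1 qc xs2; lra.
have rq : 5 / 9 <= rc K ^+ 2 - rc K by clear -K qx t1 r1; nra.
by clear -K qx t1 rV hV h1 rq hs; lra.
Qed.

End Wall.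
End Wing.

(** * Sampling the arcs *)

Section Sampling.
Variables (R : rcfType) (K : config R).
Implicit Types x y : R.

Lemma q_gt : 140 / 99 < q K.
Proof. by have [h _] := q_bounds K; have q2 := q_sq K; clear -K h q2; nra. Qed.

Lemma crossing_points : exists x0 x1 : R,
  [/\ arc2 x0 ((q K - 1) * x0), arc3 K x1 ((q K - 1) * x1),
      13 / 8 <= x0 <= 44 / 27 & 5 / 2 <= x1 <= 96 / 37].
Proof.
have [q1 q2] := q_bounds K; have q3 := q_gt; have [r31 r32] := r3_bounds K.
have bE := b_def K; have [xJ1 _] := xJ_bounds K.
have k0 : 41 / 99 <= q K - 1 by clear -K q3; lra.
have k1 : q K - 1 <= 17 / 41 by clear -K q2; lra.
set k := q K - 1 in k0 k1 *; clearbody k.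
(* The equations of [arc2] and [arc3] restricted to the ray, as polynomials, so that sign changes
   give roots over any real closed field. *)
pose p0 : {poly R} := - ('X - (29 / 12)%:P) ^+ 2 - (k%:P * 'X - (1 / 17)%:P) ^+ 2 + 1.
pose p1 : {poly R} := (r3 K ^+ 2)%:P - ('X - (29 / 12)%:P) ^+ 2
  - (k%:P * 'X - (b K)%:P) ^+ 2.
have e0 x : p0.[x] = 1 - ((x - 29 / 12) ^+ 2 + (k * x - 1 / 17) ^+ 2).
  by rewrite /p0 !hornerE; ring.
have e1 x : p1.[x] = r3 K ^+ 2 - ((x - 29 / 12) ^+ 2 + (k * x - b K) ^+ 2).
  by rewrite /p1 !hornerE; ring.
have [x0 /andP[x01 x02] /eqP r0] : exists2 x0, 13 / 8 <= x0 <= 44 / 27 & root p0 x0.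
  apply: poly_ivt; first by clear; lra.
  by rewrite !e0; apply/andP; clear -K k0 k1; split; nra.
have [x1 /andP[x11 x12] /eqP r1] : exists2 x1, 5 / 2 <= x1 <= 96 / 37 & root p1 x1.
  apply: poly_ivt; first by clear; lra.
  by rewrite !e1 bE; apply/andP; clear -K k0 k1 r31 r32; split; nra.
exists x0, x1; rewrite x01 x02 x11 x12; split => //.
- split; [clear -K x02; lra | clear -K k0 x01; nra |].
  by apply/eqP; rewrite -subr_eq0 -oppr_eq0 opprB -e0 r0.
- split; [clear -K x11; lra | clear -K x12 xJ1; lra | rewrite bE; clear -K x12 x11 k0 k1 r31; nra |].
  by apply/eqP; rewrite -subr_eq0 -oppr_eq0 opprB -e1 r1.
Qed.

(** The squared distance to the diagonal is [(x - y) ^+ 2 / 2]; so the squared distance to the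
    sample is at most 15/29 times the square of the smaller of 1 and the distance to the
    diagonal. *)
Definition close_to x y sx sy :=
  sqd x y sx sy <= 15 / 29 /\ sqd x y sx sy <= 15 / 58 * (x - y) ^+ 2.

Lemma arc1_close x y sx sy : arc1 x y -> 13 / 8 <= sx <= 44 / 27 ->
  27 / 44 + 1 / 17 <= sy <= 23 / 34 -> close_to x y sx sy.
Proof.
case=> -> /andP[y0 y1] /andP[x01 x02] /andP[s1 s2].
have a1 : (17 / 12 - sx) ^+ 2 <= (23 / 108) ^+ 2.
  by rewrite -sqrrN; clear -x01 x02; rewrite ler_sqr ?nnegrE; lra.
have a2 : (y - sy) ^+ 2 <= (23 / 34 - y) ^+ 2.
  by rewrite -sqrrN; clear -y1 s1 s2; rewrite ler_sqr ?nnegrE; lra.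
have yy : y * (1 / 17 - y) >= 0 by rewrite mulr_ge0 ?subr_ge0.
by rewrite /close_to /sqd; clear -a1 a2 yy y0 y1; split; lra.
Qed.

(** The abscissa [29 / 12 - 21 / 59] divides [arc2] between the two crossing points; there the
    estimates for both of them are nearly sharp. *)
Lemma arc2_close x y sx sy : arc2 x y -> arc2 sx sy -> x <= 29 / 12 - 21 / 59 ->
  13 / 8 <= sx <= 44 / 27 -> 27 / 44 + 1 / 17 <= sy <= 23 / 34 -> close_to x y sx sy.
Proof.
move=> a as' xX /andP[_ x02] /andP[s1 _]; have [xh _] := arc2_bounds a.
case: a as' => xl yl h [_ _ hs].
have k1 : 0 <= (44 / 27 - sx) * (29 / 12 - x) by rewrite mulr_ge0 ?subr_ge0.
have k2 : 0 <= (sy - (27 / 44 + 1 / 17)) * (y - 1 / 17) by rewrite mulr_ge0 ?subr_ge0.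
(* A squared chord of the unit circle is 2 minus twice the inner product of the radii; the
   components of the radius to the sample are at least 85/108 and 27/44. *)
have D : sqd x y sx sy <=
    2 - 2 * (85 / 108 * (29 / 12 - x) + 27 / 44 * (y - 1 / 17)).
  by rewrite /sqd; clear -k1 k2 h hs; lra.
move: D; rewrite /close_to; move: (sqd x y sx sy) => D le.
(* The arc lies above its chord from the lower end to the dividing abscissa, whose slope slightly
   exceeds 29/20. *)
have Y : 29 / 20 * (x - 17 / 12) <= y - 1 / 17.
  have k : 0 <= (x - 17 / 12) * (29 / 12 - 21 / 59 - x) by rewrite mulr_ge0 ?subr_ge0.
  rewrite -ler_sqr ?nnegrE; [| |by rewrite subr_ge0]; last by clear -xh; lra.
  by clear -k h xX xh; lra.
(* This bounds [(x - y) ^+ 2] below by its tangent at 16/15, close to the value of [x - y] at the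
   dividing point, and makes the second condition linear. *)
have z : 0 <= (x - y - 16 / 15) ^+ 2 by rewrite sqr_ge0.
by clear -le Y z xX xh; split; lra.
Qed.

Lemma arc2_close_right x y sx sy : arc2 x y -> 29 / 12 - 21 / 59 <= x ->
  5 / 2 <= sx <= 96 / 37 -> 18 / 17 <= sy <= 43 / 40 -> close_to x y sx sy.
Proof.
move=> a xX /andP[s1 s2] /andP[s3 s4]; have [xh yh] := arc2_bounds a.
case: a => xl yl h.
have k1 : (x - sx) ^+ 2 <= (96 / 37 - x) ^+ 2.
  by rewrite -sqrrN; clear -xl s1 s2; rewrite ler_sqr ?nnegrE; lra.
have k2 : (y - sy) ^+ 2 <= (43 / 40 - y) ^+ 2.
  by rewrite -sqrrN; clear -yh s3 s4; rewrite ler_sqr ?nnegrE; lra.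
have D : sqd x y sx sy <= (96 / 37 - x) ^+ 2 + (43 / 40 - y) ^+ 2 by rewrite lerD.
move: D; rewrite /close_to; move: (sqd x y sx sy) => D le.
(* The chord from the dividing point to the upper end of [arc2], of slope just below 5/27. *)
have Y : 1 - 5 / 27 * (29 / 12 - x) <= y - 1 / 17.
  have k : 0 <= (29 / 12 - x) * (x - (29 / 12 - 21 / 59)) by rewrite mulr_ge0 ?subr_ge0.
  rewrite -ler_sqr ?nnegrE; [| |by rewrite subr_ge0]; last by clear -xh; lra.
  by clear -k h xX xl; lra.
have z : 0 <= (x - y - 16 / 15) ^+ 2 by rewrite sqr_ge0.
by clear -le Y z xX xl h; split; lra.
Qed.

Lemma sqr_le_bound (u c : R) : - c <= u -> u <= c -> u ^+ 2 <= c ^+ 2.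
Proof.
move=> h1 h2; have : 0 <= (c - u) * (c + u) by rewrite mulr_ge0; clear -h1 h2; lra.
by clear; lra.
Qed.

Lemma arc3_close x y sx sy : arc3 K x y ->
  5 / 2 <= sx <= 96 / 37 -> 18 / 17 <= sy <= 43 / 40 -> close_to x y sx sy.
Proof.
move=> a /andP[s1 s2] /andP[s3 s4]; have [y1 y2] := arc3_bounds a.
case: a => x1 x2 _ _; have [_ xJ2] := xJ_bounds K; have [_ yJ2] := yJ_bounds K.
have k1 : (x - sx) ^+ 2 <= (9 / 20) ^+ 2.
  by apply: sqr_le_bound; clear -K x1 x2 xJ2 s1 s2; lra.
have k2 : (y - sy) ^+ 2 <= (1 / 6) ^+ 2.
  by apply: sqr_le_bound; clear -K y1 y2 yJ2 s3 s4; lra.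
have k3 : (6 / 5) ^+ 2 <= (x - y) ^+ 2.
  by clear -K x1 y2 yJ2; rewrite ler_sqr ?nnegrE; lra.
by rewrite /close_to /sqd; clear -K k1 k2 k3; split; lra.
Qed.

Lemma arc4_close x y : arc4 K x y -> close_to x y (xs K) (ys K).
Proof.
move=> a; have [y1 y2] := arc4_bounds a; case: a => x1 x2 _ _.
have [xJ1 _] := xJ_bounds K; have [yJ1 _] := yJ_bounds K.
have [xs1 xs2 ys1 ys2] := s_bounds K.
have k1 : (x - xs K) ^+ 2 <= (1 / 5) ^+ 2.
  by apply: sqr_le_bound; clear -K x1 x2 xJ1 xs2; lra.
have k2 : (y - ys K) ^+ 2 <= (1 / 5) ^+ 2.
  by apply: sqr_le_bound; clear -K y1 y2 yJ1 ys2; lra.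
have k3 : (6 / 5) ^+ 2 <= (x - y) ^+ 2.
  by clear -K x1 y2 xJ1 ys2; rewrite ler_sqr ?nnegrE; lra.
by rewrite /close_to /sqd; clear -K k1 k2 k3; split; lra.
Qed.

Lemma inner_samples : exists x0 x1 : R,
  [/\ inner K x0 ((q K - 1) * x0), inner K x1 ((q K - 1) * x1), 0 <= x0, 0 <= x1 &
   forall x y, inner K x y -> exists2 s, s \in [:: x0; x1; xs K] &
     close_to x y s ((q K - 1) * s)].
Proof.
have [x0 [x1 [c0 c1 hx0 hx1]]] := crossing_points.
have [_ q2] := q_bounds K; have q3 := q_gt.
have q4 : q K < 99 / 70 by have := q_sq K; clear -K q2 q3 => *; nra.
have [/andP[a1 a2] /andP[a3 a4]] := (hx0, hx1).
have hy0 : 27 / 44 + 1 / 17 <= (q K - 1) * x0 <= 23 / 34.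
  by apply/andP; clear -K a1 a2 q3 q4; split; nra.
have hy1 : 18 / 17 <= (q K - 1) * x1 <= 43 / 40.
  have [-> _] := arc3_bounds c1; clear -K a3 a4 q3 q4; nra.
exists x0, x1; split; [by constructor 2 | by constructor 3 | lra | lra |].
move=> x y [a|a|a|a].
- by exists x0; [rewrite inE eqxx | exact: arc1_close].
- case: (lerP x (29 / 12 - 21 / 59)) => h.
    by exists x0; [rewrite inE eqxx | exact: arc2_close].
  by exists x1; [rewrite !inE eqxx orbT | apply: arc2_close_right => //; exact: ltW].
- by exists x1; [rewrite !inE eqxx orbT | exact: arc3_close].
- exists (xs K); first by rewrite !inE eqxx !orbT.
  by rewrite -s_ray; exact: arc4_close.
Qed.

Lemma refl_ray x : rx K x ((q K - 1) * x) = x /\ ry K x ((q K - 1) * x) = (q K - 1) * x.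
Proof.
have q2 := q_sq K; split; rewrite /rx /ry.
  transitivity (q K ^+ 2 / 2 * x); [by field | by rewrite half_q_sq mul1r].
transitivity (q K * x - q K ^+ 2 / 2 * x); [by field | rewrite half_q_sq; ring].
Qed.

End Sampling.

(** * Unfolding the wedge *)

Section Fold.
Variable R : rcfType.
Implicit Types x y : R.

Definition fx x y : R := Num.max `|x| `|y|.
Definition fy x y : R := Num.min `|x| `|y|.

Lemma fold_bounds x y : 0 <= fy x y /\ fy x y <= fx x y.
Proof. by rewrite /fx /fy; case: (lerP `|x| `|y|) => h; rewrite ?normr_ge0 // ltW. Qed.

Lemma fold_sqr x y : fx x y ^+ 2 + fy x y ^+ 2 = x ^+ 2 + y ^+ 2.
Proof.
by rewrite /fx /fy; case: (lerP `|x| `|y|) => _; rewrite !real_normK ?num_real // addrC.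
Qed.

Lemma fold_id x y : 0 <= y -> y <= x -> fx x y = x /\ fy x y = y.
Proof.
move=> y0 yx; have x0 := le_trans y0 yx; rewrite /fx /fy !ger0_norm //.
by rewrite max_l // min_r.
Qed.

(** Among the images of a point under the symmetry group, the one in the wedge has the largest inner
    product with a given point of the wedge, by the rearrangement inequality; hence it is nearest to
    it. *)
Lemma fold_dot x y qx qy : 0 <= qy -> qy <= qx ->
  qx * x + qy * y <= qx * fx x y + qy * fy x y.
Proof.
move=> y0 yx; have x0 := le_trans y0 yx.
have h1 : 0 <= qx * (`|x| - x) by rewrite mulr_ge0 // subr_ge0 ler_norm.
have h2 : 0 <= qy * (`|y| - y) by rewrite mulr_ge0 // subr_ge0 ler_norm.
rewrite /fx /fy; case: (lerP `|x| `|y|) => h; last by clear -h1 h2; lra.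
have h3 : 0 <= (qx - qy) * (`|y| - `|x|) by rewrite mulr_ge0 // subr_ge0.
by clear -h1 h2 h3; lra.
Qed.

Lemma fold_sqd x y qx qy : 0 <= qy -> qy <= qx ->
  sqd (fx x y) (fy x y) qx qy <= sqd x y qx qy.
Proof.
move=> y0 yx; have := fold_dot x y y0 yx; have := fold_sqr x y; rewrite /sqd.
by move: (fx x y) (fy x y) => a c; clear; lra.
Qed.

(** The equality case of [fold_sqd]. Reflection in a wall preserves the distance to a query on that
    wall, so there the folded image is required to lie on the wall as well. *)
Lemma fold_eq x y qx qy : 0 <= qy -> qy <= qx -> 0 < qx ->
  sqd x y qx qy <= sqd (fx x y) (fy x y) qx qy ->
  (qy = 0 -> fy x y = 0) -> (qx = qy -> fx x y = fy x y) ->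
  x = fx x y /\ y = fy x y.
Proof.
move=> y0 yx x0 le w1 w2.
have dot : qx * fx x y + qy * fy x y <= qx * x + qy * y.
  move: le; have := fold_sqr x y; rewrite /sqd.
  by move: (fx x y) (fy x y) => a c; clear; lra.
have h1 : 0 <= `|x| - x by rewrite subr_ge0 ler_norm.
have h2 : 0 <= `|y| - y by rewrite subr_ge0 ler_norm.
have h2' : 0 <= qy * (`|y| - y) by rewrite mulr_ge0.
have h1' : 0 <= qx * (`|x| - x) by rewrite mulr_ge0 // ltW.
case: (lerP `|y| `|x|) => h.
  have [Ex Ey] : fx x y = `|x| /\ fy x y = `|y| by rewrite /fx /fy max_l // min_r.
  rewrite Ex Ey in dot w1 *.
  have e1 : qx * (`|x| - x) = 0.
    by apply/eqP; rewrite eq_le h1' andbT; clear -dot h2'; lra.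
  have e2 : qy * (`|y| - y) = 0.
    by apply/eqP; rewrite eq_le h2' andbT; clear -dot h1'; lra.
  split; first by move/eqP: e1; rewrite mulf_eq0 gt_eqF //= subr_eq0 => /eqP.
  move/eqP: e2; rewrite mulf_eq0 subr_eq0 => /orP[/eqP/w1 e|/eqP //].
  by rewrite e; apply/eqP; rewrite -normr_eq0 e.
have [Ex Ey] : fx x y = `|y| /\ fy x y = `|x|.
  by rewrite /fx /fy max_r ?min_l // ltW.
rewrite Ex Ey in dot w1 w2 *.
have h3 : 0 <= (qx - qy) * (`|y| - `|x|) by rewrite mulr_ge0 // subr_ge0 // ltW.
have e3 : (qx - qy) * (`|y| - `|x|) = 0.
  by apply/eqP; rewrite eq_le h3 andbT; clear -dot h1' h2'; lra.
move/eqP: e3; rewrite mulf_eq0 !subr_eq0 => /orP[/eqP/w2 e|/eqP e];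
  by move: h; rewrite e ltxx.
Qed.

(** The preimage is chosen in the same chamber of the symmetry group as [(x, y)]. *)
Lemma unfold_point x y sx sy : 0 <= sy -> sy <= sx -> exists x' y',
  [/\ fx x' y' = sx, fy x' y' = sy & sqd x y x' y' = sqd (fx x y) (fy x y) sx sy].
Proof.
move=> s0 s1; have s2 := le_trans s0 s1.
pose sg (u v : R) := if 0 <= u then v else - v.
have nsg u v : `|sg u v| = `|v| by rewrite /sg; case: ifP; rewrite ?normrN.
have esg u v : (u - sg u v) ^+ 2 = (`|u| - v) ^+ 2.
  rewrite /sg; case: (lerP 0 u) => h; first by rewrite ger0_norm.
  by rewrite ltr0_norm // -sqrrN; congr (_ ^+ 2); ring.
case: (lerP `|y| `|x|) => h.
  exists (sg x sx), (sg y sy); rewrite /sqd !esg /fx /fy !nsg (ger0_norm s0) (ger0_norm s2).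
  by rewrite (max_l s1) (min_r s1) (max_l h) (min_r h).
exists (sg x sy), (sg y sx); rewrite /sqd !esg /fx /fy !nsg (ger0_norm s0) (ger0_norm s2).
by rewrite (max_r s1) (min_l s1) (max_r (ltW h)) (min_l (ltW h)) addrC.
Qed.

End Fold.

(** * The folded plane curves and queries in the wedge *)

Section Planar.
Variables (R : rcfType) (K : config R).
Implicit Types x y : R.

Definition frx (d : bool) x y : R := if d then x else rx K x y.
Definition fry (d : bool) x y : R := if d then y else ry K x y.
Definition planar d x y :=
  wing K d (frx d (fx x y) (fy x y)) (fry d (fx x y) (fy x y)).

Lemma frxK d x y : frx d (frx d x y) (fry d x y) = x.
Proof. by case: d => //; exact: rxK. Qed.

Lemma fryK d x y : fry d (frx d x y) (fry d x y) = y.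
Proof. by case: d => //; exact: ryK. Qed.

Lemma frame_sqd d x y x' y' :
  sqd (frx d x y) (fry d x y) (frx d x' y') (fry d x' y') = sqd x y x' y'.
Proof. by case: d => //; exact: refl_sqd. Qed.

Lemma frame_wedge d x y : 0 <= y -> y <= x -> 0 <= fry d x y /\ fry d x y <= frx d x y.
Proof.
case: d => // y0 yx; have [q1 _] := q_bounds K.
have q0 : 0 <= q K / 2 by clear -K q1; lra.
by rewrite /= /rx /ry; split; [rewrite mulr_ge0 ?subr_ge0 | rewrite ler_wpM2l //; clear -K y0; lra].
Qed.

(* the radius is bounded by the distance to the far side of the wedge, which carries
   points of the medial axis *)
Definition near d (px py qx qy : R) :=
  let fpx := frx d (fx px py) (fy px py) in let fpy := fry d (fx px py) (fy px py) in
  [/\ inner K fpx fpy, sqd px py qx qy < 1 & 2 * sqd px py qx qy < (fpx - fpy) ^+ 2] \/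
  (cap K (fx px py) (fy px py) /\ sqd px py qx qy < 1 / 4).

Lemma diag_sqd (x y z : R) : (x - y) ^+ 2 <= 2 * sqd x y z z.
Proof. by have := sqr_ge0 (x + y - 2 * z); rewrite /sqd; clear; lra. Qed.

Lemma axis_frame (x : R) : frx false x 0 = fry false x 0.
Proof. by rewrite /= /rx /ry addr0 subr0. Qed.

Lemma diag_frame (x : R) : fry false x x = 0.
Proof. by rewrite /= /ry subrr mulr0. Qed.

Lemma fry0 (x y : R) : fry false x y = 0 -> x = y.
Proof.
have [q1 _] := q_bounds K; rewrite /= /ry => /eqP; rewrite mulf_eq0 subr_eq0.
by rewrite gt_eqF /=; [move/eqP | clear -K q1; lra].
Qed.

Lemma cap_far x y : cap K x y -> 1 <= x - y.
Proof.
have [xs1 _ _ _] := s_bounds K; have [_ r2] := rc_bounds K.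
by move=> c; have [h _] := cap_bounds c; case: c => h' _ _; clear -K xs1 r2 h h'; lra.
Qed.

Lemma cap_query_far x y qx qy : cap K x y -> sqd x y qx qy < 1 / 4 -> qy = 0 -> 11 / 3 < qx.
Proof.
move=> c h e; have [_ xs2 ys1 _] := s_bounds K; rewrite /sqd e subr0 in h.
have y0 : 0 <= y by case: c.
have x2 := sqr_ge0 (x - qx); have y2 := sqr_ge0 y.
case: (cap_dich c) => h1; first by exfalso; clear -K ys1 h1 x2 h; nra.
rewrite ltNge; apply/negP => le.
have : (1 / 2) ^+ 2 <= (x - qx) ^+ 2.
  by clear -K h1 le xs2; rewrite ler_sqr ?nnegrE; lra.
by clear -K h y2; lra.
Qed.

Lemma wing_wedge d x y : wing K d x y -> 0 <= y /\ y <= x.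
Proof.
have [xs1 xs2 ys1 ys2] := s_bounds K; have [_ r2] := rc_bounds K.
case=> [/inner_bounds[h1 h2 h3 h4]|]; first by clear -K h1 h3 h4 ys2; split; lra.
case: d => c.
  by have := cap_far c; case: c => _ h _ h'; clear -K h h'; split; lra.
have [_ h] := cap_up_bounds c; have [q1 _] := q_bounds K.
split; first by clear -K h ys1; lra.
case: c => _ + _; rewrite /ry pmulr_rge0 ?subr_ge0 //.
by clear -K q1; lra.
Qed.

(** The folded nearest points coincide by [wing_unique], and [fold_eq] recovers the points
    themselves once queries on a wall are known to have their nearest points on it. By [near], the
    wall opposite to the chain is met only close to a cap. *)
Lemma wedge_unique d px py qx qy t x1 y1 x2 y2 :
  0 <= qy -> qy <= qx -> planar d px py -> near d px py qx qy ->
  (forall x y, planar d x y -> t <= sqd x y qx qy) ->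
  planar d x1 y1 -> sqd x1 y1 qx qy = t ->
  planar d x2 y2 -> sqd x2 y2 qx qy = t -> x1 = x2 /\ y1 = y2.
Proof.
move=> qy0 qyx Pp np Hm P1 e1 P2 e2.
have [f0 f1] := fold_bounds px py.
have fle := fold_sqd px py qy0 qyx.
have t1 : t < 1.
  apply: (le_lt_trans (Hm _ _ Pp)); case: np => [[_ h _]//|[_ h]].
  by clear -K h; lra.
have [w1 w2] := frame_wedge d qy0 qyx.
set Qx := frx d qx qy in w1 w2 *; set Qy := fry d qx qy in w1 w2 *.
have HmW x y : wing K d x y -> t <= sqd x y Qx Qy.
  move=> h; have [g0 g1] := wing_wedge h.
  have [h0 h1] := frame_wedge d g0 g1.
  have [ex ey] := fold_id h0 h1.
  rewrite -(frame_sqd d) /Qx /Qy frxK fryK; apply: Hm.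
  by rewrite /planar ex ey frxK fryK.
have red x y : planar d x y -> sqd x y qx qy = t ->
   sqd (fx x y) (fy x y) qx qy = t /\
   sqd (frx d (fx x y) (fy x y)) (fry d (fx x y) (fy x y)) Qx Qy = t.
  move=> P e; rewrite frame_sqd; split; apply/eqP; rewrite eq_le.
    by rewrite -{1}e (fold_sqd _ _ qy0 qyx) /= -(frame_sqd d); exact: HmW.
  by rewrite -{1}e (fold_sqd _ _ qy0 qyx) /= -(frame_sqd d); exact: HmW.
have [r1 s1] := red _ _ P1 e1; have [r2 s2] := red _ _ P2 e2.
have [ex ey] := wing_unique t1 w1 HmW P1 P2 s1 s2.
have Efx : fx x1 y1 = fx x2 y2 by rewrite -(frxK d (fx x1 y1) (fy x1 y1)) ex ey frxK.
have Efy : fy x1 y1 = fy x2 y2 by rewrite -(fryK d (fx x1 y1) (fy x1 y1)) ex ey fryK.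
have nr : near d (fx px py) (fy px py) qx qy.
  have [Fx Fy] := fold_id f0 f1; case: np => [[i h2 h3]|[c h2]]; [left|right];
    rewrite Fx Fy; split => //.
  - exact: le_lt_trans fle h2.
  - by apply: le_lt_trans h3; rewrite ler_pM2l.
  - exact: le_lt_trans fle h2.
have diag x y : qx = qy -> sqd x y qx qy < 1 / 4 -> cap K x y -> False.
  move=> e h /cap_far c; have := diag_sqd x y qx; rewrite {2}e.
  have h3 : 1 ^+ 2 <= (x - y) ^+ 2 by rewrite ler_sqr ?nnegrE //; clear -K c; lra.
  by clear -K h h3; lra.
have frdiag x y : Qx = Qy -> 2 * sqd x y Qx Qy < (x - y) ^+ 2 -> False.
  by move=> <-; rewrite ltNge diag_sqd.
have nQ : [\/ Qx <> Qy | cap K (fx px py) (fy px py) /\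
                 sqd (fx px py) (fy px py) qx qy < 1 / 4].
  case: nr; have [-> ->] := fold_id f0 f1; last by right.
  by move=> [_ _ h3]; left => e; apply: (frdiag (frx d (fx px py) (fy px py)) (fry d (fx px py) (fy px py)) e); rewrite /Qx /Qy frame_sqd; exact: h3.
have wallT x y : planar d x y -> sqd x y qx qy = t ->
    (qy = 0 -> fy x y = 0) /\ (qx = qy -> fx x y = fy x y).
  move=> P e; have [ea eb] := red _ _ P e.
  have wall0 : Qy = 0 -> fry d (fx x y) (fy x y) = 0.
    move=> Q0; rewrite Q0 in HmW eb; exact: (@wing_wall R K Qx t t1 d _ _ HmW P eb).
  (* For [d = false] the frame exchanges the walls: [Qy = 0] means [qx = qy], and [Qx = Qy] means
     [qy = 0]. *)
  case: nQ => [nQ|[c h]]; split=> eq.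
  - case: d @Qx @Qy nQ wall0 {w1 w2 HmW Pp np Hm P1 P2 red s1 s2 ex ey nr eb P frdiag} => /= nQ w.
      exact: w.
    by case: nQ; rewrite eq; exact: (axis_frame qx).
  - case: d @Qx @Qy nQ wall0 {w1 w2 HmW Pp np Hm P1 P2 red s1 s2 ex ey nr eb P frdiag} => /= nQ w.
      by case: nQ.
    by apply: fry0; apply: w; rewrite eq; exact: (diag_frame qy).
  - have qc : 11 / 3 < qx by exact: cap_query_far c h eq.
    case: d @Qx @Qy HmW P eb wall0 {w1 w2 Pp np Hm P1 P2 red s1 s2 ex ey nr frdiag} => /= HmW P eb w.
      exact: w.
    rewrite -[fy x y](ryK K (fx x y)); apply: (cap_axis_wall t1 qc _ P); last first.
      by rewrite rxK ryK -eq.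
    move=> x' y' w'; rewrite -[0]eq -(refl_sqd K) rxK ryK; exact: HmW.
  - by case: (diag _ _ eq h c).
have qx0 : 0 < qx.
  rewrite lt_neqAle (le_trans qy0 qyx) andbT; apply/eqP => q0.
  have qyE : qy = 0 by apply/eqP; rewrite eq_le qy0 andbT q0.
  case: nQ => [[]|[c h]]; last by apply: (diag _ _ _ h c); rewrite qyE.
  by rewrite /Qx /Qy qyE -q0; case: (d) => //; exact: axis_frame.
have [w11 w12] := wallT _ _ P1 e1; have [w21 w22] := wallT _ _ P2 e2.
have [|E1 E1'] := fold_eq qy0 qyx qx0 _ w11 w12; first by rewrite e1 r1.
have [|E2 E2'] := fold_eq qy0 qyx qx0 _ w21 w22; first by rewrite e2 r2.
split; [exact: (etrans E1 (etrans Efx (esym E2))) | exact: (etrans E1' (etrans Efy (esym E2')))].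
Qed.

End Planar.

(** * Arbitrary queries, and the shared sample in the plane *)

Section Plane.
Variables (R : rcfType) (K : config R).
Implicit Types x y : R.

Definition sg (u v : R) := if 0 <= u then v else - v.

Lemma norm_sg u v : `|sg u v| = `|v|.
Proof. by rewrite /sg; case: ifP; rewrite ?normrN. Qed.

Lemma sgK u : involutive (sg u).
Proof. by move=> v; rewrite /sg; case: (0 <= u) => //; rewrite opprK. Qed.

Lemma sg_sqd x y u v : sqd (sg u x) (sg v y) `|u| `|v| = sqd x y u v.
Proof.
rewrite /sqd; congr (_ + _); rewrite /sg.
  by case: (lerP 0 u) => h; rewrite ?(ger0_norm h) ?(ltr0_norm h) // -opprD sqrrN.
by case: (lerP 0 v) => h; rewrite ?(ger0_norm h) ?(ltr0_norm h) // -opprD sqrrN.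
Qed.

Lemma swap_sqd x y u v : sqd y x v u = sqd x y u v.
Proof. by rewrite /sqd addrC. Qed.

Lemma fx_sg u v x y : fx (sg u x) (sg v y) = fx x y.
Proof. by rewrite /fx !norm_sg. Qed.

Lemma fy_sg u v x y : fy (sg u x) (sg v y) = fy x y.
Proof. by rewrite /fy !norm_sg. Qed.

Lemma fx_swap x y : fx y x = fx x y.
Proof. exact: maxC. Qed.

Lemma fy_swap x y : fy y x = fy x y.
Proof. exact: minC. Qed.

Lemma plane_unique d px py qx qy t x1 y1 x2 y2 :
  planar K d px py -> near K d px py qx qy ->
  (forall x y, planar K d x y -> t <= sqd x y qx qy) ->
  planar K d x1 y1 -> sqd x1 y1 qx qy = t ->
  planar K d x2 y2 -> sqd x2 y2 qx qy = t -> x1 = x2 /\ y1 = y2.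
Proof.
wlog [qx0 qy0] : qx qy px py x1 y1 x2 y2 / 0 <= qx /\ 0 <= qy.
  move=> W P N Hm P1 e1 P2 e2.
  have [] := W `|qx| `|qy| (sg qx px) (sg qy py) (sg qx x1) (sg qy y1) (sg qx x2) (sg qy y2).
  - by split; exact: normr_ge0.
  - by rewrite /planar !fx_sg !fy_sg.
  - by move: N; rewrite /near !fx_sg !fy_sg sg_sqd.
  - move=> x y P'; rewrite -(sgK qx x) -(sgK qy y) sg_sqd; apply: Hm.
    by rewrite /planar !fx_sg !fy_sg.
  - by rewrite /planar !fx_sg !fy_sg.
  - by rewrite sg_sqd.
  - by rewrite /planar !fx_sg !fy_sg.
  - by rewrite sg_sqd.
  by move=> /(can_inj (sgK qx)) -> /(can_inj (sgK qy)) ->.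
wlog qyx : qx qy px py x1 y1 x2 y2 qx0 qy0 / qy <= qx.
  move=> W; case: (lerP qy qx) => h; first exact: W.
  move=> P N Hm P1 e1 P2 e2.
  have [||||||||||-> ->] := W qy qx py px y1 x1 y2 x2 => //.
  - exact: ltW.
  - by rewrite /planar (fx_swap px) (fy_swap px).
  - by move: N; rewrite /near (fx_swap px) (fy_swap px) swap_sqd.
  - move=> x y P'; rewrite swap_sqd; apply: Hm.
    by rewrite /planar (fx_swap x) (fy_swap x).
  - by rewrite /planar (fx_swap x1) (fy_swap x1).
  - by rewrite swap_sqd.
  - by rewrite /planar (fx_swap x2) (fy_swap x2).
  - by rewrite swap_sqd.
exact: wedge_unique.
Qed.

(** No frame occurs: the crossing points are fixed by the reflection and the caps are common, so one
    set serves both curves. *)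
Definition sample_set (x0 x1 : R) x y :=
  [/\ fx x y = x0 & fy x y = (q K - 1) * x0] \/
  [/\ fx x y = x1 & fy x y = (q K - 1) * x1] \/ cap K (fx x y) (fy x y).

Lemma inner_gap x y : inner K x y -> 1 / 10 <= x - y.
Proof.
by case/inner_bounds; have [_ _ _ ys2] := s_bounds K; clear -K ys2 => *; lra.
Qed.

Lemma planar_sampling : exists x0 x1 : R,
  (forall d x y, sample_set x0 x1 x y -> planar K d x y) /\
  (forall d px py, planar K d px py -> exists sx sy g,
    [/\ sample_set x0 x1 sx sy, sqd px py sx sy <= 15 / 29 * g ^+ 2,
        1 / 20 <= g & forall qx qy, sqd px py qx qy < g ^+ 2 -> near K d px py qx qy]).
Proof.
have [x0 [x1 [i0 i1 x00 x10 Hs]]] := inner_samples K; exists x0, x1.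
have [q1 q2] := q_bounds K; have qsq := q_sq K.
have frr d s : frx K d s ((q K - 1) * s) = s /\ fry K d s ((q K - 1) * s) = (q K - 1) * s.
  by case: d => //; exact: refl_ray.
have capP d x y : cap K (fx x y) (fy x y) -> planar K d x y.
  by move=> c; right; case: d => //=; rewrite rxK ryK.
split.
  move=> d x y [[ex ey]|[[ex ey]|/capP]]; rewrite /planar ?ex ?ey ?(frr d _).1 ?(frr d _).2 //;
    by left.
move=> d px py P; have [f0 f1] := fold_bounds px py.
case: (P) => [i|c]; last first.
  have c' : cap K (fx px py) (fy px py) by case: (d) c => //=; rewrite rxK ryK.
  (* A cap point is its own sample, so the radius is free; 1/2 is small enough to keep queries off
     the diagonal and, on the axis, to the right of the cap centre. *)
  exists px, py, (1 / 2); split; [by right; right | | lra |].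
    by rewrite /sqd !subrr; clear; lra.
  by move=> qx qy h; right; split=> //; clear -h; lra.
have [s sin [s1 s2]] := Hs _ _ i.
have s0 : 0 <= s.
  move: sin; rewrite !inE => /or3P[] /eqP -> //.
  by have [? _ _ _] := s_bounds K; lra.
have k0 : 0 <= (q K - 1) * s by rewrite mulr_ge0 //; clear -K q1; lra.
have k1 : (q K - 1) * s <= s by rewrite ler_piMl //; clear -K q2; lra.
have [sx [sy [ex ey es]]] := unfold_point px py k0 k1.
set kx := frx K d _ _ in i s1 s2; set ky := fry K d _ _ in i s1 s2.
have gap := inner_gap i.
have gq : ((kx - ky) * (q K / 2)) ^+ 2 = 1 / 2 * (kx - ky) ^+ 2.
  by rewrite exprMn expr_div_n qsq; field.
have ss : sqd px py sx sy = sqd kx ky s ((q K - 1) * s).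
  by rewrite es -(frame_sqd K d) (frr d s).1 (frr d s).2.
(* As [q K / 2] is the inverse of the square root of 2, the second term is the distance from
   [(kx, ky)] to the diagonal. *)
exists sx, sy, (Num.min 1 ((kx - ky) * (q K / 2))); split.
- move: sin; rewrite !inE => /or3P[] /eqP sE; rewrite /sample_set ex ey sE; [by left|by right; left|].
  by right; right; rewrite -s_ray; exact: cap_s.
- rewrite ss; case: (lerP 1 ((kx - ky) * (q K / 2))) => h.
    by rewrite expr1n mulr1.
  by rewrite gq; clear -s2; lra.
- rewrite le_min; apply/andP; split; first by clear; lra.
  by clear -K q1 gap; nra.
- move=> qx qy; have g0 : 0 <= (kx - ky) * (q K / 2) by clear -K q1 gap; nra.
  case: (lerP 1 ((kx - ky) * (q K / 2))) => h lt; left; split=> //.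
  + by rewrite expr1n in lt.
  + have : 1 ^+ 2 <= ((kx - ky) * (q K / 2)) ^+ 2 by rewrite ler_sqr ?nnegrE.
    by rewrite gq; rewrite -/kx -/ky; clear -lt; lra.
  + apply: (lt_trans lt); rewrite exprn_ilt1 //.
  + by move: lt; rewrite gq -/kx -/ky; clear; lra.
Qed.

End Plane.

(** * Charts *)

Section Continuity.
Variables (R : realType) (T : topologicalType).
Implicit Types (f g : T -> R) (x : T).

Lemma contP f : (forall x, {for x, continuous f}) -> continuous f.
Proof. by []. Qed.

Lemma cont_cst (a : R) x : {for x, continuous (fun _ : T => a)}.
Proof. exact: cst_continuous. Qed.

Lemma contD f g x : {for x, continuous f} -> {for x, continuous g} ->
  {for x, continuous (fun v => f v + g v)}.
Proof. by move=> cf cg; exact: cvgD. Qed.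

Lemma contB f g x : {for x, continuous f} -> {for x, continuous g} ->
  {for x, continuous (fun v => f v - g v)}.
Proof. by move=> cf cg; exact: cvgB. Qed.

Lemma contN f x : {for x, continuous f} -> {for x, continuous (fun v => - f v)}.
Proof. by move=> cf; exact: cvgN. Qed.

Lemma contM f g x : {for x, continuous f} -> {for x, continuous g} ->
  {for x, continuous (fun v => f v * g v)}.
Proof. by move=> cf cg; exact: cvgM. Qed.

Lemma contV f x : f x != 0 -> {for x, continuous f} ->
  {for x, continuous (fun v => (f v)^-1)}.
Proof. by move=> f0 cf; exact: cvgV. Qed.

Lemma contX2 f x : {for x, continuous f} -> {for x, continuous (fun v => f v ^+ 2)}.
Proof.
move=> cf; rewrite (_ : (fun _ => _) = fun v => f v * f v); first exact: contM.
by apply/funext => v; rewrite expr2.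
Qed.

Lemma cont_comp (h : R -> R) f x : {for x, continuous f} -> continuous h ->
  {for x, continuous (fun v => h (f v))}.
Proof. by move=> cf ch; apply: continuous_comp => //; exact: ch. Qed.

Lemma cont_sqrt f x : {for x, continuous f} ->
  {for x, continuous (fun v => Num.sqrt (f v))}.
Proof. by move=> cf; apply: cont_comp => //; exact: sqrt_continuous. Qed.

Lemma cont_norm f x : {for x, continuous f} -> {for x, continuous (fun v => `|f v|)}.
Proof. by move=> cf; apply: cont_comp => //; exact: norm_continuous. Qed.

Lemma cont_max f g x : {for x, continuous f} -> {for x, continuous g} ->
  {for x, continuous (fun v => Num.max (f v) (g v))}.
Proof. by move=> cf cg; exact: continuous_max. Qed.

Lemma cont_min f g x : {for x, continuous f} -> {for x, continuous g} ->
  {for x, continuous (fun v => Num.min (f v) (g v))}.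
Proof. by move=> cf cg; exact: continuous_min. Qed.

End Continuity.

(** * Charts of level sets of monotone functions *)

Section Chart.
Variable R : realType.

Lemma row_continuous (T : topologicalType) n (f : T -> 'rV[R]_n) (x : T) :
  (forall j, {for x, continuous (fun v => f v ord0 j)}) -> {for x, continuous f}.
Proof.
move=> cf; apply/cvg_ballP => e e0.
have H : \forall v \near x, forall j, ball (f x ord0 j) e (f v ord0 j).
  by apply: filter_forall => j; have /cvg_ballP := cf j; apply.
near=> v; split=> // i j; rewrite (ord1 i).
by move: j; near: v.
Unshelve. all: by end_near. Qed.

Definition ins n (i : 'I_n.+1) (z : R) (v : 'rV[R]_n) : 'rV[R]_n.+1 :=
  \row_j (if unlift i j is Some k then v ord0 k else z).
Definition del n (i : 'I_n.+1) (v : 'rV[R]_n.+1) : 'rV[R]_n :=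
  \row_k v ord0 (lift i k).

Lemma ins_at n (i : 'I_n.+1) z (v : 'rV[R]_n) : ins i z v ord0 i = z.
Proof. by rewrite mxE unlift_none. Qed.

Lemma ins_lift n (i : 'I_n.+1) z (v : 'rV[R]_n) k : ins i z v ord0 (lift i k) = v ord0 k.
Proof. by rewrite mxE liftK. Qed.

Lemma del_ins n (i : 'I_n.+1) z (v : 'rV[R]_n) : del i (ins i z v) = v.
Proof. by apply/rowP => k; rewrite mxE ins_lift. Qed.

Lemma ins_del n (i : 'I_n.+1) (v : 'rV[R]_n.+1) : ins i (v ord0 i) (del i v) = v.
Proof.
by apply/rowP => j; case: (unliftP i j) => [k|] ->; rewrite ?ins_lift ?ins_at // mxE.
Qed.

Lemma ins_continuous (T : topologicalType) n (i : 'I_n.+1) (z : T -> R)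
    (v : T -> 'rV[R]_n) (x : T) :
  {for x, continuous z} -> {for x, continuous v} ->
  {for x, continuous (fun t => ins i (z t) (v t))}.
Proof.
move=> cz cv; apply: row_continuous => j; case: (unliftP i j) => [k|] ->.
  rewrite (_ : (fun _ => _) = fun t => v t ord0 k); last first.
    by apply/funext => t; rewrite ins_lift.
  exact: (continuous_comp cv (@coord_continuous _ _ _ ord0 k _)).
by rewrite (_ : (fun _ => _) = z) //; apply/funext => t; rewrite ins_at.
Qed.

Lemma del_continuous n (i : 'I_n.+1) : continuous (@del n i).
Proof.
move=> v; apply: row_continuous => k.
rewrite (_ : (fun _ => _) = fun v : 'rV[R]_n.+1 => v ord0 (lift i k)); last first.
  by apply/funext => t; rewrite mxE.
exact: coord_continuous.
Qed.

(** A chart in [top_submanifold] is defined on the whole of the parameter space, so the line has to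
    be identified with a bounded interval. *)
Definition squash (z : R) := z / (1 + `|z|).
Definition unsquash (z : R) := z / (1 - `|z|).

Lemma squash_lt1 z : `|squash z| < 1.
Proof.
have h := normr_ge0 z; have p : 0 < 1 + `|z| by lra.
by rewrite /squash normrM normfV (gtr0_norm p) ltr_pdivrMr //; lra.
Qed.

Lemma squashK : cancel squash unsquash.
Proof.
move=> z; have h := normr_ge0 z; have p : 0 < 1 + `|z| by lra.
rewrite /unsquash /squash normrM normfV (gtr0_norm p).
have -> : 1 - `|z| / (1 + `|z|) = (1 + `|z|)^-1.
  by apply: (mulIf (lt0r_neq0 p)); rewrite mulVf ?gt_eqF // mulrBl divfK ?gt_eqF //; lra.
by rewrite invrK divfK ?gt_eqF.
Qed.

Lemma unsquashK z : `|z| < 1 -> squash (unsquash z) = z.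
Proof.
move=> h; have p : 0 < 1 - `|z| by lra.
rewrite /unsquash /squash normrM normfV (gtr0_norm p).
have -> : 1 + `|z| / (1 - `|z|) = (1 - `|z|)^-1.
  by apply: (mulIf (lt0r_neq0 p)); rewrite mulVf ?gt_eqF // mulrDl divfK ?gt_eqF //; lra.
by rewrite invrK divfK ?gt_eqF.
Qed.

Lemma squash_continuous : continuous squash.
Proof.
move=> z; have h := normr_ge0 z; apply: cvgM; first exact: cvg_id.
apply: cvgV; first by rewrite gt_eqF //; lra.
by apply: cvgD; [exact: cvg_cst | exact: norm_continuous].
Qed.

Lemma unsquash_continuous z : `|z| < 1 -> {for z, continuous unsquash}.
Proof.
move=> h; apply: cvgM; first exact: cvg_id.
apply: cvgV; first by rewrite gt_eqF //; lra.
by apply: cvgB; [exact: cvg_cst | exact: norm_continuous].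
Qed.

(** An implicit function theorem without derivatives: along coordinate [i] a root exists by the
    intermediate value theorem, is unique by monotonicity, and depends continuously on the other
    coordinates because strict signs persist. Only continuity is available where arcs meet. *)
Lemma monotone_chart n (C : set 'rV[R]_n.+1) (p : 'rV[R]_n.+1) (i : 'I_n.+1)
    (U : set 'rV[R]_n.+1) (Phi : 'rV[R]_n.+1 -> R) :
  open U -> U p -> C p -> continuous Phi ->
  (forall v, U v -> (C v <-> Phi v = 0)) ->
  (forall v w, U v -> U w -> del i v = del i w -> v ord0 i < w ord0 i ->
    Phi v < Phi w) ->
  exists U' : set 'rV[R]_n.+1, [/\ open U', U' p &
    exists (f : 'rV[R]_n -> 'rV[R]_n.+1) (g : 'rV[R]_n.+1 -> 'rV[R]_n),
      [/\ continuous f, range f = U' `&` C,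
          {within U' `&` C, continuous g} & (forall y, g (f y) = y)]].
Proof.
move=> oU Up Cp cPhi CPhi mono.
have /nbhs_ballP [e /= e0 eU] : nbhs p U by exact: open_nbhs_nbhs.
pose z0 := p ord0 i; pose p' := del i p; pose h := e / 2.
have h0 : 0 < h by rewrite divr_gt0.
have he : h < e by rewrite /h; lra.
have inU z v' : `|z0 - z| < e -> ball p' e v' -> U (ins i z v').
  move=> hz [_ hv]; apply: eU; split=> // a j; rewrite (ord1 a).
  case: (unliftP i j) => [k|] ->; rewrite ?ins_lift ?ins_at.
    by have := hv ord0 k; rewrite /p' mxE.
  by rewrite -ball_normE.
have monoz z w v' : `|z0 - z| < e -> `|z0 - w| < e -> ball p' e v' -> z < w ->
    Phi (ins i z v') < Phi (ins i w v').
  by move=> hz hw hv zw; apply: mono; rewrite ?del_ins ?ins_at //; exact: inU.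
have Phi_p : Phi p = 0 by apply/CPhi.
have insp : ins i z0 p' = p by exact: ins_del.
have delp : del i p = p' by [].
clearbody p'.
have zm : `|z0 - (z0 - h)| < e by rewrite opprB addrC subrK gtr0_norm.
have zp : `|z0 - (z0 + h)| < e by rewrite opprD addrA subrr sub0r normrN gtr0_norm.
have z00 : `|z0 - z0| < e by rewrite subrr normr0.
have bp : ball p' e p' by exact: ballxx.
have cins z v' : {for v', continuous (fun u => Phi (ins i z u))}.
  apply: continuous_comp; last exact: cPhi.
  by apply: ins_continuous => [|w]; [exact: cst_continuous | exact: id].
have neg z v' : Phi (ins i z v') < 0 -> \forall u \near v', Phi (ins i z u) < 0.
  by move=> lt; exact: (cvgr_lt _ (cins z v')).
have pos z v' : 0 < Phi (ins i z v') -> \forall u \near v', 0 < Phi (ins i z u).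
  by move=> lt; exact: (cvgr_gt _ (cins z v')).
have [d [d0 de negd posd]] : exists d, [/\ 0 < d, d <= e,
    (forall u, ball p' d u -> Phi (ins i (z0 - h) u) < 0) &
    (forall u, ball p' d u -> 0 < Phi (ins i (z0 + h) u))].
  have n1 : Phi (ins i (z0 - h) p') < 0 by rewrite -Phi_p -insp; apply: monoz => //; lra.
  have n2 : 0 < Phi (ins i (z0 + h) p') by rewrite -Phi_p -insp; apply: monoz => //; lra.
  have /nbhs_ballP [d1 /= d10 hd1] := neg _ _ n1.
  have /nbhs_ballP [d2 /= d20 hd2] := pos _ _ n2.
  exists (Num.min e (Num.min d1 d2)); split.
  - by rewrite !lt_min e0 d10 d20.
  - by rewrite ge_min lexx.
  - by move=> u hu; apply: hd1; apply: le_ball hu; rewrite !ge_min lexx /= orbT.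
  - by move=> u hu; apply: hd2; apply: le_ball hu; rewrite !ge_min lexx !orbT.
have bde u : ball p' d u -> ball p' e u by exact: le_ball.
pose root u : set R := [set z | `|z0 - z| < h /\ Phi (ins i z u) = 0].
(* The default [z0] can occur only outside [ball p' d], where [F] is never evaluated by the
   chart. *)
pose F u := xget z0 (root u).
have FP u : ball p' d u -> `|z0 - F u| < h /\ Phi (ins i (F u) u) = 0.
  move=> bu; apply: (@xgetPex _ z0 (root u)).
  have le1 : z0 - h <= z0 + h by lra.
  have cw : {within `[z0 - h, z0 + h], continuous (fun z => Phi (ins i z u))}.
    apply: continuous_subspaceT => z; apply: continuous_comp; last exact: cPhi.
    by apply: ins_continuous => [w|]; [exact: id | exact: cst_continuous].
  have n1 := negd u bu; have n2 := posd u bu.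
  have [|z] := IVT (v := 0) le1 cw.
    by rewrite ge_min le_max (ltW n1) (ltW n2) orbT.
  rewrite in_itv /= => /andP[z1 z2] hz; exists z; split=> //.
  have d1 : z0 - h != z by apply/eqP => E; move: n1; rewrite E hz ltxx.
  have d2 : z != z0 + h by apply/eqP => E; move: n2; rewrite -E hz ltxx.
  have l1 : z0 - h < z by rewrite lt_neqAle d1.
  have l2 : z < z0 + h by rewrite lt_neqAle d2.
  by rewrite ltr_norml; apply/andP; clear -l1 l2; split; lra.
have Funiq u z : ball p' d u -> `|z0 - z| < h -> Phi (ins i z u) = 0 -> z = F u.
  move=> bu hz z1; have [hF F1] := FP u bu.
  have hz' := lt_trans hz he; have hF' := lt_trans hF he.
  case: (ltrgtP z (F u)) => // lt.
    by have := monoz _ _ _ hz' hF' (bde _ bu) lt; rewrite z1 F1 ltxx.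
  by have := monoz _ _ _ hF' hz' (bde _ bu) lt; rewrite z1 F1 ltxx.
have obd : open (ball p' d) by exact: ball_open.
have Fc u : ball p' d u -> {for u, continuous F}.
  move=> bu; have nb : nbhs u (ball p' d) by apply: open_nbhs_nbhs; split.
  have FF : Filter (nbhs u) by exact: nbhs_filter.
  suff : F x @[x --> u] --> F u by [].
  apply/cvgrPdist_lt => eta eta0.
  have [hF F1] := FP u bu; rewrite ltr_norml in hF; have /andP[hF1 hF2] := hF.
  (* A step so small that [F u - m] and [F u + m] stay in the range of monotonicity; [Phi] has
     opposite signs there, also for nearby [w], which traps [F w]. *)
  pose m := Num.min (eta / 2) (Num.min ((h - (z0 - F u)) / 2) ((h + (z0 - F u)) / 2)).
  have m0 : 0 < m by rewrite !lt_min; apply/and3P; split; lra.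
  have m1 : m <= eta / 2 by rewrite ge_min lexx.
  have m2 : m <= (h - (z0 - F u)) / 2 by rewrite !ge_min lexx /= orbT.
  have m3 : m <= (h + (z0 - F u)) / 2 by rewrite !ge_min lexx !orbT.
  clearbody m.
  have k1 : `|z0 - (F u - m)| < e.
    by rewrite ltr_norml; apply/andP; clear -m2 m3 m0 hF1 hF2 he; split; lra.
  have k2 : `|z0 - (F u + m)| < e.
    by rewrite ltr_norml; apply/andP; clear -m2 m3 m0 hF1 hF2 he; split; lra.
  have k3 : `|z0 - F u| < e by apply: lt_trans he; rewrite ltr_norml hF.
  have n1 : Phi (ins i (F u - m) u) < 0.
    by rewrite -F1; apply: monoz => //; [exact: bde | lra].
  have n2 : 0 < Phi (ins i (F u + m) u).
    by rewrite -F1; apply: monoz => //; [exact: bde | lra].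
  near=> w.
  have bw : ball p' d w by near: w; exact: nb.
  have w1 : Phi (ins i (F u - m) w) < 0 by near: w; exact: neg.
  have w2 : 0 < Phi (ins i (F u + m) w) by near: w; exact: pos.
  have [hw W1] := FP w bw; have hw' := lt_trans hw he.
  have l1 : F u - m < F w.
    rewrite ltNge le_eqVlt; apply/negP => /orP[/eqP E|lt].
      by move: w1; rewrite -E W1 ltxx.
    by have := monoz _ _ _ hw' k1 (bde _ bw) lt; rewrite W1 ltNge ltW.
  have l2 : F w < F u + m.
    rewrite ltNge le_eqVlt; apply/negP => /orP[/eqP E|lt].
      by move: w2; rewrite E W1 ltxx.
    by have := monoz _ _ _ k2 hw' (bde _ bw) lt; rewrite W1 ltNge ltW.
  by rewrite ltr_norml; apply/andP; clear -l1 l2 m1 m0; split; lra.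
(* The parameter space is mapped onto the cube [ball p' d], coordinate by coordinate. *)
pose Y (y : 'rV[R]_n) : 'rV[R]_n := \row_k (p' ord0 k + d * squash (y ord0 k)).
have Yb y : ball p' d (Y y).
  split=> // a k; rewrite (ord1 a) -ball_normE /= [Y y _ _]mxE opprD addrA subrr sub0r normrN.
  by rewrite normrM (gtr0_norm d0) gtr_pMr // squash_lt1.
have Yc : continuous Y.
  move=> y; apply: row_continuous => k.
  rewrite (_ : (fun _ => _) = fun v : 'rV[R]_n => p' ord0 k + d * squash (v ord0 k)); last first.
    by apply/funext => v; rewrite mxE.
  apply: contD; first exact: cont_cst.
  apply: contM; first exact: cont_cst.
  by apply: cont_comp; [exact: coord_continuous | exact: squash_continuous].
exists [set v | ball p' d (del i v) /\ `|z0 - v ord0 i| < h]; split.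
- rewrite (_ : mkset _ = (@del n i) @^-1` (ball p' d) `&`
    (fun v : 'rV[R]_n.+1 => v ord0 i) @^-1` (ball z0 h)); last first.
    by rewrite -ball_normE.
  apply: openI; apply: open_comp; [|by []| |exact: ball_open].
    by move=> v _; exact: del_continuous.
  by move=> v _; exact: coord_continuous.
- by split; [rewrite delp; exact: ballxx | rewrite subrr normr0].
exists (fun y => ins i (F (Y y)) (Y y)).
exists (fun v => \row_k unsquash ((v ord0 (lift i k) - p' ord0 k) / d)); split.
- move=> y; apply: (@ins_continuous _ n i (F \o Y) Y y); last exact: Yc.
  by apply: continuous_comp; [exact: Yc | exact: Fc].
- apply/seteqP; split=> [_ [y _ <-]|v [[bv hv] Cv]].
    have [h1 h2] := FP _ (Yb y); split; first by rewrite /= del_ins ins_at.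
    by apply/CPhi => //; apply: inU; [exact: lt_trans he | exact: bde].
  exists (\row_k unsquash ((v ord0 (lift i k) - p' ord0 k) / d)) => //.
  have -> : Y (\row_k unsquash ((v ord0 (lift i k) - p' ord0 k) / d)) = del i v.
    apply/rowP => k; rewrite !mxE unsquashK.
      by rewrite mulrC divfK ?gt_eqF // addrC subrK.
    have [_ /(_ ord0 k)] := bv; rewrite -ball_normE /= mxE => lt.
    by rewrite normrM normfV (gtr0_norm d0) ltr_pdivrMr // mul1r distrC.
  rewrite -(Funiq (del i v) (v ord0 i)) ?ins_del //.
  by apply/CPhi => //; rewrite -(ins_del i v); apply: inU; [exact: lt_trans he|exact: bde].
- apply: continuous_in_subspaceT => v /set_mem [[[_ bv] _] _].
  apply: row_continuous => k.
  rewrite (_ : (fun _ => _) = fun v : 'rV[R]_n.+1 =>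
      unsquash ((v ord0 (lift i k) - p' ord0 k) / d)); last first.
    by apply/funext => w; rewrite mxE.
  apply: (@continuous_comp _ _ _ (fun v : 'rV[R]_n.+1 => (v ord0 (lift i k) - p' ord0 k) / d)).
    apply: contM; last exact: cont_cst.
    by apply: contB; [exact: coord_continuous | exact: cont_cst].
  apply: unsquash_continuous.
  have := bv ord0 k; rewrite -ball_normE /= mxE => lt.
  by rewrite normrM normfV (gtr0_norm d0) ltr_pdivrMr // mul1r distrC.
- move=> y; apply/rowP => k; rewrite !mxE liftK mxE addrC addKr.
  by rewrite mulrC mulKf ?gt_eqF // squashK.
Unshelve. all: by end_near. Qed.

End Chart.

(** * The chains as graphs of continuous functions *)

Section Graphs.
Variables (R : realType) (K : config R).
Implicit Types x y u v : R.

Lemma sqrt_sub_le (a z z' : R) : 0 <= z' -> z' <= z ->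
  Num.sqrt (a - z ^+ 2) <= Num.sqrt (a - z' ^+ 2).
Proof.
move=> h0 h; apply: ler_wsqrtr; rewrite lerD2l lerN2 ler_sqr ?nnegrE //.
exact: le_trans h.
Qed.

Lemma sqrt_eq (z a : R) : 0 <= z -> z ^+ 2 = a -> Num.sqrt a = z.
Proof. by move=> h <-; rewrite sqrtr_sqr ger0_norm. Qed.

Lemma sqr_sqrt_gt0 (z a : R) : 0 < z -> z = Num.sqrt a -> z ^+ 2 = a.
Proof. by move=> h e; rewrite e sqr_sqrtr // ltW // -sqrtr_gt0 -e. Qed.

(** The truncation at 0 joins [arc1] and [arc2] into one graph over the ordinate. *)
Definition left_graph y := 29 / 12 - Num.sqrt (1 - (Num.max (y - 1 / 17) 0) ^+ 2).

(* Each summand is constant outside the range of its arc, so that the sums are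
   continuous and restrict to the successive arcs. *)
Definition arc2_graph x : R :=
  1 / 17 + Num.sqrt (1 - (29 / 12 - Num.min x (29 / 12)) ^+ 2).
Definition arc3_graph x : R :=
  r3 K - Num.sqrt (r3 K ^+ 2 - (Num.max (Num.min x (xJ K)) (29 / 12) - 29 / 12) ^+ 2).
Definition cap_graph x : R := Num.sqrt (rc K ^+ 2 - (11 / 3 - x) ^+ 2).
Definition graph_true x : R :=
  arc2_graph x + arc3_graph x + (cap_graph (Num.max x (xJ K)) - yJ K).
Definition up_graph x : R := ys K - Num.sqrt (rc K ^+ 2 - (Num.max x (xs K) - 2 * ys K) ^+ 2).
Definition graph_false x : R :=
  arc2_graph x + arc3_graph x +
  (cap_graph (Num.max (Num.min x (xs K)) (xJ K)) - yJ K) + up_graph x.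

Lemma left_graph_low y : y <= 1 / 17 -> left_graph y = 17 / 12.
Proof.
move=> h; rewrite /left_graph max_r ?subr_le0 //.
by rewrite expr0n subr0 sqrtr1; lra.
Qed.

Lemma left_graph_mono y y' : y <= y' -> left_graph y <= left_graph y'.
Proof.
move=> h; rewrite /left_graph lerD2l lerN2; apply: sqrt_sub_le.
  by rewrite le_max lexx orbT.
by rewrite ge_max !le_max lexx orbT andbT lerD2r h.
Qed.

Lemma wing_left d x v : x < 29 / 12 -> 0 <= v ->
  wing K d x v <-> x = left_graph v.
Proof.
move=> hx v0; have [xs1 _ _ _] := s_bounds K; have [xJ1 _] := xJ_bounds K; split.
  case=> [[a|a|a|a]|a].
  - by case: a => -> /andP[_ h]; rewrite left_graph_low.
  - case: a => x0 y0 h; rewrite /left_graph max_l ?subr_ge0 //.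
    by rewrite (sqrt_eq (z := 29 / 12 - x)); [lra | rewrite subr_ge0 | clear -h; lra].
  - by case: a => h _ _ _; exfalso; clear -K h hx; lra.
  - by case: a => h _ _ _; exfalso; clear -K h hx xJ1; lra.
  - exfalso; case: d a => [[h _ _]|/cap_up_bounds[h _]]; clear -K h hx xs1; lra.
move=> e; case: (lerP v (1 / 17)) => h.
  left; constructor 1; split; last by rewrite v0.
  by rewrite e left_graph_low.
left; constructor 2; split; [exact: ltW | exact: ltW |].
move: e; rewrite /left_graph max_l; last by rewrite subr_ge0 ltW.
move=> e; have e' : 29 / 12 - x = Num.sqrt (1 - (v - 1 / 17) ^+ 2).
  by move: e; move: (Num.sqrt _) => z; clear; lra.
have := sqr_sqrt_gt0 _ e'; rewrite subr_gt0 => /(_ hx); clear; lra.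
Qed.

Lemma J_sqrt : Num.sqrt (r3 K ^+ 2 - (xJ K - 29 / 12) ^+ 2) = b K - yJ K.
Proof.
have hA := J_arc K; have bE := b_def K; have [_ y2] := yJ_bounds K.
have [r31 _] := r3_bounds K.
apply: sqrt_eq; first by rewrite bE; clear -K y2 r31; lra.
by clear -K hA; lra.
Qed.

Lemma cap_graph_J : cap_graph (xJ K) = yJ K.
Proof.
have hA := J_cap K; have [y1 _] := yJ_bounds K.
apply: sqrt_eq; first by clear -K y1; lra.
by clear -K hA; lra.
Qed.

Lemma cap_graph_s : cap_graph (xs K) = ys K.
Proof.
have hA := s_cap K; have [_ _ y1 _] := s_bounds K.
apply: sqrt_eq; first by clear -K y1; lra.
by clear -K hA; lra.
Qed.

(** The reflection carries the x-axis to the diagonal, so the centre of the reflected cap circle has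
    equal coordinates. *)
Lemma up_center : 2 * ys K = 2 * xs K - 11 / 3.
Proof. by have [-> ->] := s_def K; field. Qed.

Lemma up_graph_s : Num.sqrt (rc K ^+ 2 - (xs K - 2 * ys K) ^+ 2) = ys K.
Proof.
rewrite up_center.
have <- : (11 / 3 - xs K) ^+ 2 = (xs K - (2 * xs K - 11 / 3)) ^+ 2 by ring.
exact: cap_graph_s.
Qed.

Lemma up_graph_left x : x <= xs K -> up_graph x = 0.
Proof.
by move=> h; rewrite /up_graph (max_r h) up_graph_s subrr.
Qed.

Lemma arc2_graph_right x : 29 / 12 <= x -> arc2_graph x = 18 / 17.
Proof. by move=> h; rewrite /arc2_graph (min_r h) subrr expr0n subr0 sqrtr1; lra. Qed.

Lemma arc3_graph_left x : x <= 29 / 12 -> arc3_graph x = 0.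
Proof.
have [xJ1 _] := xJ_bounds K; have [r31 _] := r3_bounds K => h.
rewrite /arc3_graph max_r; last by rewrite ge_min h.
by rewrite subrr expr0n subr0 sqrtr_sqr ger0_norm ?subrr //; clear -K r31; lra.
Qed.

Lemma arc3_graph_right x : xJ K <= x -> arc3_graph x = yJ K - 18 / 17.
Proof.
have [xJ1 _] := xJ_bounds K => h.
rewrite /arc3_graph (min_r h) max_l; last by clear -K xJ1; lra.
by rewrite J_sqrt b_def; ring.
Qed.

Definition low_graph x : R := arc2_graph x + arc3_graph x.

Lemma low_graph2 x : x <= 29 / 12 ->
  low_graph x = 1 / 17 + Num.sqrt (1 - (29 / 12 - x) ^+ 2).
Proof. by move=> h; rewrite /low_graph arc3_graph_left // addr0 /arc2_graph min_l. Qed.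

Lemma low_graph3 x : 29 / 12 <= x -> x <= xJ K ->
  low_graph x = b K - Num.sqrt (r3 K ^+ 2 - (x - 29 / 12) ^+ 2).
Proof.
move=> h1 h2; rewrite /low_graph arc2_graph_right // /arc3_graph (min_l h2) (max_l h1).
by rewrite b_def addrA.
Qed.

Lemma low_graphJ x : xJ K <= x -> low_graph x = yJ K.
Proof.
have [xJ1 _] := xJ_bounds K => h; rewrite /low_graph arc2_graph_right; last first.
  by clear -K xJ1 h; lra.
by rewrite arc3_graph_right // addrC subrK.
Qed.

Lemma graph_true_low x : x <= xJ K -> graph_true x = low_graph x.
Proof. by move=> h; rewrite /graph_true (max_r h) cap_graph_J subrr addr0. Qed.

Lemma graph_true_cap x : xJ K <= x -> graph_true x = cap_graph x.
Proof.
by move=> h; rewrite /graph_true -/(low_graph x) low_graphJ // (max_l h) addrC subrK.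
Qed.

Lemma graph_false_low x : x <= xJ K -> graph_false x = low_graph x.
Proof.
have [_ xJ2] := xJ_bounds K; have [xs1 _ _ _] := s_bounds K => h.
rewrite /graph_false up_graph_left; last by clear -K xJ2 xs1 h; lra.
by rewrite max_r ?ge_min ?h // cap_graph_J subrr !addr0.
Qed.

Lemma graph_false_cap x : xJ K <= x -> x <= xs K -> graph_false x = cap_graph x.
Proof.
move=> h h'; rewrite /graph_false (up_graph_left h') (min_l h') (max_l h) addr0.
by rewrite -/(low_graph x) low_graphJ // addrC subrK.
Qed.

Lemma graph_false_up x : xs K <= x ->
  graph_false x = 2 * ys K - Num.sqrt (rc K ^+ 2 - (x - 2 * ys K) ^+ 2).
Proof.
have [_ xJ2] := xJ_bounds K; have [xs1 _ _ _] := s_bounds K => h.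
have h' : xJ K <= xs K by clear -K xJ2 xs1; lra.
rewrite /graph_false /up_graph (min_r h) (max_l h') (max_l h) cap_graph_s.
rewrite -/(low_graph x) low_graphJ ?(le_trans h' h) //.
by move: (Num.sqrt _) => z; clear; ring.
Qed.

Lemma arc2_graph_spec x y : 17 / 12 <= x -> x <= 29 / 12 ->
  arc2 x y <-> y = low_graph x.
Proof.
move=> hx hx'; rewrite low_graph2 //; split.
  case=> _ y0 h; rewrite (sqrt_eq (z := y - 1 / 17)) ?subr_ge0 //; first by clear; lra.
  by clear -h; lra.
move=> e; have e' : y - 1 / 17 = Num.sqrt (1 - (29 / 12 - x) ^+ 2).
  by rewrite e shiftK.
have h1 : 0 <= 1 - (29 / 12 - x) ^+ 2 by clear -hx hx'; nra.
split=> //; first by rewrite -subr_ge0 e' sqrtr_ge0.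
by rewrite e' sqr_sqrtr //; clear; lra.
Qed.

Lemma arc3_graph_spec x y : 29 / 12 <= x -> x <= xJ K ->
  arc3 K x y <-> y = low_graph x.
Proof.
move=> hx hx'; rewrite low_graph3 //; split.
  case=> _ _ y0 h; rewrite (sqrt_eq (z := b K - y)) ?subr_ge0 //; first by clear; lra.
  by clear -K h; lra.
move=> e; have e' : b K - y = Num.sqrt (r3 K ^+ 2 - (x - 29 / 12) ^+ 2).
  by rewrite e opprB shiftB.
have h1 : 0 <= r3 K ^+ 2 - (x - 29 / 12) ^+ 2.
  have [r31 _] := r3_bounds K; have [_ x2] := xJ_bounds K.
  by rewrite subr_ge0 ler_sqr ?nnegrE ?subr_ge0 //; clear -K r31 x2 hx'; lra.
split=> //; first by rewrite -subr_ge0 e' sqrtr_ge0.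
have e2 : (b K - y) ^+ 2 = r3 K ^+ 2 - (x - 29 / 12) ^+ 2 by rewrite e' sqr_sqrtr.
by clear -K e2; lra.
Qed.

Lemma cap_graph_spec x y : 0 < y -> cap_circle K x y <-> y = cap_graph x.
Proof.
move=> y0; rewrite /cap_circle /cap_graph; split=> [h|e].
  by rewrite (sqrt_eq (z := y)) ?ltW //; clear -K h; lra.
by have := sqr_sqrt_gt0 y0 e; clear; lra.
Qed.

Lemma inner_graph_spec x y : 17 / 12 < x -> 0 < y -> x <= xs K ->
  inner K x y <-> y = graph_false x.
Proof.
have [xJ1 xJ2] := xJ_bounds K; have [xs1 _ _ _] := s_bounds K => hx y0 hx'.
split.
  case=> a.
  - by case: a => e _; exfalso; clear -K e hx; lra.
  - have [xl _] := arc2_bounds a; have [xr _ _] := a.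
    rewrite graph_false_low; last by clear -K xr xJ1; lra.
    exact/arc2_graph_spec.
  - have [xl xr _ _] := a; rewrite graph_false_low //; exact/arc3_graph_spec.
  - have [xl xr _ h] := a; rewrite graph_false_cap //; exact/cap_graph_spec.
case: (lerP x (29 / 12)) => h1.
  rewrite graph_false_low; last by clear -K h1 xJ1; lra.
  by move/(arc2_graph_spec y (ltW hx) h1) => ?; constructor 2.
case: (lerP x (xJ K)) => h2.
  rewrite graph_false_low // => /(arc3_graph_spec y (ltW h1) h2) ?; by constructor 3.
rewrite graph_false_cap // ?ltW // => /(cap_graph_spec x y0) ?.
by constructor 4; split=> //; exact: ltW.
Qed.

Lemma wing_true_graph x y : 17 / 12 < x -> 0 < y ->
  wing K true x y <-> y = graph_true x.
Proof.
have [xJ1 xJ2] := xJ_bounds K; have [xs1 _ _ _] := s_bounds K => hx y0.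
have h' : xJ K <= xs K by clear -K xJ2 xs1; lra.
have E : x <= xs K -> graph_true x = graph_false x.
  case: (lerP x (xJ K)) => h1 h2; first by rewrite graph_true_low ?graph_false_low.
  by rewrite graph_true_cap ?graph_false_cap // ltW.
case: (lerP x (xs K)) => hs.
  rewrite E //; split.
    case=> [i|[h1 _ h2]]; first exact/inner_graph_spec.
    have -> : x = xs K by apply/eqP; rewrite eq_le hs h1.
    rewrite graph_false_cap //; apply/cap_graph_spec => //.
    by move: h2; have -> : x = xs K by apply/eqP; rewrite eq_le hs h1.
  by move=> e; left; apply/inner_graph_spec.
rewrite graph_true_cap ?(le_trans h' (ltW hs)) //; split.
  case=> [/inner_bounds[_ h _ _]|[_ _ h]]; last exact/cap_graph_spec.
  by move: hs; rewrite ltNge h.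
by move/(cap_graph_spec x y0) => h; right; split=> //; exact: ltW.
Qed.

Lemma refl_cap_circle x y : (rx K x y - 11 / 3) ^+ 2 + ry K x y ^+ 2 =
  (x - 2 * ys K) ^+ 2 + (y - 2 * ys K) ^+ 2.
Proof.
rewrite {1}up_center; have := refl_sqd K x y (2 * xs K - 11 / 3) (2 * ys K).
rewrite /sqd => <-; have [sx sy] := s_def K.
have E : rx K (2 * xs K - 11 / 3) (2 * ys K) = 11 / 3.
  transitivity (11 / 3 * (q K ^+ 2 / 2)); first by rewrite /rx sx sy; field.
  by rewrite half_q_sq mulr1.
have E' : ry K (2 * xs K - 11 / 3) (2 * ys K) = 0 by rewrite /ry sx sy; field.
by rewrite E E' subr0.
Qed.

(** Staying below [2 * ys K] selects the lower half of the reflected cap circle; [v < u] makes the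
    reflected ordinate positive. *)
Lemma wing_false_graph u v : 17 / 12 < u -> 0 < v -> v < u -> v < 2 * ys K ->
  wing K false u v <-> v = graph_false u.
Proof.
move=> hu v0 vu vs; have [xs1 xs2 ys1 ys2] := s_bounds K.
have up : xs K <= u -> cap_circle K (rx K u v) (ry K u v) <-> v = graph_false u.
  move=> h; rewrite graph_false_up // /cap_circle refl_cap_circle; split=> e.
    rewrite (sqrt_eq (z := 2 * ys K - v)); first by clear; ring.
      by rewrite subr_ge0 ltW.
    by clear -K e; lra.
  have e' : 2 * ys K - v = Num.sqrt (rc K ^+ 2 - (u - 2 * ys K) ^+ 2).
    by rewrite {1}e; move: (Num.sqrt _) => z; clear; ring.
  have p : 0 < 2 * ys K - v by rewrite subr_gt0.
  by have := sqr_sqrt_gt0 p e'; clear; lra.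
case: (lerP u (xs K)) => hs.
  split=> [[i|c]|e]; last by left; apply/inner_graph_spec.
    exact/inner_graph_spec.
  have [h _] := cap_up_bounds c; apply/up => //; by case: c.
split=> [[/inner_bounds[_ h _ _]|c]|e].
- by move: hs; rewrite ltNge h.
- by apply/up; [exact: ltW | case: c].
right; have q0 : 0 <= q K / 2 by have [q1 _] := q_bounds K; clear -K q1; lra.
have vy : ys K <= v.
  rewrite e graph_false_up ?(ltW hs) //.
  have h0 : 0 <= xs K - 2 * ys K by rewrite up_center; clear -K xs2; lra.
  have h1 : xs K - 2 * ys K <= u - 2 * ys K by rewrite lerD2r ltW.
  have := sqrt_sub_le (rc K ^+ 2) h0 h1; rewrite up_graph_s.
  by move: (Num.sqrt _) => z; clear; lra.
split; last by apply/up; [exact: ltW|].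
  have [<- _] := refl_s K; rewrite /rx ler_wpM2l //.
  by clear -K vy hs; lra.
by rewrite /ry mulr_ge0 // subr_ge0 ltW.
Qed.

(** When the original ordinate increases, [rx] increases and [ry] decreases; with a monotone graph,
    [graph_false (rx) - ry] then increases strictly, as a chart in the original coordinates
    requires. *)
Lemma graph_false_mono u u' : 17 / 12 <= u -> u <= u' -> graph_false u <= graph_false u'.
Proof.
have [xJ1 xJ2] := xJ_bounds K; have [xs1 xs2 _ _] := s_bounds K => h0 h.
rewrite /graph_false; apply: lerD; [apply: lerD; [apply: lerD|]|].
- rewrite /arc2_graph lerD2l; apply: sqrt_sub_le.
    by rewrite subr_ge0 ge_min lexx orbT.
  by rewrite lerD2l lerN2 le_min !ge_min lexx orbT h.
- rewrite /arc3_graph lerD2l lerN2; apply: sqrt_sub_le.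
    by rewrite subr_ge0 le_max lexx orbT.
  rewrite lerD2r ge_max !le_max lexx orbT andbT; apply/orP; left.
  by rewrite le_min !ge_min h lexx orbT.
- rewrite lerD2r /cap_graph; apply: sqrt_sub_le.
    rewrite subr_ge0 ge_max ge_min; apply/andP; split; last by clear -K xJ2; lra.
    by apply/orP; right; clear -K xs2; lra.
  rewrite lerD2l lerN2 ge_max !le_max lexx orbT andbT; apply/orP; left.
  by rewrite le_min !ge_min h lexx orbT.
- rewrite /up_graph lerD2l lerN2; apply: sqrt_sub_le.
    by rewrite subr_ge0 le_max up_center; apply/orP; right; clear -K xs2; lra.
  by rewrite lerD2r ge_max !le_max lexx h orbT.
Qed.

End Graphs.

(** * Plane sets locally defined by monotone functions *)

Section LocalGraph.
Variable R : realType.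
Implicit Types (x y : R) (P : R -> R -> Prop).

Lemma open_ltf (T : topologicalType) (f g : T -> R) :
  continuous f -> continuous g -> open [set z | f z < g z].
Proof.
move=> cf cg.
rewrite (_ : mkset _ = (fun z => g z - f z) @^-1` [set t | 0 < t]); last first.
  by apply/seteqP; split=> z /=; rewrite subr_gt0.
apply: open_comp; last exact: open_gt.
by move=> z _; apply: contB; [exact: cg | exact: cf].
Qed.

(** This form is stable under the symmetries of the square and pulls back under revolution to the
    hypotheses of [monotone_chart], which an explicit graph would do less directly. *)
Definition local_graph P px py := exists (N : set (R * R)) (psi : R -> R -> R) (xdir : bool),
  [/\ open N, N (px, py), continuous (fun z : R * R => psi z.1 z.2),
      (forall x y, N (x, y) -> P x y <-> psi x y = 0) &
      forall x y x' y', N (x, y) -> N (x', y') ->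
        (if xdir then y = y' /\ x < x' else x = x' /\ y < y') -> psi x y < psi x' y'].

Lemma fst_cont (z : R * R) : {for z, continuous (fun z : R * R => z.1)}.
Proof. exact: cvg_fst. Qed.

Lemma snd_cont (z : R * R) : {for z, continuous (fun z : R * R => z.2)}.
Proof. exact: cvg_snd. Qed.

Lemma pair_cont (T : topologicalType) (f g : T -> R) z :
  {for z, continuous f} -> {for z, continuous g} ->
  {for z, continuous (fun z => (f z, g z))}.
Proof.
move=> cf cg; have FF : Filter (nbhs z) by exact: nbhs_filter.
suff : (f x, g x) @[x --> z] --> (f z, g z) by [].
exact: (cvg_pair cf cg).
Qed.

Lemma local_graph_swap P px py : (forall x y, P x y <-> P y x) ->
  local_graph P px py -> local_graph P py px.
Proof.
move=> sP [N [psi [xd [oN Np cpsi H mono]]]].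
exists ((fun z => (z.2, z.1)) @^-1` N), (fun x y => psi y x), (~~ xd); split=> //.
- apply: open_comp => // z _; apply: pair_cont; [exact: snd_cont | exact: fst_cont].
- move=> z; apply: (@continuous_comp _ _ _ (fun z : R * R => (z.2, z.1))
    (fun z : R * R => psi z.1 z.2)); last exact: cpsi.
  by apply: pair_cont; [exact: snd_cont | exact: fst_cont].
- by move=> x y n; rewrite sP; exact: H.
- by move=> x y x' y' n n'; case: xd mono => mono h; exact: mono.
Qed.

Lemma local_graph_opp P px py : (forall x y, P x y <-> P (- x) y) ->
  local_graph P px py -> local_graph P (- px) py.
Proof.
move=> sP [N [psi [xd [oN Np cpsi H mono]]]].
have cn z : {for z, continuous (fun z : R * R => (- z.1, z.2))}.
  by apply: pair_cont; [apply: contN; exact: fst_cont | exact: snd_cont].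
have cc : continuous (fun z : R * R => psi (- z.1) z.2).
  move=> z; apply: (@continuous_comp _ _ _ (fun z : R * R => (- z.1, z.2))
    (fun z : R * R => psi z.1 z.2)); [exact: cn | exact: cpsi].
exists ((fun z => (- z.1, z.2)) @^-1` N).
exists (if xd then fun x y => - psi (- x) y else fun x y => psi (- x) y), xd; split.
- by apply: open_comp => // z _; exact: cn.
- by rewrite /preimage /= opprK.
- by case: (xd) => /= z; [exact: (contN (cc z)) | exact: cc].
- move=> x y n; rewrite sP; case: (xd); last exact: H.
  by rewrite (H _ _ n); split=> [->|/eqP]; [rewrite oppr0 | rewrite oppr_eq0 => /eqP].
- move=> x y x' y' n n'; case: xd mono => mono [h1 h2].
    by rewrite ltrN2; apply: mono => //; split=> //; rewrite ltrN2.
  by apply: mono => //; split=> //; rewrite h1.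
Qed.

Lemma local_graph_fold P : (forall x y, P x y <-> P y x) ->
  (forall x y, P x y <-> P (- x) y) ->
  (forall x y, 0 <= y -> y <= x -> P x y -> local_graph P x y) ->
  forall x y, P x y -> local_graph P x y.
Proof.
move=> sw op H.
have oppx x y : (P `|x| y -> local_graph P `|x| y) -> P x y -> local_graph P x y.
  case: (ger0P x) => x0 h p; first exact: h.
  rewrite -[x]opprK; apply: (local_graph_opp op); apply: h.
  exact: (iffLR (op x y) p).
have all x y : (P `|x| `|y| -> local_graph P `|x| `|y|) -> P x y -> local_graph P x y.
  move=> h; apply: (oppx x) => p; apply: (local_graph_swap sw).
  apply: (oppx y) => [p'|]; last exact: (iffLR (sw _ _) p).
  by apply: (local_graph_swap sw); apply: h; exact: (iffLR (sw _ _) p').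
move=> x y; apply: all => p; case: (lerP `|y| `|x|) => h.
  by apply: H => //; exact: normr_ge0.
apply: (local_graph_swap sw); apply: H; [exact: normr_ge0 | exact: ltW |].
exact: (iffLR (sw _ _) p).
Qed.

End LocalGraph.

(** * Charts of the two plane curves *)

Section PlanarCharts.
Variables (R : realType) (K : config R).
Implicit Types x y u v : R.

Lemma planar_swap d x y : planar K d x y <-> planar K d y x.
Proof. by rewrite /planar (fx_swap x) (fy_swap x). Qed.

Lemma planar_opp d x y : planar K d x y <-> planar K d (- x) y.
Proof. by rewrite /planar /fx /fy normrN. Qed.

Lemma fold_abs x y : `|y| < x -> fx x y = x /\ fy x y = `|y|.
Proof.
move=> h; have x0 : 0 <= x by apply: ltW; exact: le_lt_trans h.
by rewrite /fx /fy (ger0_norm x0) max_l ?min_r // ltW.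
Qed.

Lemma fold_sum x y : 0 <= x -> 0 <= y ->
  rx K (fx x y) (fy x y) = rx K x y /\ ry K (fx x y) (fy x y) = `|ry K x y|.
Proof.
move=> x0 y0; rewrite /fx /fy /rx /ry (ger0_norm x0) (ger0_norm y0).
have q0 : 0 <= q K / 2 by have [q1 _] := q_bounds K; clear -K q1; lra.
case: (lerP x y) => h; rewrite normrM (ger0_norm q0); split; congr (_ * _).
- exact: addrC.
- by rewrite ler0_norm ?subr_le0 // opprB.
- by rewrite ger0_norm // subr_ge0 ltW.
Qed.

Lemma rx_cont (z : R * R) : {for z, continuous (fun z : R * R => rx K z.1 z.2)}.
Proof.
apply: contM; first exact: cont_cst.
by apply: contD; [exact: fst_cont | exact: snd_cont].
Qed.

Lemma ry_cont (z : R * R) : {for z, continuous (fun z : R * R => ry K z.1 z.2)}.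
Proof.
apply: contM; first exact: cont_cst.
by apply: contB; [exact: fst_cont | exact: snd_cont].
Qed.

Lemma left_graph_cont (z : R) : {for z, continuous (@left_graph R)}.
Proof.
apply: contB; first exact: cont_cst.
apply: cont_sqrt; apply: contB; first exact: cont_cst.
apply: contX2; apply: cont_max; last exact: cont_cst.
by apply: contB; [exact: id | exact: cont_cst].
Qed.

Lemma cap_graph_cont (T : topologicalType) (f : T -> R) (z : T) : {for z, continuous f} ->
  {for z, continuous (fun t => cap_graph K (f t))}.
Proof.
move=> cf; apply: cont_sqrt; apply: contB; first exact: cont_cst.
by apply: contX2; apply: contB; [exact: cont_cst | exact: cf].
Qed.

Lemma low_graph_cont (z : R) : {for z, continuous (low_graph K)}.
Proof.
have ci : {for z, continuous (fun t : R => t)} by exact: id.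
apply: contD.
  apply: contD; first exact: cont_cst.
  apply: cont_sqrt; apply: contB; first exact: cont_cst.
  apply: contX2; apply: contB; first exact: cont_cst.
  by apply: cont_min; [exact: ci | exact: cont_cst].
apply: contB; first exact: cont_cst.
apply: cont_sqrt; apply: contB; first exact: cont_cst.
apply: contX2; apply: contB; last exact: cont_cst.
apply: cont_max; last exact: cont_cst.
by apply: cont_min; [exact: ci | exact: cont_cst].
Qed.

Lemma graph_true_cont (z : R) : {for z, continuous (graph_true K)}.
Proof.
have ci : {for z, continuous (fun t : R => t)} by exact: id.
apply: contD; first exact: low_graph_cont.
apply: contB; last exact: cont_cst.
by apply: cap_graph_cont; apply: cont_max; [exact: ci | exact: cont_cst].
Qed.

Lemma graph_false_cont (z : R) : {for z, continuous (graph_false K)}.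
Proof.
have ci : {for z, continuous (fun t : R => t)} by exact: id.
apply: contD.
  apply: contD; first exact: low_graph_cont.
  apply: contB; last exact: cont_cst.
  apply: cap_graph_cont; apply: cont_max; last exact: cont_cst.
  by apply: cont_min; [exact: ci | exact: cont_cst].
apply: contB; first exact: cont_cst.
apply: cont_sqrt; apply: contB; first exact: cont_cst.
apply: contX2; apply: contB; last exact: cont_cst.
by apply: cont_max; [exact: ci | exact: cont_cst].
Qed.

Lemma wing_cap_right d x y : 11 / 3 < x ->
  wing K d (frx K d x y) (fry K d x y) -> cap K x y.
Proof.
move=> hx; have [_ xs2 _ _] := s_bounds K; case: d => [[/inner_bounds[_ h _ _]|//]|[i|]].
- exfalso; move: h => /= h; clear -K xs2 h hx; lra.
- exfalso; have [_ h1 _ h2] := inner_bounds i; have xE := rxK K x y.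
  have [sE _] := refl_s K; have q0 : 0 <= q K / 2.
    by have [q1 _] := q_bounds K; clear -K q1; lra.
  have : x <= xs K; last by clear -K xs2 hx; lra.
  by rewrite -xE -sE /rx ler_wpM2l // lerD.
- by rewrite /= rxK ryK.
Qed.

Lemma chart_cap d x y : `|y| < x -> 11 / 3 < x -> local_graph (planar K d) x y.
Proof.
move=> hy hx.
exists [set z | `|z.2| < z.1 /\ 11 / 3 < z.1].
exists (fun x y => (x - 11 / 3) ^+ 2 + y ^+ 2 - rc K ^+ 2), true; split => //.
- apply: openI; apply: open_ltf => z; try exact: fst_cont; last exact: cont_cst.
  by apply: cont_norm; exact: snd_cont.
- apply: contP => z; apply: contB; last exact: cont_cst.
  apply: contD; apply: contX2; last exact: snd_cont.
  by apply: contB; [exact: fst_cont | exact: cont_cst].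
- move=> a c [/= h1 h2]; rewrite /planar; have [-> ->] := fold_abs h1.
  rewrite -(real_normK (num_real c)).
  split=> [/(wing_cap_right h2)[_ _ h]|h].
    by apply/eqP; rewrite subr_eq0; apply/eqP; exact: h.
  have cp : cap K a `|c|.
    have [_ xs2 _ _] := s_bounds K; split=> //; first by clear -K xs2 h2; lra.
    by apply/eqP; rewrite -subr_eq0; apply/eqP; exact: h.
  by right; case: (d) => //=; rewrite rxK ryK.
- move=> a c a' c' [_ /= h1] [_ /= h2] [-> lt].
  rewrite ltrD2r ltrD2r ltr_sqr ?nnegrE ?subr_ge0 ?ltW //.
  by rewrite ltrD2r.
Qed.

Lemma chart_left x y : `|y| < x -> x < 29 / 12 -> local_graph (planar K true) x y.
Proof.
move=> hy hx.
exists [set z | `|z.2| < z.1 /\ z.1 < 29 / 12].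
exists (fun x y => x - left_graph `|y|), true; split => //.
- apply: openI; apply: open_ltf => z; try exact: fst_cont; last exact: cont_cst.
  by apply: cont_norm; exact: snd_cont.
- apply: contP => z; apply: contB; first exact: fst_cont.
  apply: cont_comp; last exact: left_graph_cont.
  by apply: cont_norm; exact: snd_cont.
- move=> a c [/= h1 h2]; rewrite /planar; have [-> ->] := fold_abs h1.
  rewrite [frx _ _ _ _]/= [fry _ _ _ _]/= wing_left // ?normr_ge0 //.
  by split=> [->|/eqP]; [rewrite subrr | rewrite subr_eq0 => /eqP].
- by move=> a c a' c' _ _ [-> lt]; rewrite ltrD2r.
Qed.

Lemma chart_top x y : 0 < y -> y < x -> 17 / 12 < x -> local_graph (planar K true) x y.
Proof.
move=> y0 yx hx.
exists [set z | (0 < z.2 /\ z.2 < z.1) /\ 17 / 12 < z.1].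
exists (fun x y => y - graph_true K x), false; split => //.
- apply: openI; [apply: openI|]; apply: open_ltf => z;
    by [exact: fst_cont | exact: snd_cont | exact: cont_cst].
- apply: contP => z; apply: contB; first exact: snd_cont.
  by apply: cont_comp; [exact: fst_cont | exact: graph_true_cont].
- move=> a c [/= [h1 h2] h3]; rewrite /planar.
  have [-> ->] := fold_id (ltW h1) (ltW h2); rewrite [frx _ _ _ _]/= [fry _ _ _ _]/=.
  rewrite wing_true_graph //.
  by split=> [->|/eqP]; [rewrite subrr | rewrite subr_eq0 => /eqP].
- by move=> a c a' c' _ _ [-> lt]; rewrite ltrD2r.
Qed.

Lemma r_move x y y' : y < y' -> rx K x y < rx K x y' /\ ry K x y' < ry K x y.
Proof.
move=> lt; have q0 : 0 < q K / 2 by have [q1 _] := q_bounds K; clear -K q1; lra.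
by rewrite /rx /ry !ltr_pM2l // !ltrD2l ltrN2.
Qed.

(** Across the diagonal, folding replaces [ry] by its absolute value. This does no harm, because in
    these coordinates the chain starts with the vertical segment [arc1]. *)
Lemma chart_diag x y : 0 < x -> 0 < y -> `|ry K x y| < 1 / 17 -> rx K x y < 29 / 12 ->
  local_graph (planar K false) x y.
Proof.
move=> x0 y0 h1 h2.
exists [set z | ((0 < z.1 /\ 0 < z.2) /\ `|ry K z.1 z.2| < 1 / 17) /\ rx K z.1 z.2 < 29 / 12].
exists (fun x y => rx K x y - 17 / 12), false; split => //.
- apply: openI; [apply: openI; [apply: openI|]|]; apply: open_ltf => z;
    try by [exact: fst_cont | exact: snd_cont | exact: cont_cst | exact: rx_cont].
  exact: (cont_norm (@ry_cont z)).
- by apply: contP => z; apply: contB; [exact: rx_cont | exact: cont_cst].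
- move=> a c [/= [[a0 c0] l1] l2]; rewrite /planar.
  rewrite [frx _ _ _ _]/= [fry _ _ _ _]/=; have [-> ->] := fold_sum (ltW a0) (ltW c0).
  rewrite wing_left // ?normr_ge0 // left_graph_low ?ltW //.
  by split=> [->|/eqP]; [rewrite subrr | rewrite subr_eq0 => /eqP].
- by move=> a c a' c' _ _ [-> lt]; rewrite ltrD2r; have [] := r_move a' lt.
Qed.

Lemma chart_false_left x y : 0 < y -> y < x -> rx K x y < 29 / 12 ->
  local_graph (planar K false) x y.
Proof.
move=> y0 yx hx; have q0 : 0 < q K / 2 by have [q1 _] := q_bounds K; clear -K q1; lra.
exists [set z | (0 < z.2 /\ z.2 < z.1) /\ rx K z.1 z.2 < 29 / 12].
exists (fun x y => rx K x y - left_graph (ry K x y)), false; split => //.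
- apply: openI; [apply: openI|]; apply: open_ltf => z;
    by [exact: fst_cont | exact: snd_cont | exact: cont_cst | exact: rx_cont].
- apply: contP => z; apply: contB; first exact: rx_cont.
  by apply: cont_comp; [exact: ry_cont | exact: left_graph_cont].
- move=> a c [/= [h1 h2] h3]; rewrite /planar.
  have [-> ->] := fold_id (ltW h1) (ltW h2); rewrite [frx _ _ _ _]/= [fry _ _ _ _]/=.
  rewrite wing_left //; last by rewrite /ry mulr_ge0 ?ltW // subr_gt0.
  by split=> [->|/eqP]; [rewrite subrr | rewrite subr_eq0 => /eqP].
- move=> a c a' c' _ _ [-> lt]; have [l1 l2] := r_move a' lt.
  by apply: ltr_leD => //; rewrite lerN2 left_graph_mono // ltW.
Qed.

Lemma chart_false_top x y : 0 < y -> y < x -> 17 / 12 < rx K x y -> ry K x y < 2 * ys K ->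
  local_graph (planar K false) x y.
Proof.
move=> y0 yx hx hy; have q0 : 0 < q K / 2 by have [q1 _] := q_bounds K; clear -K q1; lra.
exists [set z | ((0 < z.2 /\ z.2 < z.1) /\ 17 / 12 < rx K z.1 z.2) /\ ry K z.1 z.2 < 2 * ys K].
exists (fun x y => graph_false K (rx K x y) - ry K x y), false; split => //.
- apply: openI; [apply: openI; [apply: openI|]|]; apply: open_ltf => z;
    by [exact: fst_cont | exact: snd_cont | exact: cont_cst | exact: rx_cont | exact: ry_cont].
- apply: contP => z; apply: contB; last exact: ry_cont.
  by apply: cont_comp; [exact: rx_cont | exact: graph_false_cont].
- move=> a c [/= [[h1 h2] h3] h4]; rewrite /planar.
  have [-> ->] := fold_id (ltW h1) (ltW h2); rewrite [frx _ _ _ _]/= [fry _ _ _ _]/=.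
  rewrite wing_false_graph //.
  + by split=> [->|/eqP]; [rewrite subrr | rewrite subr_eq0 => /eqP].
  + by rewrite /ry mulr_gt0 // subr_gt0.
  + by rewrite /ry /rx ltr_pM2l //; clear -K h1; lra.
- move=> a c a' c' [[_ /= h3] _] _ [e lt]; rewrite e in h3 *; have [l1 l2] := r_move a' lt.
  by apply: ler_ltD; [apply: graph_false_mono; exact: ltW | rewrite ltrN2].
Qed.


Lemma planar_charts d x y : planar K d x y -> local_graph (planar K d) x y.
Proof.
apply: local_graph_fold => [a c|a c|{}x {}y y0 yx P]; [exact: planar_swap|exact: planar_opp|].
case: (lerP x (11 / 3)) => hx; last first.
  apply: chart_cap => //; rewrite ger0_norm //.
  have := P; rewrite /planar; have [-> ->] := fold_id y0 yx.
  by move/(wing_cap_right hx)/cap_far => h; clear -K h; lra.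
have [xs1 xs2 ys1 ys2] := s_bounds K.
move: P; rewrite /planar; have [-> ->] := fold_id y0 yx.
case: d => [/= w|/= w].
  have yx' : y < x by case: w => [/inner_gap|/cap_far] h; clear -K h; lra.
  case: (lerP (29 / 12) x) => h1; last by apply: chart_left => //; rewrite ger0_norm.
  apply: chart_top => //; last by clear -K h1; lra.
  rewrite lt_neqAle y0 andbT; apply/eqP => y0E; case: w => [[a|a|a|a]|[l1 l2 l3]].
  - by case: a => e _; clear -K e h1; lra.
  - by case: a => _ l _; clear -K l y0E; lra.
  - by have [l _] := arc3_bounds a; clear -K l y0E; lra.
  - by have [l _] := arc4_bounds a; have [l' _] := yJ_bounds K; clear -K l l' y0E; lra.
  - have [r1 _] := rc_bounds K; move: l3; rewrite /cap_circle -y0E expr0n addr0.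
    move/eqP; rewrite eqf_sqr => /orP[]/eqP e; clear -K e r1 xs1 hx l1; lra.
have q0 : 0 < q K / 2 by have [q1 _] := q_bounds K; clear -K q1; lra.
have yp : 0 < y.
  case: w => [/inner_gap h|].
    have := ryK K x y; rewrite {1}/ry => <-; rewrite mulr_gt0 //; clear -K h; lra.
  rewrite rxK ryK => c; case: (cap_dich c) => h; first by clear -K h ys1; lra.
  by exfalso; clear -K h hx xs2; lra.
have ry0 : 0 <= ry K x y by rewrite /ry mulr_ge0 ?subr_ge0 // ltW.
case: (ltrP (ry K x y) (1 / 17)) => h1.
  apply: chart_diag => //; [exact: lt_le_trans yx | by rewrite ger0_norm |].
  have : rx K x y = left_graph (ry K x y) \/ 29 / 12 <= rx K x y.
    case: (ltrP (rx K x y) (29 / 12)) => h2; last by right.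
    by left; apply/wing_left; [exact: h2|exact: ry0|exact: w].
  case=> [->|h2]; first by rewrite left_graph_low ?ltW //; lra.
  exfalso; case: w => [[a|a|a|a]|a].
  - by case: a => e _; clear -K e h2; lra.
  - by case: a => _ l _; clear -K l h1; lra.
  - by have [l _] := arc3_bounds a; clear -K l h1; lra.
  - by have [l _] := arc4_bounds a; have [l' _] := yJ_bounds K; clear -K l l' h1; lra.
  - by have [_ l] := cap_up_bounds a; clear -K l h1 ys1; lra.
have yx' : y < x by move: h1; rewrite /ry => h1; rewrite -subr_gt0 -(pmulr_rgt0 _ q0); clear -K h1; lra.
case: (ltrP (rx K x y) (29 / 12)) => h2; first exact: chart_false_left.
apply: chart_false_top => //; first by clear -K h2; lra.
case: w => [/inner_bounds[_ _ _ h]|]; first by clear -K h ys1; lra.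
rewrite rxK ryK => c; case: (cap_dich c) => h; last by exfalso; clear -K h hx xs2; lra.
have : ry K x y <= q K / 2 * (11 / 3 - ys K).
  by rewrite /ry ler_wpM2l ?(ltW q0) //; clear -K h hx; lra.
have [q1 q2] := q_bounds K => h3.
by apply: (le_lt_trans h3); clear -K q2 ys1 ys2 q0; nra.
Qed.

End PlanarCharts.

(** * Revolution *)

Section Revolution.
Variable R : realType.

Lemma cont_sum (T : topologicalType) n (F : 'I_n -> T -> R) (x : T) :
  (forall i, {for x, continuous (F i)}) ->
  {for x, continuous (fun v => \sum_(i < n) F i v)}.
Proof.
elim: n F => [|n IH] F cF.
  rewrite (_ : (fun _ => _) = fun _ => 0); first exact: cont_cst.
  by apply/funext => v; rewrite big_ord0.
rewrite (_ : (fun _ => _) = fun v => F ord0 v + \sum_(i < n) F (lift ord0 i) v).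
  by apply: contD; [exact: cF | apply: IH => i; exact: cF].
by apply/funext => v; rewrite big_ord_recl.
Qed.

Section Dot.
Variable n : nat.
Implicit Types w u : 'rV[R]_n.

Definition dot w u : R := \sum_(j < n) w ord0 j * u ord0 j.
Definition nrm w : R := Num.sqrt (dot w w).

Lemma dot_ge0 w : 0 <= dot w w.
Proof. by apply: sumr_ge0 => j _; rewrite -expr2 sqr_ge0. Qed.

Lemma nrm_ge0 w : 0 <= nrm w.
Proof. exact: sqrtr_ge0. Qed.

Lemma nrm_sqr w : nrm w ^+ 2 = dot w w.
Proof. by rewrite sqr_sqrtr // dot_ge0. Qed.

Lemma dot_comb (a c : R) w u :
  \sum_(j < n) (a * w ord0 j - c * u ord0 j) ^+ 2 =
  a ^+ 2 * dot w w - 2 * a * c * dot w u + c ^+ 2 * dot u u.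
Proof.
rewrite /dot !mulr_sumr -sumrB -big_split /=; apply: eq_bigr => j _; ring.
Qed.

Lemma nrm_eq0 w : nrm w = 0 -> w = 0.
Proof.
move=> e; apply/rowP => j; rewrite mxE; apply/eqP; rewrite -sqrf_eq0 expr2.
have := nrm_sqr w; rewrite e expr0n /= => /esym/eqP.
rewrite psumr_eq0; last by move=> i _; rewrite -expr2 sqr_ge0.
by move/allP => /(_ j (mem_index_enum _)).
Qed.

Lemma nrmZ a w : 0 <= a -> nrm (a *: w) = a * nrm w.
Proof.
move=> a0; rewrite /nrm (_ : dot _ _ = a ^+ 2 * dot w w).
  by rewrite sqrtrM ?sqr_ge0 // sqrtr_sqr ger0_norm.
by rewrite /dot mulr_sumr; apply: eq_bigr => j _; rewrite !mxE; ring.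
Qed.

Lemma dot_le w u : dot w u <= nrm w * nrm u.
Proof.
case: (eqVneq (nrm w) 0) => [e|w0].
  by rewrite e (nrm_eq0 e) mul0r /dot big1 // => j _; rewrite mxE mul0r.
case: (eqVneq (nrm u) 0) => [e|u0].
  by rewrite e (nrm_eq0 e) mulr0 /dot big1 // => j _; rewrite mxE mulr0.
have p : 0 < nrm w * nrm u by rewrite mulr_gt0 // lt_neqAle eq_sym ?w0 ?u0 nrm_ge0.
have : 0 <= \sum_(j < n) (nrm u * w ord0 j - nrm w * u ord0 j) ^+ 2.
  by apply: sumr_ge0 => j _; rewrite sqr_ge0.
rewrite dot_comb -!nrm_sqr => h.
have : 0 <= (nrm w * nrm u) * (nrm w * nrm u - dot w u) by clear -h; lra.
by rewrite pmulr_rge0 // subr_ge0.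
Qed.

Lemma dot_eq w u : 0 < nrm w -> nrm w * nrm u <= dot w u ->
  u = (nrm u / nrm w) *: w.
Proof.
move=> w0 h; have : \sum_(j < n) (nrm u * w ord0 j - nrm w * u ord0 j) ^+ 2 = 0.
  apply/eqP; rewrite eq_le; apply/andP; split; last first.
    by apply: sumr_ge0 => j _; rewrite sqr_ge0.
  rewrite dot_comb -!nrm_sqr.
  have : 0 <= nrm w * nrm u * (dot w u - nrm w * nrm u).
    by rewrite mulr_ge0 ?subr_ge0 // mulr_ge0 ?nrm_ge0.
  by clear; lra.
move/eqP; rewrite psumr_eq0; last by move=> j _; rewrite sqr_ge0.
move/allP => H; apply/rowP => j; rewrite mxE.
have := H j (mem_index_enum _); rewrite sqrf_eq0 subr_eq0 => /eqP e.
by apply: (mulfI (lt0r_neq0 w0)); rewrite -e mulrA [nrm w * _]mulrC divfK // gt_eqF.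
Qed.

End Dot.

Lemma nrm_continuous n (T : topologicalType) (f : T -> 'rV[R]_n) x :
  {for x, continuous f} -> {for x, continuous (fun v => nrm (f v))}.
Proof.
move=> cf; apply: cont_sqrt; apply: cont_sum => i.
have c : {for x, continuous (fun v => f v ord0 i)}.
  exact: (@continuous_comp _ _ _ f (fun w : 'rV[R]_n => w ord0 i) x cf (@coord_continuous _ _ _ ord0 i _)).
by apply: contM.
Qed.

(** * Profiles, meridians and distances *)

Section Solid.
Variable m : nat.
Local Notation V := 'rV[R]_(m.+2).
Local Notation edist := (@Defs.edist R m.+2).
Implicit Types (v u : V) (P : R -> R -> Prop) (x y : R).

Definition hx v := v ord0 ord0.
(** The shift 10 is well above the bound 6 on the curves, so the hypersurfaces and all points within
    distance 1 of them avoid the axis. *)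
Definition hy v := nrm (del ord0 v) - 10.
Definition solid P : set V := [set v | P (hx v) (hy v)].

Lemma hx_cont v : {for v, continuous hx}.
Proof. exact: coord_continuous. Qed.

Lemma hy_cont v : {for v, continuous hy}.
Proof.
apply: contB; last exact: cont_cst.
by apply: nrm_continuous; exact: del_continuous.
Qed.

Lemma edist_sqr v u : edist v u ^+ 2 =
  (hx v - hx u) ^+ 2 + (dot (del ord0 v) (del ord0 v)
    - 2 * dot (del ord0 v) (del ord0 u) + dot (del ord0 u) (del ord0 u)).
Proof.
rewrite /Defs.edist sqr_sqrtr; last by apply: sumr_ge0 => j _; rewrite sqr_ge0.
rewrite big_ord_recl; congr (_ + _).
have := dot_comb 1 1 (del ord0 v) (del ord0 u); rewrite expr1n !mul1r !mulr1 => <-.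
by apply: eq_bigr => j _; rewrite !mul1r !mxE.
Qed.

Lemma edist_ge0 v u : 0 <= edist v u.
Proof. exact: sqrtr_ge0. Qed.

Lemma edistC v u : edist v u = edist u v.
Proof. by rewrite /Defs.edist; congr Num.sqrt; apply: eq_bigr => j _; rewrite -sqrrN opprB. Qed.

Lemma edist_cont u v : {for v, continuous (fun w => edist u w)}.
Proof.
apply: cont_sqrt; apply: cont_sum => i; apply: contX2.
by apply: contB; [exact: cont_cst | exact: coord_continuous].
Qed.

(** By Cauchy-Schwarz; [meridian_edist] shows that the distance is kept inside one meridian
    half-plane, and [meridian_eq] is the case of equality. *)
Lemma profile_sqd v u :
  sqd (hx v) (hy v) (hx u) (hy u) <= edist v u ^+ 2.
Proof.
rewrite edist_sqr -!nrm_sqr /sqd /hy lerD2l.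
by have := dot_le (del ord0 v) (del ord0 u); clear; lra.
Qed.

(* the copy of the planar point [(x, y)] in the half-plane through the axis and [w] *)
Definition meridian (w : 'rV[R]_m.+1) x y : V := ins ord0 x (((10 + y) / nrm w) *: w).

Lemma meridian_profile w x y : 0 < nrm w -> 0 <= 10 + y ->
  hx (meridian w x y) = x /\ hy (meridian w x y) = y.
Proof.
move=> w0 y0; rewrite /hx /hy /meridian ins_at del_ins nrmZ; last by rewrite divr_ge0 // ltW.
by rewrite divfK ?gt_eqF // shiftK.
Qed.

Lemma meridian_edist v x y : 0 < nrm (del ord0 v) -> 0 <= 10 + y ->
  edist v (meridian (del ord0 v) x y) ^+ 2 = sqd (hx v) (hy v) x y.
Proof.
move=> v0 y0; have [ex ey] := meridian_profile x v0 y0.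
have nE : nrm (del ord0 (meridian (del ord0 v) x y)) = 10 + y by rewrite -{2}ey /hy shiftB.
rewrite edist_sqr ex -!nrm_sqr nE /meridian del_ins /sqd; congr (_ + _).
have -> : dot (del ord0 v) (((10 + y) / nrm (del ord0 v)) *: del ord0 v) =
    (10 + y) / nrm (del ord0 v) * nrm (del ord0 v) ^+ 2.
  rewrite nrm_sqr /dot mulr_sumr; apply: eq_bigr => j _; rewrite !mxE; ring.
have -> : (10 + y) / nrm (del ord0 v) * nrm (del ord0 v) ^+ 2 = (10 + y) * nrm (del ord0 v).
  by rewrite expr2 mulrA divfK ?gt_eqF.
by rewrite /hy; move: (nrm _) => z; ring.
Qed.

Lemma meridian_eq v u : 0 < nrm (del ord0 v) ->
  edist v u ^+ 2 <= sqd (hx v) (hy v) (hx u) (hy u) -> u = meridian (del ord0 v) (hx u) (hy u).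
Proof.
move=> v0 h; rewrite /meridian /hy shiftB -dot_eq ?ins_del //.
by move: h; rewrite edist_sqr -!nrm_sqr /sqd /hy; clear; lra.
Qed.

(** Every profile point has a copy in the half-plane of [v] at its planar distance. So a nearest
    point attains the planar minimum, and by the case of equality it lies in that half-plane, where
    its profile determines it. *)
Lemma closest_unique P v : (forall x y, P x y -> `|y| <= 6) ->
  0 < nrm (del ord0 v) -> compact (solid P) -> solid P !=set0 ->
  (forall t x1 y1 x2 y2, (forall x y, P x y -> t <= sqd x y (hx v) (hy v)) ->
     P x1 y1 -> sqd x1 y1 (hx v) (hy v) = t ->
     P x2 y2 -> sqd x2 y2 (hx v) (hy v) = t -> x1 = x2 /\ y1 = y2) ->
  exists! c, closest (solid P) v c.
Proof.
move=> Pb v0 cP P0 U.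
have [c cin cmin] : exists2 c, c \in solid P & forall t, t \in solid P -> edist v c <= edist v t.
  apply: compact_EVT_min => //; apply: continuous_subspaceT => w.
  exact: edist_cont.
have Pc : solid P c by exact: set_mem.
have Cc : closest (solid P) v c by split=> // c' Pc'; apply: cmin; exact: mem_set.
have y10 x y : P x y -> 0 <= 10 + y by move/Pb; rewrite ler_norml => /andP[? _]; lra.
have key c' : closest (solid P) v c' ->
    edist v c' ^+ 2 = sqd (hx c') (hy c') (hx v) (hy v) /\
    forall x y, P x y -> sqd (hx c') (hy c') (hx v) (hy v) <= sqd x y (hx v) (hy v).
  move=> [Pc' hc'].
  have lb x y : P x y -> edist v c' ^+ 2 <= sqd x y (hx v) (hy v).
    move=> Pxy; have y0 := y10 _ _ Pxy; rewrite sqdC -meridian_edist //.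
    have [ex ey] := meridian_profile x v0 y0.
    by rewrite ler_sqr ?nnegrE ?edist_ge0 //; apply: hc'; rewrite /solid /= ex ey.
  have le1 := lb _ _ Pc'; have le2 := profile_sqd v c'; rewrite sqdC in le2.
  have e : edist v c' ^+ 2 = sqd (hx c') (hy c') (hx v) (hy v).
    by apply/eqP; rewrite eq_le le1 le2.
  by split=> // x y Pxy; rewrite -e; exact: lb.
exists c; split=> // c' Cc'.
have [e1 m1] := key _ Cc; have [e2 m2] := key _ Cc'.
have Pc' : solid P c' by case: Cc'.
have [ex ey] : hx c = hx c' /\ hy c = hy c'.
  apply: (U (sqd (hx c) (hy c) (hx v) (hy v))) => //.
  by apply/eqP; rewrite eq_le m2 // m1.
rewrite (meridian_eq v0 (u := c)); last by rewrite e1 sqdC.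
by rewrite (meridian_eq v0 (u := c')) ?ex ?ey // e2 sqdC.
Qed.

End Solid.
End Revolution.

(** * Compactness and sampling of the hypersurfaces *)

Section ClosedSets.
Variables (R : realType) (T : topologicalType).
Implicit Types (f g : T -> R) (A B C D : T -> Prop).

Lemma closed_lef f g : continuous f -> continuous g -> closed [set z | f z <= g z].
Proof.
move=> cf cg; rewrite (_ : mkset _ = ~` [set z | g z < f z]).
  by rewrite closedC; exact: open_ltf.
by apply/seteqP; split=> z /=; rewrite leNgt => /negP.
Qed.

Lemma closed_and A B : closed [set z | A z] -> closed [set z | B z] ->
  closed [set z | A z /\ B z].
Proof. exact: closedI. Qed.

Lemma closed_or A B : closed [set z | A z] -> closed [set z | B z] ->
  closed [set z | A z \/ B z].
Proof. exact: closedU. Qed.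

Lemma closed_eqf f g : continuous f -> continuous g -> closed [set z | f z = g z].
Proof.
move=> cf cg; rewrite (_ : mkset _ = [set z | f z <= g z /\ g z <= f z]).
  by apply: closed_and; exact: closed_lef.
apply/seteqP; split=> z /= => [->//|[h1 h2]].
by apply/eqP; rewrite eq_le h1 h2.
Qed.

Lemma closed_and3 A B C : closed [set z | A z] -> closed [set z | B z] ->
  closed [set z | C z] -> closed [set z | [/\ A z, B z & C z]].
Proof.
move=> a b c; rewrite (_ : mkset _ = [set z | A z /\ (B z /\ C z)]).
  by do 2 apply: closed_and => //.
by apply/seteqP; split=> z /= => [[]|[? []]].
Qed.

Lemma closed_and4 A B C D : closed [set z | A z] -> closed [set z | B z] ->
  closed [set z | C z] -> closed [set z | D z] ->
  closed [set z | [/\ A z, B z, C z & D z]].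
Proof.
move=> a b c d; rewrite (_ : mkset _ = [set z | A z /\ [/\ B z, C z & D z]]).
  by apply: closed_and => //; exact: closed_and3.
by apply/seteqP; split=> z /= => [[]|[? []]].
Qed.

End ClosedSets.

Section Closed.
Variables (R : realType) (K : config R) (T : topologicalType).
Variables X Y : T -> R.
Hypotheses (cX : continuous X) (cY : continuous Y).

Lemma circle_closed (a c r : R) :
  closed [set v | (X v - a) ^+ 2 + (Y v - c) ^+ 2 = r].
Proof.
apply: closed_eqf; apply: contP => z; last exact: cont_cst.
by apply: contD; apply: contX2; apply: contB;
  by [exact: cX | exact: cY | exact: cont_cst].
Qed.

Let cc (a : R) : continuous (fun _ : T => a).
Proof. by move=> z; exact: cont_cst. Qed.

Lemma cap_circle_closed : closed [set v | cap_circle K (X v) (Y v)].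
Proof.
rewrite (_ : mkset _ = [set v | (X v - 11 / 3) ^+ 2 + (Y v - 0) ^+ 2 = rc K ^+ 2]).
  exact: circle_closed.
by apply/seteqP; split=> v /=; rewrite subr0.
Qed.

Lemma inner_closed : closed [set v | inner K (X v) (Y v)].
Proof.
rewrite (_ : mkset _ = [set v | (arc1 (X v) (Y v) \/ arc2 (X v) (Y v)) \/
   (arc3 K (X v) (Y v) \/ arc4 K (X v) (Y v))]); last first.
  apply/seteqP; split=> v /= => [[]|[[]|[]]] h; try by [constructor|constructor 2|constructor 3|constructor 4].
  - by left; left.
  - by left; right.
  - by right; left.
  - by right; right.
apply: closed_or; apply: closed_or.
- rewrite (_ : mkset _ = [set v | X v = 17 / 12 /\ (0 <= Y v /\ Y v <= 1 / 17)]).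
    apply: closed_and; first exact: closed_eqf.
    by apply: closed_and; exact: closed_lef.
  by apply/seteqP; split=> v /= [e] => [/andP[]//|[h1 h2]]; split=> //; apply/andP.
- by apply: closed_and3; [exact: closed_lef|exact: closed_lef|exact: circle_closed].
- by apply: closed_and4; [exact: closed_lef|exact: closed_lef|exact: closed_lef|exact: circle_closed].
- by apply: closed_and4; [exact: closed_lef|exact: closed_lef|exact: closed_lef|exact: cap_circle_closed].
Qed.

Lemma cap_closed : closed [set v | cap K (X v) (Y v)].
Proof.
by apply: closed_and3; [exact: closed_lef|exact: closed_lef|exact: cap_circle_closed].
Qed.

End Closed.

(** * Finite samples of the hypersurfaces *)

Section SolidSampling.
Variables (R : realType) (K : config R) (m : nat).
Local Notation V := 'rV[R]_(m.+2).
Local Notation edist := (@Defs.edist R m.+2).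
Local Notation body := (@solid R m).

Lemma rxf_cont (T : topologicalType) (X Y : T -> R) : continuous X -> continuous Y ->
  continuous (fun v => rx K (X v) (Y v)).
Proof.
move=> cX cY; apply: contP => z; apply: contM; first exact: cont_cst.
by apply: contD; [exact: cX | exact: cY].
Qed.

Lemma ryf_cont (T : topologicalType) (X Y : T -> R) : continuous X -> continuous Y ->
  continuous (fun v => ry K (X v) (Y v)).
Proof.
move=> cX cY; apply: contP => z; apply: contM; first exact: cont_cst.
by apply: contB; [exact: cX | exact: cY].
Qed.

Lemma wing_closed d (T : topologicalType) (X Y : T -> R) : continuous X -> continuous Y ->
  closed [set v | wing K d (X v) (Y v)].
Proof.
move=> cX cY; apply: closed_or; first exact: inner_closed.
case: d; first exact: cap_closed.
by apply: cap_closed; [exact: rxf_cont | exact: ryf_cont].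
Qed.

Lemma fxf_cont : continuous (fun v : V => fx (hx v) (hy v)).
Proof.
apply: contP => z; apply: cont_max; apply: cont_norm; [exact: hx_cont | exact: hy_cont].
Qed.

Lemma fyf_cont : continuous (fun v : V => fy (hx v) (hy v)).
Proof.
apply: contP => z; apply: cont_min; apply: cont_norm; [exact: hx_cont | exact: hy_cont].
Qed.

Lemma solid_planar_closed d : closed (body (planar K d)).
Proof.
apply: (@wing_closed d V (fun v => frx K d (fx (hx v) (hy v)) (fy (hx v) (hy v)))
  (fun v => fry K d (fx (hx v) (hy v)) (fy (hx v) (hy v)))); case: d.
- exact: fxf_cont.
- exact: rxf_cont fxf_cont fyf_cont.
- exact: fyf_cont.
- exact: ryf_cont fxf_cont fyf_cont.
Qed.

Lemma solid_sample_closed x0 x1 : closed (body (sample_set K x0 x1)).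
Proof.
have cc (a : R) : continuous (fun _ : V => a) by move=> z; exact: cont_cst.
have E (x : R) : closed [set v : V | [/\ fx (hx v) (hy v) = x &
    fy (hx v) (hy v) = (q K - 1) * x]].
  by apply: closed_and; apply: closed_eqf => //; [exact: fxf_cont | exact: fyf_cont].
apply: closed_or; first exact: E.
by apply: closed_or; [exact: E | apply: cap_closed; [exact: fxf_cont | exact: fyf_cont]].
Qed.

Lemma planar_bounds d x y : planar K d x y -> `|x| <= 6 /\ `|y| <= 6.
Proof.
move=> P; have [_ xs2 _ _] := s_bounds K; have [_ r2] := rc_bounds K.
have capb : cap K (fx x y) (fy x y) -> fx x y <= 6.
  by move/cap_bounds=> [_ h]; clear -K h r2; lra.
suff h : fx x y <= 6.
  by split; apply: le_trans h; rewrite /fx le_max lexx ?orbT.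
case: (d) P => [[/inner_bounds[_ h _ _]|//]|[i|]].
- by move: h => /= h; clear -K h xs2; lra.
- have [_ h1 _ h2] := inner_bounds i; have xE := rxK K (fx x y) (fy x y).
  have [sE _] := refl_s K; have q0 : 0 <= q K / 2.
    by have [q1 _] := q_bounds K; clear -K q1; lra.
  have : rx K (rx K (fx x y) (fy x y)) (ry K (fx x y) (fy x y)) <= rx K (xs K) (ys K).
    by apply: (ler_wpM2l q0); exact: lerD.
  by rewrite xE sE; clear -K xs2; lra.
- by rewrite /= rxK ryK.
Qed.

Lemma solid_compact (P : R -> R -> Prop) : closed (body P) ->
  (forall x y, P x y -> `|x| <= 6 /\ `|y| <= 6) -> compact (body P).
Proof.
move=> cP Pb.
(* A profile ordinate of at most 6 bounds the norm of [del ord0 v] by 16. *)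
have cM : compact [set v : V | forall i, `[(- 16 : R), 16]%classic (v ord0 i)].
  by apply: (@rV_compact R _ (fun=> `[(- 16 : R), 16]%classic)) => _; exact: segment_compact.
apply: subclosed_compact cP cM _ => v Pv i.
have [bx by'] := Pb _ _ Pv; rewrite /= in_itv /= -ler_norml.
case: (unliftP ord0 i) => [j|] -> ; last by apply: (le_trans bx); lra.
have h1 : nrm (del ord0 v) <= 16.
  by move: by'; rewrite /hy ler_norml => /andP[_ ?]; lra.
apply: le_trans h1; rewrite -ler_sqr ?nnegrE ?nrm_ge0 // real_normK ?num_real //.
rewrite nrm_sqr /dot (bigD1 j) //= !mxE expr2 lerDl.
by apply: sumr_ge0 => k _; rewrite -expr2 sqr_ge0.
Qed.

Lemma finite_net (A : set V) (delta : R) : compact A -> 0 < delta ->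
  exists S : set V, [/\ finite_set S, S `<=` A &
    forall v, A v -> exists2 s, S s & edist v s < delta].
Proof.
rewrite compact_cover => cA d0.
have [||D' sD cov] := cA V A (fun u => [set w | edist u w < delta]).
- move=> u _; apply: open_ltf => w; [exact: edist_cont | exact: cont_cst].
- by move=> v Av; exists v => //=; rewrite /Defs.edist big1 ?sqrtr0 // => i _; rewrite subrr expr0n.
exists [set` D']; split; first exact: finite_fset.
  by move=> v /sD /set_mem.
move=> v /cov [u uD] /= h; exists u => //; by rewrite edistC.
Qed.

Lemma edist_nrm v u : edist v u = nrm (v - u).
Proof. by rewrite /Defs.edist /nrm /dot; congr Num.sqrt; apply: eq_bigr => j _; rewrite !mxE expr2. Qed.

Lemma edist_triangle v u w : edist v w <= edist v u + edist u w.
Proof.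
rewrite !edist_nrm (_ : v - w = (v - u) + (u - w)); last by rewrite addrA subrK.
move: (v - u) (u - w) => a c.
rewrite -ler_sqr ?nnegrE ?addr_ge0 ?nrm_ge0 // sqrrD !nrm_sqr.
have -> : dot (a + c) (a + c) = dot a a + 2 * dot a c + dot c c.
  by rewrite /dot mulr_sumr -!big_split /=; apply: eq_bigr => j _; rewrite !mxE; ring.
by have := dot_le a c; lra.
Qed.

(** The square of 41/57 slightly exceeds 15/29, so replacing shared points by a net may cost
    [(18 / 25 - 41 / 57) * g]; the mesh is this bound at the least radius 1/20. *)
Lemma solid_eps_sample d x0 x1 (S : set V) :
  (forall e x y, sample_set K x0 x1 x y -> planar K e x y) ->
  (forall px py, planar K d px py -> exists sx sy g,
    [/\ sample_set K x0 x1 sx sy, sqd px py sx sy <= 15 / 29 * g ^+ 2,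
        1 / 20 <= g & forall qx qy, sqd px py qx qy < g ^+ 2 -> near K d px py qx qy]) ->
  finite_set S ->
  (forall v, body (sample_set K x0 x1) v ->
     exists2 s, S s & edist v s < (18 / 25 - 41 / 57) / 20) ->
  eps_sample (72 / 100) S (body (planar K d)).
Proof.
move=> sP sam finS net; split=> // v Pv.
have [sx [sy [g [Ts le g0 nr]]]] := sam _ _ Pv.
have [_ vb] := planar_bounds Pv; have [_ sb] := planar_bounds (sP d _ _ Ts).
have gp : 0 < g by apply: lt_le_trans g0; lra.
have nv : 0 < nrm (del ord0 v).
  by move: vb; rewrite /hy ler_norml => /andP[? _]; lra.
have s0 : 0 <= 10 + sy by move: sb; rewrite ler_norml => /andP[? _]; lra.
have [ux uy] := meridian_profile sx nv s0.
have [|s Ss hs] := net (meridian (del ord0 v) sx sy); first by rewrite /= /solid /= ux uy.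
have e1 : edist v (meridian (del ord0 v) sx sy) <= 41 / 57 * g.
  rewrite -ler_sqr ?nnegrE ?edist_ge0 ?mulr_ge0 ?(ltW gp) //.
  by rewrite meridian_edist // (le_trans le) //; have := sqr_ge0 g; clear; nra.
have e2 : edist v s < 72 / 100 * g.
  have := edist_triangle v (meridian (del ord0 v) sx sy) s.
  by move: e1 hs g0; clear; lra.
(* A point nearer than [g] has its profile nearer than [g] too, so [near] applies and the point has
   a unique closest point, hence is not on the medial axis. *)
have lf : (g%:E <= lfs (body (planar K d)) v)%E.
  apply: le_ereal_inf_tmp => _ [u mu <-]; rewrite lee_fin leNgt; apply/negP => lt.
  have lt2 : sqd (hx v) (hy v) (hx u) (hy u) < g ^+ 2.
    apply: (le_lt_trans (profile_sqd v u)).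
    by rewrite ltr_sqr ?nnegrE ?edist_ge0 // ltW.
  have N := nr _ _ lt2; apply: mu.
  have hu : 0 < nrm (del ord0 u).
    have : sqd (hx v) (hy v) (hx u) (hy u) < 1 by case: N => [[]//|[_ h]]; clear -h; lra.
    have := sqr_ge0 (hx v - hx u); rewrite /sqd => h1 h2.
    have h3 : (hy v - hy u) ^+ 2 < 1 by clear -h1 h2; lra.
    have : `|hy v - hy u| < 1.
      by rewrite -ltr_sqr ?nnegrE ?normr_ge0 // real_normK ?num_real // expr1n.
    rewrite ltr_norml => /andP[_]; move: vb; rewrite ler_norml => /andP[].
    by rewrite /hy; clear; lra.
  apply: (closest_unique _ hu).
  - by move=> x y /planar_bounds[].
  - by apply: solid_compact; [exact: solid_planar_closed | exact: planar_bounds].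
  - by exists v.
  - by move=> t a1 b1 a2 b2; apply: plane_unique Pv N.
apply: (@lt_le_trans _ _ ((72 / 100 * g)%:E)).
  apply: (@le_lt_trans _ _ (edist v s)%:E); last by rewrite lte_fin.
  by apply: ereal_inf_lbound; exists s.
by rewrite EFinM; apply: lee_wpmul2l => //; rewrite lee_fin; lra.
Qed.

End SolidSampling.

(** * The hypersurfaces are submanifolds *)

Section SolidManifold.
Variables (R : realType) (m : nat).
Local Notation V := 'rV[R]_(m.+2).
Local Notation body := (@solid R m).

Lemma del_eq n (i k : 'I_n.+1) (v w : 'rV[R]_n.+1) : del i v = del i w -> k != i ->
  v ord0 k = w ord0 k.
Proof.
move=> e; case: (unliftP i k) => [j ->|->]; last by rewrite eqxx.
by move=> _; have := congr1 (fun z : 'rV[R]_n => z ord0 j) e; rewrite !mxE.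
Qed.

Lemma hy_mono (v w : V) (j : 'I_m.+1) : del (lift ord0 j) v = del (lift ord0 j) w ->
  v ord0 (lift ord0 j) ^+ 2 < w ord0 (lift ord0 j) ^+ 2 -> hx v = hx w /\ hy v < hy w.
Proof.
move=> e lt; split; first exact: del_eq e (neq_lift _ _).
rewrite /hy ltrD2r -ltr_sqr ?nnegrE ?nrm_ge0 // !nrm_sqr /dot.
rewrite (bigD1 j) // [X in _ < X](bigD1 j) //=.
rewrite (eq_bigr (fun k => del ord0 w ord0 k * del ord0 w ord0 k)); last first.
  by move=> k kj; rewrite !mxE (del_eq e).
by rewrite ltrD2r -!expr2 !mxE.
Qed.

(** If [psi] increases with the abscissa, the first coordinate serves. Otherwise some other
    coordinate of [p] is nonzero, and [hy] is strictly monotone in it on either side of 0: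
    increasing where it is positive, decreasing where it is negative, whence the change of sign of
    [psi]. *)
Lemma solid_submanifold (P : R -> R -> Prop) :
  (forall x y, P x y -> 0 < 10 + y) -> (forall x y, P x y -> local_graph P x y) ->
  top_submanifold (m.+2 - 1) (body P).
Proof.
move=> Pb lg; rewrite (_ : (m.+2 - 1)%N = m.+1) ?subn1 // => p Pp.
have [N [psi [xd [oN Np cpsi H mono]]]] := lg _ _ Pp.
have cpr (v : V) : {for v, continuous (fun v : V => (hx v, hy v))}.
  by apply: pair_cont; [exact: hx_cont | exact: hy_cont].
have oU : open [set v : V | N (hx v, hy v)].
  by apply: (open_comp (f := fun v : V => (hx v, hy v))) => // v _; exact: cpr.
have cPhi : continuous (fun v : V => psi (hx v) (hy v)).
  apply: contP => v; apply: (@continuous_comp _ _ _ (fun v : V => (hx v, hy v))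
    (fun z : R * R => psi z.1 z.2)); [exact: cpr | exact: cpsi].
case: xd mono => mono.
  apply: (monotone_chart (i := ord0) oU Np Pp cPhi) => [v Nv|v w Nv Nw e lt].
    exact: H.
  by apply: mono => //; rewrite /hy e.
have [j pj] : exists j : 'I_m.+1, p ord0 (lift ord0 j) != 0.
  apply/existsP; apply: contraT; rewrite negb_exists => /forallP h.
  have := Pb _ _ Pp; rewrite /hy shiftB /nrm /dot big1 ?sqrtr0 ?ltxx // => j _.
  by rewrite mxE; have := h j; rewrite negbK => /eqP ->; rewrite mul0r.
have cj : continuous (fun v : V => v ord0 (lift ord0 j)) by exact: coord_continuous.
have c0 : continuous (fun _ : V => (0 : R)) by move=> v; exact: cont_cst.
case: (ltrgtP (p ord0 (lift ord0 j)) 0) pj => // hp _.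
  have oU' : open ([set v : V | N (hx v, hy v)] `&` [set v | v ord0 (lift ord0 j) < 0]).
    by apply: openI => //; exact: open_ltf.
  have cPhi' : continuous (fun v : V => - psi (hx v) (hy v)).
    by apply: contP => v; exact: (contN (cPhi v)).
  apply: (monotone_chart (i := lift ord0 j) oU' _ Pp cPhi') => [//|v [Nv _]|v w [Nv hv] [Nw hw] e lt].
    split=> [/(H _ _ Nv) ->|/eqP]; first by rewrite oppr0.
    by rewrite oppr_eq0 => /eqP/(H _ _ Nv).
  rewrite ltrN2; apply: mono => //.
  have [|-> ?] := @hy_mono w v j (esym e); last by [].
  by move: hv hw lt => /=; clear; move: (v _ _) (w _ _) => a c *; nra.
have oU' : open ([set v : V | N (hx v, hy v)] `&` [set v | 0 < v ord0 (lift ord0 j)]).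
  by apply: openI => //; exact: open_ltf.
apply: (monotone_chart (i := lift ord0 j) oU' _ Pp cPhi) => [//|v [Nv _]|v w [Nv hv] [Nw hw] e lt].
  exact: H.
apply: mono => //; have [|-> ?] := @hy_mono v w j e; last by [].
by move: hv hw lt => /=; clear; move: (v _ _) (w _ _) => a c *; nra.
Qed.

End SolidManifold.

(** * Connected components *)

Section Paths.
Variable R : realType.

Lemma path_component (T : topologicalType) (A : set T) (f : R -> T) (a b s t : R) :
  (forall r, a <= r -> r <= b -> {for r, continuous f}) ->
  (forall r, a <= r -> r <= b -> A (f r)) ->
  a <= s -> s <= b -> a <= t -> t <= b -> connected_component A (f s) (f t).
Proof.
move=> cf Af as' sb at' tb; exists (f @` `[a, b]); last by exists t => //=; rewrite in_itv /= at' tb.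
split.
- by exists s => //=; rewrite in_itv /= as' sb.
- by move=> _ [r /=] + <-; rewrite in_itv /= => /andP[? ?]; exact: Af.
- apply: connected_continuous_connected; first exact: segment_connected.
  apply: continuous_in_subspaceT => r /set_mem /=; rewrite in_itv /= => /andP[? ?].
  exact: cf.
Qed.

Lemma map_component (T U : topologicalType) (A : set T) (B : set U) (f : T -> U) x y :
  continuous f -> (forall z, A z -> B (f z)) -> connected_component A x y ->
  connected_component B (f x) (f y).
Proof.
move=> cf AB [D [Dx DA cD] Dy]; exists (f @` D); last by exists y.
split; first by exists x.
  by move=> _ [z Dz <-]; apply: AB; exact: DA.
apply: connected_continuous_connected => //; exact: continuous_subspaceT.
Qed.

End Paths.

Lemma contP2 (T U : topologicalType) (f : T -> U) :
  (forall x, {for x, continuous f}) -> continuous f.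
Proof. by []. Qed.

(** * Connectedness of the second plane curve *)

Section PlanarConnected.
Variables (R : realType) (K : config R).
Implicit Types x y u v : R.

Local Notation Q := ([set z : R * R | planar K false z.1 z.2]).
Local Notation Z := (11 / 3 + rc K).

Lemma wing_planar u v : wing K false u v -> Q (rx K u v, ry K u v).
Proof.
move=> w; have [v0 vu] := wing_wedge w.
have [h0 h1] := frame_wedge K false v0 vu.
rewrite /= /planar; have [-> ->] := fold_id h0 h1.
by rewrite /= rxK ryK.
Qed.

Lemma refl_point_cont (f g : R -> R) r : {for r, continuous f} -> {for r, continuous g} ->
  {for r, continuous (fun t => (rx K (f t) (g t), ry K (f t) (g t)))}.
Proof.
move=> cf cg; apply: pair_cont; apply: contM; try exact: cont_cst.
  exact: contD.
exact: contB.
Qed.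

Lemma graph_false_start : graph_false K (17 / 12) = 1 / 17.
Proof.
have [xJ1 _] := xJ_bounds K; rewrite graph_false_low; last by clear -K xJ1; lra.
rewrite low_graph2; last by clear; lra.
rewrite (_ : 1 - _ = 0); last by clear; lra.
by rewrite sqrtr0 addr0.
Qed.

Lemma wing_graph_point u : 17 / 12 <= u -> u <= xs K -> wing K false u (graph_false K u).
Proof.
move=> h1 h2; left; case: (eqVneq u (17 / 12)) => [->|ne].
  rewrite graph_false_start; constructor 1; split=> //.
  by apply/andP; split; clear; lra.
have hu : 17 / 12 < u by rewrite lt_neqAle eq_sym ne.
apply/inner_graph_spec => //.
apply: lt_le_trans (graph_false_mono K (lexx _) h1).
by rewrite graph_false_start; clear; lra.
Qed.

Lemma cap_graph_point x : xs K <= x -> x <= Z -> cap K x (cap_graph K x).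
Proof.
have [xs1 _ _ _] := s_bounds K; have [r1 _] := rc_bounds K => h1 h2.
split=> //; first exact: sqrtr_ge0.
rewrite /cap_circle /cap_graph sqr_sqrtr; first by clear; lra.
rewrite subr_ge0 -sqrrN opprB; apply: sqr_le_bound; clear -K xs1 r1 h1 h2; lra.
Qed.

Lemma cap_Q x y : cap K x y -> Q (x, y).
Proof.
move=> c; have c' : wing K true x y by right.
have [y0 yx] := wing_wedge c'; rewrite /= /planar.
by have [-> ->] := fold_id y0 yx; right; rewrite /= rxK ryK.
Qed.

Lemma cap_on_graph x y : cap K x y -> y = cap_graph K x.
Proof.
by case=> _ y0 h; rewrite /cap_graph (sqrt_eq (z := y)) //; rewrite /cap_circle in h; clear -K h; lra.
Qed.

Local Notation conn := (connected_component Q).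

Lemma start_conn v : 0 <= v -> v <= 1 / 17 ->
  conn (rx K (17 / 12) v, ry K (17 / 12) v) (rx K (17 / 12) (1 / 17), ry K (17 / 12) (1 / 17)).
Proof.
move=> v0 v1.
apply: (@path_component _ _ Q (fun v => (rx K (17 / 12) v, ry K (17 / 12) v)) 0 (1 / 17)) => //.
- by move=> r _ _; apply: refl_point_cont; [exact: cont_cst | exact: id].
- by move=> r r0 r1; apply: wing_planar; left; constructor 1; split=> //; apply/andP.
Qed.

Lemma graph_conn u u' : 17 / 12 <= u -> u <= xs K -> 17 / 12 <= u' -> u' <= xs K ->
  conn (rx K u (graph_false K u), ry K u (graph_false K u))
       (rx K u' (graph_false K u'), ry K u' (graph_false K u')).
Proof.
move=> h1 h2 h3 h4.
apply: (@path_component _ _ Q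
  (fun u => (rx K u (graph_false K u), ry K u (graph_false K u))) (17 / 12) (xs K)) => //.
- by move=> r _ _; apply: refl_point_cont; [exact: id | exact: graph_false_cont].
- by move=> r r0 r1; apply: wing_planar; exact: wing_graph_point.
Qed.

Lemma cap_conn x x' : xs K <= x -> x <= Z -> xs K <= x' -> x' <= Z ->
  conn (x, cap_graph K x) (x', cap_graph K x').
Proof.
move=> h1 h2 h3 h4.
apply: (@path_component _ _ Q (fun x => (x, cap_graph K x)) (xs K) Z) => //.
- move=> r _ _; apply: pair_cont; first exact: id.
  by apply: cap_graph_cont; exact: id.
- by move=> r r0 r1; apply: cap_Q; exact: cap_graph_point.
Qed.

Lemma xs_le_Z : xs K <= Z.
Proof. by have [_ xs2 _ _] := s_bounds K; have [r1 _] := rc_bounds K; clear -K xs2 r1; lra. Qed.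

Lemma cap_graph_Z : cap_graph K Z = 0.
Proof.
rewrite /cap_graph (_ : _ - _ = 0) ?sqrtr0 //.
by clear; ring.
Qed.

(** The graph and the cap are paths that meet at [s]; the vertical segment [arc1], which is not part
    of the graph, is joined to it at [(17 / 12, 1 / 17)] in the reflected frame. *)
Lemma wedge_conn x y : 0 <= y -> y <= x -> planar K false x y -> conn (x, y) (Z, 0).
Proof.
move=> y0 yx; rewrite /planar; have [-> ->] := fold_id y0 yx => w.
have [xs1 _ _ _] := s_bounds K; have [sx sy] := refl_s K; have hZ := xs_le_Z.
have h17 : 17 / 12 <= xs K by clear -K xs1; lra.
have capc x' : xs K <= x' -> x' <= Z -> conn (x', cap_graph K x') (Z, 0).
  by move=> h1 h2; have := cap_conn h1 h2 hZ (lexx Z); rewrite cap_graph_Z.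
have grc u : 17 / 12 <= u -> u <= xs K ->
    conn (rx K u (graph_false K u), ry K u (graph_false K u)) (Z, 0).
  move=> h1 h2; apply: connected_component_trans (capc _ (lexx _) hZ).
  have := graph_conn h1 h2 h17 (lexx _).
  have -> : graph_false K (xs K) = ys K.
    rewrite graph_false_cap ?cap_graph_s //.
    by have [_ xJ2] := xJ_bounds K; clear -K xs1 xJ2; lra.
  by rewrite sx sy cap_graph_s.
case: w => [i|]; last first.
  rewrite /= rxK ryK => c; rewrite (cap_on_graph c); have [_ h] := cap_bounds c.
  by case: c => h' _ _; exact: capc.
move: i; rewrite [frx _ _ _ _]/= [fry _ _ _ _]/= => i.
have [u1 u2 v1 v2] := inner_bounds i.
have -> : (x, y) = (rx K (rx K x y) (ry K x y), ry K (rx K x y) (ry K x y)).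
  by rewrite rxK ryK.
move: (rx K x y) (ry K x y) i u1 u2 v1 v2 => u v i u1 u2 v1 v2.
have A1 : arc1 u v -> conn (rx K u v, ry K u v) (Z, 0).
  case=> -> /andP[l1 l2]; apply: connected_component_trans (start_conn l1 l2) _.
  by have := grc _ (lexx _) h17; rewrite graph_false_start.
case: (eqVneq u (17 / 12)) => [uE|ne].
  case: i => a; first exact: A1.
  - apply: A1; split=> //; case: a => _ l h; rewrite v1 /=.
    move: h; rewrite uE => h.
    have : (v - 1 / 17) ^+ 2 = 0 by clear -h; lra.
    by move/eqP; rewrite sqrf_eq0 subr_eq0 => /eqP ->.
  - by case: a => l _ _ _; exfalso; clear -l uE; lra.
  - by case: a => l _ _ _; have [l' _] := xJ_bounds K; exfalso; clear -K l l' uE; lra.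
have hu : 17 / 12 < u by rewrite lt_neqAle eq_sym ne.
case: (eqVneq v 0) => [vE|vn].
  case: i => a; first exact: A1.
  - by case: a => _ l _; exfalso; clear -l vE; lra.
  - by have [l _] := arc3_bounds a; exfalso; clear -K l vE; lra.
  - by have [l _] := arc4_bounds a; have [l' _] := yJ_bounds K; exfalso; clear -K l l' vE; lra.
have v0 : 0 < v by rewrite lt_neqAle eq_sym vn.
have -> : v = graph_false K u by exact: (iffLR (inner_graph_spec hu v0 u2) i).
exact: grc.
Qed.

Lemma planar_connected x y : planar K false x y -> conn (x, y) (Z, 0).
Proof.
have csw : continuous (fun z : R * R => (z.2, z.1)).
  by apply: contP2 => z; apply: pair_cont; [exact: snd_cont | exact: fst_cont].
have cox : continuous (fun z : R * R => (- z.1, z.2)).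
  by apply: contP2 => z; apply: pair_cont; [exact: (contN (@fst_cont _ z)) | exact: snd_cont].
have coy : continuous (fun z : R * R => (z.1, - z.2)).
  by apply: contP2 => z; apply: pair_cont; [exact: fst_cont | exact: (contN (@snd_cont _ z))].
have Qsw z : Q z -> Q (z.2, z.1) by move/planar_swap.
have Qox z : Q z -> Q (- z.1, z.2) by move/planar_opp.
have Qoy z : Q z -> Q (z.1, - z.2) by move/planar_swap/planar_opp/planar_swap.
have sw a b : conn a b -> conn (a.2, a.1) (b.2, b.1) by exact: map_component csw Qsw.
have ox a b : conn a b -> conn (- a.1, a.2) (- b.1, b.2) by exact: map_component cox Qox.
have oy a b : conn a b -> conn (a.1, - a.2) (b.1, - b.2) by exact: map_component coy Qoy.
(* the lobes are linked through the point of the curve on the diagonal *)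
have top : conn (0, Z) (Z, 0).
  have d0 : conn (rx K (17 / 12) 0, ry K (17 / 12) 0) (Z, 0).
    have w : wing K false (17 / 12) 0.
      by left; constructor 1; split=> //; apply/andP; split; clear; lra.
    have [w0 w1] := wing_wedge w; have [h0 h1] := frame_wedge K false w0 w1.
    by apply: wedge_conn => //; exact: (wing_planar w).
  have e : rx K (17 / 12) 0 = ry K (17 / 12) 0 := axis_frame K (17 / 12).
  rewrite e in d0; apply: (connected_component_trans _ d0).
  by apply: connected_component_sym; exact: (sw _ _ d0).
have quad a c : 0 <= a -> 0 <= c -> planar K false a c -> conn (a, c) (Z, 0).
  move=> a0 c0 P; case: (lerP c a) => h; first exact: wedge_conn.
  apply: connected_component_trans top.
  by apply: (sw (c, a) (Z, 0)); apply: wedge_conn => //; [exact: ltW | exact/planar_swap].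
have half a c : 0 <= a -> planar K false a c -> conn (a, c) (Z, 0).
  move=> a0 P; case: (lerP 0 c) => c0; first exact: quad.
  have := oy (a, - c) (Z, 0); rewrite /= opprK oppr0; apply; apply: quad => //.
    by rewrite oppr_ge0 ltW.
  by apply/planar_swap; apply/planar_opp; rewrite opprK; apply/planar_swap.
move=> P; case: (lerP 0 x) => x0; first exact: half.
have left : conn (- Z, 0) (Z, 0).
  apply: (connected_component_trans _ top); apply: connected_component_sym.
  by have := ox _ _ top; rewrite /= oppr0.
apply: connected_component_trans left.
have := ox (- x, y) (Z, 0); rewrite /= opprK; apply; apply: half.
  by rewrite oppr_ge0 ltW.
by apply/planar_opp; rewrite opprK.
Qed.

End PlanarConnected.

(** * Counting components after revolution *)

Section Components.
Variables (R : realType) (K : config R) (m : nat).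
Local Notation V := 'rV[R]_(m.+2).
Local Notation body := (@solid R m).
Local Notation C := (body (planar K true)).
Local Notation C' := (body (planar K false)).

Lemma not_card_eq_pigeonhole (T : Type) (U : pointedType) (A : set T) (B : set U) (a1 a2 a3 : T) (b1 b2 : U) :
  A a1 -> A a2 -> A a3 -> a1 <> a2 -> a1 <> a3 -> a2 <> a3 ->
  (forall b, B b -> b = b1 \/ b = b2) -> ~ card_eq A B.
Proof.
move=> A1 A2 A3 n12 n13 n23 Bb AB; have [f [fB fI _]] := elimT card_set_bijP AB.
have inj a a' : A a -> A a' -> f a = f a' -> a = a' by move=> ? ?; apply: fI; exact: mem_set.
have [e1|e1] := Bb _ (fB _ A1); have [e2|e2] := Bb _ (fB _ A2);
  have [e3|e3] := Bb _ (fB _ A3).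
all: by [case: n12; apply: inj; rewrite ?e1|case: n13; apply: inj; rewrite ?e1
  |case: n23; apply: inj; rewrite ?e2].
Qed.

Lemma connected_component_value (T : topologicalType) (A : set T) (f : T -> R) (c : R) x y :
  continuous f -> (forall z, A z -> f z != c) -> f x < c -> c < f y ->
  ~ connected_component A x y.
Proof.
move=> cf Ac fx fy [D [Dx DA cD] Dy].
have /connected_intervalP i : connected (f @` D).
  by apply: connected_continuous_connected => //; exact: continuous_subspaceT.
have [z Dz e] : (f @` D) c.
  by apply: (i (f x) (f y)); [exists x|exists y|rewrite (ltW fx) (ltW fy)].
by have := Ac z (DA _ Dz); rewrite e eqxx.
Qed.

(* each lobe around a coordinate axis is confined to a strip disjoint from the others *)
Lemma planar_true_gap x y : planar K true x y -> `|x| != 24 / 17.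
Proof.
rewrite /planar /= => w; have h := wing_xge w.
have l : fy x y <= 45 / 32.
  have [_ r2] := rc_bounds K; have [_ _ _ ys2] := s_bounds K.
  case: w => [/inner_bounds[_ _ _ k]|/cap_bounds[k _]]; clear -K k r2 ys2; lra.
move: h l; rewrite /fx /fy; case: (lerP `|x| `|y|) => _ h l; apply/eqP => e.
  by clear -e l; lra.
by clear -e h; lra.
Qed.

Lemma scale_continuous n (T : topologicalType) (c : T -> R) (u : T -> 'rV[R]_n) t :
  {for t, continuous c} -> (forall j, {for t, continuous (fun s => u s ord0 j)}) ->
  {for t, continuous (fun s => c s *: u s)}.
Proof.
move=> cc cu; apply: row_continuous => j.
rewrite (_ : (fun _ => _) = fun s => c s * u s ord0 j); last by apply/funext => s; rewrite mxE.
exact: contM.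
Qed.

Lemma meridian_continuous w : continuous (fun z : R * R => meridian w z.1 z.2 : V).
Proof.
apply: contP2 => z; apply: ins_continuous; first exact: fst_cont.
apply: scale_continuous => [|j]; last exact: cont_cst.
apply: contM; last exact: cont_cst.
by apply: contD; [exact: cont_cst | exact: snd_cont].
Qed.

Lemma planar_shift_gt0 d x y : planar K d x y -> 0 < 10 + y.
Proof. by case/planar_bounds => _; rewrite ler_norml => /andP[h _]; clear -h; lra. Qed.

(** Two opposite directions. The segment from a nonzero [w] to the pole chosen by the sign of its
    first coordinate avoids 0, so two poles suffice in every dimension, including the plane, where
    there are only two directions. *)
Definition pole (s : bool) : 'rV[R]_m.+1 := (-1) ^+ s *: delta_mx ord0 ord0.

Lemma pole_coord s : pole s ord0 ord0 = (-1) ^+ s.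
Proof. by rewrite !mxE !eqxx mulr1. Qed.

Lemma nrm_gt0 n (w : 'rV[R]_n) j : w ord0 j != 0 -> 0 < nrm w.
Proof.
move=> wj; rewrite lt_neqAle nrm_ge0 andbT eq_sym; apply/eqP => /nrm_eq0 e.
by move: wj; rewrite e mxE eqxx.
Qed.

Lemma pole_gt0 s : 0 < nrm (pole s).
Proof. by apply: (@nrm_gt0 _ _ ord0); rewrite pole_coord signr_eq0. Qed.

Lemma connect_pole d v : body (planar K d) v -> exists s,
  connected_component (body (planar K d)) v (meridian (pole s) (hx v) (hy v)).
Proof.
move=> Pv; set w := del ord0 v.
have w0 : 0 < nrm w.
  have := planar_shift_gt0 Pv; rewrite /hy -/w; clear -K m; lra.
pose s := w ord0 ord0 < 0; exists s.
pose u t := (1 - t) *: w + t *: pole s.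
have u0 t : 0 <= t -> t <= 1 -> 0 < nrm (u t).
  move=> t0 t1; case: (eqVneq t 0) => [->|tn].
    by rewrite /u subr0 scale1r scale0r addr0.
  have tp : 0 < t by rewrite lt_neqAle eq_sym tn.
  apply: (@nrm_gt0 _ _ ord0); rewrite mxE [in X in X + _]mxE [in X in _ + X]mxE pole_coord.
  rewrite /s; case: (ltrP (w ord0 ord0) 0) => h; rewrite ?expr0 ?expr1.
    have : (1 - t) * w ord0 ord0 <= 0 by rewrite mulr_ge0_le0 ?subr_ge0 // ltW.
    by move=> k; apply/eqP => e; clear -k e tp; lra.
  have : 0 <= (1 - t) * w ord0 ord0 by rewrite mulr_ge0 ?subr_ge0.
  by move=> k; apply/eqP => e; clear -k e tp; lra.
pose f t := meridian (u t) (hx v) (hy v).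
have f0 : f 0 = v.
  rewrite /f /u subr0 scale1r scale0r addr0 /meridian /= /hy -/w shiftB divff ?gt_eqF //.
  by rewrite scale1r ins_del.
have f1 : f 1 = meridian (pole s) (hx v) (hy v).
  by rewrite /f /u subrr scale1r scale0r add0r.
rewrite -{1}f0 -f1.
apply: (@path_component _ _ _ f 0 1) => //; last first.
  move=> t t0 t1; have [ex ey] := @meridian_profile R m (u t) (hx v) (hy v) (u0 _ t0 t1)
    (ltW (planar_shift_gt0 Pv)).
  by rewrite /solid /= ex ey.
move=> t t0 t1; have uc j : {for t, continuous (fun t => u t ord0 j)}.
  rewrite (_ : (fun _ => _) = fun t => (1 - t) * w ord0 j + t * pole s ord0 j); last first.
    by apply/funext => t'; rewrite [LHS]mxE [in X in X + _]mxE [in X in _ + X]mxE.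
  by apply: contD; apply: contM; try exact: cont_cst; [apply: contB; [exact: cont_cst|]|];
    exact: id.
apply: ins_continuous; first exact: cont_cst.
apply: scale_continuous => //; apply: contM; first exact: cont_cst.
apply: contV; first by rewrite gt_eqF // u0.
apply: nrm_continuous.
rewrite (_ : u = fun t => 1 *: u t); last by apply/funext => t'; rewrite scale1r.
by apply: scale_continuous => //; exact: cont_cst.
Qed.

Lemma false_components B : components C' B ->
  B = connected_component C' (meridian (pole true) (11 / 3 + rc K) 0) \/
  B = connected_component C' (meridian (pole false) (11 / 3 + rc K) 0).
Proof.
move=> [v Pv <-]; have [s cs] := connect_pole Pv.
have c : connected_component C' v (meridian (pole s) (11 / 3 + rc K) 0).
  apply: connected_component_trans cs _.
  apply: (map_component (@meridian_continuous (pole s)) _ (planar_connected Pv)) => z Qz.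
  have [ex ey] := meridian_profile z.1 (pole_gt0 s) (ltW (planar_shift_gt0 Qz)).
  by rewrite /solid /= ex ey.
by move: c; case: s {cs} => /same_connected_component ->; [left|right].
Qed.

Lemma true_lobe a c : fx a c = 17 / 12 -> fy a c = 0 -> exists v, C v /\ hx v = a.
Proof.
move=> ex ey; have Q : planar K true a c.
  rewrite /planar /= ex ey; left; constructor 1; split=> //.
  by apply/andP; split; clear -K m; lra.
have [hX hY] := meridian_profile a (pole_gt0 true) (ltW (planar_shift_gt0 Q)).
by exists (meridian (pole true) a c); rewrite /solid /= hX hY.
Qed.

Lemma components_differ : ~ card_eq (components C) (components C').
Proof.
have a0 : `|17 / 12| = 17 / 12 :> R by rewrite ger0_norm //; clear -K m; lra.
have l0 : (0 : R) <= 17 / 12 by clear -K m; lra.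
(* The innermost points of the left, the upper and the right lobe. *)
have [v1 [P1 h1]] : exists v, C v /\ hx v = - (17 / 12).
  by apply: (@true_lobe _ 0); rewrite /fx /fy normrN normr0 a0 ?max_l ?min_r.
have [v2 [P2 h2]] : exists v, C v /\ hx v = 0.
  by apply: (@true_lobe _ (17 / 12)); rewrite /fx /fy normr0 a0 ?max_r ?min_l.
have [v3 [P3 h3]] : exists v, C v /\ hx v = 17 / 12.
  by apply: (@true_lobe _ 0); rewrite /fx /fy normr0 a0 ?max_l ?min_r.
(* The separating value 24/17 lies between 45/32, which bounds the half-width of a lobe, and 17/12,
   the distance of a lobe from the centre. *)
have k0 : (0 : R) <= 24 / 17 by clear -K m; lra.
have gp v : C v -> hx v != 24 / 17.
  by move/planar_true_gap; apply: contra_neq => ->; rewrite ger0_norm.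
have gn v : C v -> hx v != - (24 / 17).
  by move/planar_true_gap; apply: contra_neq => ->; rewrite normrN ger0_norm.
have cx : continuous (@hx R m) by exact: contP (@hx_cont R m).
have ne v w c : (forall u, C u -> hx u != c) -> C v -> C w -> hx v < c -> c < hx w ->
    connected_component C v <> connected_component C w.
  move=> Hc Pv Pw l r e; apply: (connected_component_value cx Hc l r).
  by rewrite e; exact: connected_component_refl.
apply: (@not_card_eq_pigeonhole _ _ _ _ _ _ _ _ _ _ _ _ _ _ _ false_components).
- by exists v1; [exact: P1|].
- by exists v2; [exact: P2|].
- by exists v3; [exact: P3|].
- by apply: (ne _ _ _ gn) => //; rewrite ?h1 ?h2; clear -K m; lra.
- by apply: (ne _ _ _ gn) => //; rewrite ?h1 ?h3; clear -K m; lra.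
- by apply: (ne _ _ _ gp) => //; rewrite ?h2 ?h3; clear -K m; lra.
Qed.

End Components.
Theorem theorem5p1 (R : realType) (d : nat) (hd : (2 <= d)%N) :
  exists (S C C' : set 'rV[R]_d),
    [/\ compact C /\ compact C',
        top_submanifold (d - 1) C /\ top_submanifold (d - 1) C',
        ~ card_eq (components C) (components C'),
        S `<=` C `&` C' &
        eps_sample (72 / 100) S C /\ eps_sample (72 / 100) S C'].
Proof.
case: d hd => [|[|m]] // _.
have [K] := config_exists R.
have [x0 [x1 [sP sam]]] := planar_sampling K.
have d0 : (0 : R) < (18 / 25 - 41 / 57) / 20 by lra.
have cT : compact (@solid R m (sample_set K x0 x1)).
  apply: solid_compact; first exact: solid_sample_closed.
  by move=> x y T; exact: planar_bounds (sP true _ _ T).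
have [S [finS ST net]] := finite_net cT d0.
have cP e : compact (@solid R m (planar K e)).
  by apply: solid_compact; [exact: solid_planar_closed | exact: planar_bounds].
have sub e : top_submanifold (m.+2 - 1) (@solid R m (planar K e)).
  by apply: solid_submanifold; [exact: planar_shift_gt0 | exact: planar_charts].
have eps e : eps_sample (72 / 100) S (@solid R m (planar K e)).
  exact: solid_eps_sample sP (sam e) finS net.
exists S, (solid (planar K true)), (solid (planar K false)).
split; [by []|by []|exact: components_differ| |by []].
by move=> v /ST T; split; exact: sP T.
Qed.
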